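(* In the setting described in the context, with $k$ a fixed positive integer and $\Gamma$ acting as described there: for every smooth function $f$ on $\mathcal M$ (independent of $\sigma\in\mathcal T$), with multiplication operator $\mathcal C_f(\psi)=f\psi$, there exists a solution $\mathcal R^{(1)}(\mathcal C_f)\colon\mathcal T\to\mathrm D_k$ (a smooth map) of the first step of the recursion, $$d^F_{\mathcal T}\mathcal R^{(1)}(\mathcal C_f)=\frac i2\bigl[b+\overline b,\ \mathcal C_f\bigr],$$ and it can be chosen $\Gamma$-invariantly, i.e. such that $\gamma\cdot\bigl(\mathcal R^{(1)}(\mathcal C_f)_\sigma\bigr)=\mathcal R^{(1)}(\gamma\cdot\mathcal C_f)_{\gamma\sigma}$ for all $\gamma\in\Gamma$, $\sigma\in\mathcal T$ and $f$. Moreover, for this solution, $$\tilde{\boldsymbol\nabla}^{\mathrm{End}}\bigl(\mathcal C_f+\mathcal R^{(1)}(\mathcal C_f)\,s^{-1}\bigr)=o\bigl(|t|^{-1}\bigr)$$ as $s\to\infty$ with $k$ fixed, $t=k+is$.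
   Context: Setting. $(\mathcal M,\omega)$ is a symplectic manifold with $H^1(\mathcal M,\mathbb R)=0$ and with a pre-quantum line bundle $\mathscr L$, i.e. a Hermitian line bundle with compatible connection $\nabla$ of curvature $-i\omega$; $\mathscr L^k=\mathscr L^{\otimes k}$. $\mathcal T$ is a complex manifold and $J\colon\mathcal T\to C^\infty(\mathcal M,\operatorname{End}(T\mathcal M))$ is a smooth family of integrable almost complex structures such that, for each $\sigma\in\mathcal T$, $J_\sigma$, $\omega$ and $g_\sigma=\omega(\cdot,J_\sigma\cdot)$ form a Kähler structure; $(\mathcal M,J_\sigma)$ has no non-constant holomorphic functions and no non-zero holomorphic vector fields. $d_{\mathcal T}$ is the exterior differential on $\mathcal T$, $d$ that on $\mathcal M$. There is given a Ricci potential: a real-valued smooth function $F$ on $\mathcal M\times\mathcal T$ and a real constant $\lambda$ such that, for each $\sigma$, $2i\partial\overline\partial F=\rho-\lambda\omega$ on $\mathcal M$, with $\rho$ the Ricci form of $g_\sigma$. For $V$ tangent to $\mathcal T$, let $\tilde g$ be the inverse of $g$ and $\tilde G(V)=-V[\tilde g]$, which decomposes as $\tilde G(V)=G(V)+\overline G(V)$ into parts of type $(2,0)$ and $(0,2)$ on $\mathcal M$. It is assumed that $J$ is holomorphic ($G$ is a $(1,0)$-form and $\overline G$ a $(0,1)$-form on $\mathcal T$) and rigid ($G(V)$ is a holomorphic tensor field on $\mathcal M$ for every $V$). For a symmetric bivector field $B$ on $\mathcal M$ put $\Delta_B=\nabla^2_B+\nabla_{\delta B}$ acting on sections of $\mathscr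 L^k$, where $\nabla^2_B=B^{\mu\nu}\nabla_\mu\nabla_\nu$ (using the Levi-Civita connection and the connection on $\mathscr L^k$) and $(\delta B)^\nu=\nabla_\mu B^{\mu\nu}$. Writing $V=V'+V''$ for the decomposition into $(1,0)$ and $(0,1)$ parts on $\mathcal T$, define the operator-valued $1$-forms on $\mathcal T$ $$b(V)=\Delta_{G(V)}+2\nabla_{G(V)\cdot dF}-2\lambda V'[F],\qquad \overline b(V)=\Delta_{\overline G(V)}+2\nabla_{\overline G(V)\cdot dF}-2\lambda V''[F].$$ For $t=k+is$, $s\in\mathbb R$, the Hitchin-Witten connection is $\tilde{\boldsymbol\nabla}=\nabla^{\mathrm{Tr}}+\frac1{2t}b-\frac1{2\overline t}\overline b+d_{\mathcal T}F$ on $C^\infty(\mathcal M,\mathscr L^k)\times\mathcal T\to\mathcal T$ ($\nabla^{\mathrm{Tr}}$ the trivial connection), and the induced connection on operators depending smoothly on $\sigma$ is $$\tilde{\boldsymbol\nabla}^{\mathrm{End}}D=d^F_{\mathcal T}D+\frac1{2t}[b,D]-\frac1{2\overline t}[\overline b,D],\qquad d^F_{\mathcal T}D=d_{\mathcal T}D+[d_{\mathcal T}F,D],$$ functions being identified with their multiplication operators. $\mathrm D_k$ is the algebra of finite-order differential operators acting on $C^\infty(\mathcal M,\mathscr L^k)$. A map $D\colon\mathcal T\to\mathrm D_k$ is smooth if $D\psi$ is smooth on $\mathcal M\times\mathcal T$ for every smooth section $\psi$. Convergence. All families of operators in question are, at each $\sigma$ and after evaluation on a vector $V$ on $\mathcal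 T$, finite sums $\sum_j c_j(s)D_j$ with scalar functions $c_j$ and $s$-independent $D_j\in\mathrm D_k$, hence lie in a fixed finite-dimensional subspace of $\mathrm D_k$. Such a family is $o(|t|^{-1})$ if $|t|$ times it tends to $0$. The limit may be taken in a Sobolev operator norm, in the sup-norm of the total symbol, or strongly in $L^2$ on each smooth section; whenever finite, these all agree with convergence in the finite-dimensional subspace. Group action. A group $\Gamma$ acts on $\mathcal T$ by biholomorphisms and on $\mathcal M$ by symplectomorphisms lifted to $\mathscr L$ (preserving Hermitian structure and connection), so that $J$ is equivariant: $\gamma\colon(\mathcal M,J_\sigma)\to(\mathcal M,J_{\gamma\sigma})$ is holomorphic. $\Gamma$ acts on $\mathrm D_k$ by conjugation, $\gamma\cdot D=\gamma D\gamma^{-1}$; in particular $\gamma\cdot\mathcal C_f=\mathcal C_{f\circ\gamma^{-1}}$. *)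

(* Defs.v *)
From HB Require Import structures.
From mathcomp Require Import all_boot all_order all_algebra.
From mathcomp Require Import complex.
From mathcomp Require Import all_classical all_reals all_analysis.
Import Order.TTheory GRing.Theory Num.Theory.
Import numFieldNormedType.Exports.

Set Implicit Arguments.
Unset Strict Implicit.
Unset Printing Implicit Defensive.

Local Open Scope classical_set_scope.
Local Open Scope ring_scope.

(******************************************************************************)
(* The real numbers are an arbitrary R : realType, and C := R[i].             *)
(* - An atlas is indexed by the points of the manifold: it provides, for each *)
(*   x, a chart around x. Any smooth structure is given by such an atlas.     *)
(* - The tangent space at x is R^m through the chart at x, and its            *)
(*   complexification is C^m. Tangent vectors and covectors at x are row      *)
(*   vectors, so that a covector a pairs with a vector v to v *m a^T, an      *)
(*   endomorphism A sends v to v *m A, a 2-form or metric A has value         *)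
(*   v *m A *m w^T on (v, w) and a bivector B has value a *m B *m b^T on      *)
(*   (a, b). The contraction B.a is the vector a *m B.                        *)
(* - Likewise, the fibre at x of the Hermitian line bundle (and of its powers)*)
(*   is C, through the value at x of a unitary frame given around x.          *)
(* - Functions, vector fields and sections are total functions on M;          *)
(*   smoothness is always relative to an open set W.                          *)
(******************************************************************************)

Section Calculus.
Variable R : realType.

(* For finite-dimensional V and open U, this is C^n regularity on U. *)
Fixpoint Ck (V W : normedModType R) (n : nat) (U : set V) (f : V -> W) : Prop :=
  match n with
  | 0 => forall x, U x -> {for x, continuous f}
  | n'.+1 => (forall x, U x -> differentiable f x) /\
             forall v : V, Ck n' U (fun x => 'D_v f x)
  end.

Definition smooth (V W : normedModType R) (U : set V) (f : V -> W) : Prop :=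
  forall n, Ck n U f.

Definition csmooth (V : normedModType R) (U : set V) (f : V -> R[i]) : Prop :=
  smooth U (fun x => complex.Re (f x) : R^o) /\
  smooth U (fun x => complex.Im (f x) : R^o).

Definition cderive (V : normedModType R) (f : V -> R[i]) (x v : V) : R[i] :=
  Complex ('D_v (fun y => complex.Re (f y) : R^o) x)
          ('D_v (fun y => complex.Im (f y) : R^o) x).

Record atlas (E : normedModType R) (M : topologicalType) := Atlas {
  dom : M -> set M ;
  chart : M -> M -> E ;
  param : M -> E -> M ;
  dom_open : forall x, open (dom x) ;
  dom_self : forall x, dom x x ;
  chartK : forall x y, dom x y -> param x (chart x y) = y ;
  chart_open : forall x, open (chart x @` dom x) ;
  chart_continuous : forall x y, dom x y -> {for y, continuous (chart x)} ;
  param_continuous : forall x z, (chart x @` dom x) z ->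
    {for z, continuous (param x)} ;
  transition_smooth : forall x y,
    smooth (chart x @` (dom x `&` dom y)) (chart y \o param x) ;
  atlas_hausdorff : hausdorff_space M ;
  atlas_second_countable : @second_countable M }.

(* C^p as a real normed space of pairs (real part, imaginary part). *)
Definition cspace (p : nat) : normedModType R := ('rV[R]_p * 'rV[R]_p)%type.
Definition imul (p : nat) (v : cspace p) : cspace p := (- v.2, v.1).

(* The transition maps are holomorphic: their differentials are C-linear. *)
Record complex_atlas (p : nat) (T : topologicalType) := ComplexAtlas {
  real_atlas :> atlas (cspace p) T ;
  transition_holo : forall x y z,
    (chart real_atlas x @` (dom real_atlas x `&` dom real_atlas y)) z ->
    forall v, 'D_(imul v) (chart real_atlas y \o param real_atlas x) z =
              imul ('D_v (chart real_atlas y \o param real_atlas x) z) }.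

Definition smooth_map (E E' : normedModType R) (M M' : topologicalType)
    (A : atlas E M) (A' : atlas E' M') (phi : M -> M') : Prop :=
  continuous phi /\
  forall x y, smooth (chart A x @` (dom A x `&` phi @^-1` dom A' y))
                     (chart A' y \o phi \o param A x).

(* Smoothness on T x W for a function of a pair of points. *)
Definition smooth_prod (E E' : normedModType R) (T M : topologicalType)
    (A' : atlas E' T) (A : atlas E M) (W : set M) (u : T -> M -> R[i]) : Prop :=
  forall tau x,
    csmooth ((chart A' tau @` dom A' tau) `*` (chart A x @` (dom A x `&` W)))
            (fun z : (E' * E)%type => u (param A' tau z.1) (param A x z.2)).

(* Derivative along the tangent vector at sigma with components V in the chart
   at sigma; every tangent vector is of this form. *)
Definition dT (E : normedModType R) (T : topologicalType) (A : atlas E T)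
    (sigma : T) (V : E) (u : T -> R[i]) : R[i] :=
  cderive (u \o param A sigma) (chart A sigma sigma) V.

Definition tangent_map (E E' : normedModType R) (M M' : topologicalType)
    (A : atlas E M) (A' : atlas E' M') (phi : M -> M') (x : M) (v : E) : E' :=
  'D_v (chart A' (phi x) \o phi \o param A x) (chart A x x).

End Calculus.

Section Tensors.
Variables (R : realType) (m : nat) (M : topologicalType) (A : atlas 'rV[R]_m M).
Local Notation C := R[i].
Local Notation vfield := (M -> 'rV[C]_m).
Local Notation cx := (map_mx (real_complex R)).

Definition pairing (v a : 'rV[C]_m) : C := (v *m a^T) 0 0.
Definition form (B : 'M[C]_m) (v w : 'rV[C]_m) : C := (v *m B *m w^T) 0 0.

Definition smooth_on (W : set M) (f : M -> C) : Prop :=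
  forall x, csmooth (chart A x @` (dom A x `&` W)) (f \o param A x).

(* The differential of f at x. *)
Definition diff (f : M -> C) (x : M) : 'rV[C]_m :=
  \row_i cderive (f \o param A x) (chart A x x) (delta_mx 0 i).

(* The derivative X[f]. *)
Definition vder (X : vfield) (f : M -> C) (x : M) : C := pairing (X x) (diff f x).

(* The coordinate functions and the coordinate vector fields of the chart at x;
   the values of these outside dom A x are irrelevant. *)
Definition coord (x : M) (i : 'I_m) (y : M) : C := (chart A x y 0 i)%:C%C.
Definition dcoord (x : M) (i : 'I_m) : vfield :=
  fun y => cx ('D_(delta_mx 0 i) (chart A y \o param A x) (chart A x y)).

Definition smooth_vfield (W : set M) (X : vfield) : Prop :=
  forall x i, smooth_on (dom A x `&` W) (vder X (coord x i)).

(* Components of a tensor in the chart at x, as functions near x: an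
   endomorphism, a covector, a twice covariant tensor, a bivector. *)
Definition endo_comp (x : M) (B : M -> 'M[C]_m) (i j : 'I_m) (y : M) : C :=
  pairing (dcoord x i y *m B y) (diff (coord x j) y).
Definition cov_comp (x : M) (a : vfield) (i : 'I_m) (y : M) : C :=
  pairing (dcoord x i y) (a y).
Definition form_comp (x : M) (B : M -> 'M[C]_m) (i j : 'I_m) (y : M) : C :=
  form (B y) (dcoord x i y) (dcoord x j y).
Definition bivector_comp (x : M) (B : M -> 'M[C]_m) (i j : 'I_m) (y : M) : C :=
  form (B y) (diff (coord x i) y) (diff (coord x j) y).

Definition jacobian (phi : M -> M) (x : M) : 'M[R]_m :=
  \matrix_(i, j) (tangent_map A A phi x (delta_mx 0 i)) 0 j.

(* The Lie bracket, computed in the chart at x. *)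
Definition bracket (X Y : vfield) : vfield := fun x =>
  \row_i (vder X (vder Y (coord x i)) x - vder Y (vder X (coord x i)) x).

(* The exterior differential of a 1-form. *)
Definition ext_d (a : vfield) (x : M) : 'M[C]_m :=
  \matrix_(i, j) (diff (cov_comp x a j) x 0 i - diff (cov_comp x a i) x 0 j).

(* H^1(M, R) = 0 for de Rham cohomology. *)
Definition H1_zero : Prop :=
  forall a : M -> 'rV[R]_m,
    (forall x i, smooth_on (dom A x) (cov_comp x (cx \o a) i)) ->
    (forall x, ext_d (cx \o a) x = 0) ->
    exists2 f : M -> R, smooth_on setT (fun x => (f x)%:C%C) &
      forall x, diff (fun y => (f y)%:C%C) x = cx (a x).

Definition symplectic (omega : M -> 'M[R]_m) : Prop :=
  [/\ forall x i j, smooth_on (dom A x) (form_comp x (cx \o omega) i j),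
      forall x, (omega x)^T = - omega x,
      forall x, omega x \in unitmx &
      forall x i j l,
        diff (form_comp x (cx \o omega) j l) x 0 i +
        diff (form_comp x (cx \o omega) l i) x 0 j +
        diff (form_comp x (cx \o omega) i j) x 0 l = 0].

Definition is_connection (D : vfield -> vfield -> vfield) : Prop :=
  forall W, open W -> forall X X' Y Y' f,
    smooth_vfield W X -> smooth_vfield W X' ->
    smooth_vfield W Y -> smooth_vfield W Y' -> smooth_on W f ->
    smooth_vfield W (D X Y) /\
    forall x, W x ->
      [/\ D (fun y => X y + X' y) Y x = D X Y x + D X' Y x,
          D (fun y => f y *: X y) Y x = f x *: D X Y x,
          D X (fun y => Y y + Y' y) x = D X Y x + D X Y' x &
          D X (fun y => f y *: Y y) x = vder X f x *: Y x + f x *: D X Y x].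

(* The Levi-Civita connection of g, acting on complex vector fields defined on
   open sets; its values at the points where its arguments are smooth are
   uniquely determined by g. *)
Definition is_levi_civita (g : M -> 'M[R]_m) (D : vfield -> vfield -> vfield) :
    Prop :=
  is_connection D /\
  forall W, open W -> forall X Y Z,
    smooth_vfield W X -> smooth_vfield W Y -> smooth_vfield W Z ->
    forall x, W x ->
      D X Y x - D Y X x = bracket X Y x /\
      vder X (fun y => form (cx (g y)) (Y y) (Z y)) x =
        form (cx (g x)) (D X Y x) (Z x) + form (cx (g x)) (Y x) (D X Z x).

Definition curvature (D : vfield -> vfield -> vfield) (X Y Z : vfield) : vfield :=
  fun x => D X (D Y Z) x - D Y (D X Z) x - D (bracket X Y) Z x.

(* Ric(Y, Z) = tr (X |-> R(X, Y) Z). *)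
Definition ricci (D : vfield -> vfield -> vfield) (x : M) : 'M[C]_m :=
  \matrix_(i, j) \sum_l curvature D (dcoord x l) (dcoord x i) (dcoord x j) x 0 l.

Definition christoffel (D : vfield -> vfield -> vfield) (x : M) (i j l : 'I_m) : C :=
  D (dcoord x i) (dcoord x j) x 0 l.

(* (delta B)^n = nabla_l B^(l n), in the chart at x. *)
Definition div_bivector (D : vfield -> vfield -> vfield) (B : M -> 'M[C]_m) :
    vfield := fun x =>
  \row_n \sum_l (diff (bivector_comp x B l n) x 0 l +
    \sum_q (christoffel D x l q l * B x q n + christoffel D x l q n * B x l q)).

Section AlmostComplex.
Variable J : M -> 'M[R]_m.
Local Notation Jc := (cx \o J).

(* Projections of complex tangent vectors to the types (1,0) and (0,1). For a
   covector a, the part of type (1,0) is a *m (P10 x)^T. *)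
Definition P10 (x : M) : 'M[C]_m := 2^-1 *: (1%:M - 'i%C *: Jc x).
Definition P01 (x : M) : 'M[C]_m := 2^-1 *: (1%:M + 'i%C *: Jc x).

Definition holomorphic_on (W : set M) (h : M -> C) : Prop :=
  smooth_on W h /\
  forall x, W x -> forall v : 'rV[C]_m,
    pairing (v *m Jc x) (diff h x) = 'i%C * pairing v (diff h x).

Definition almost_complex : Prop := forall x, J x *m J x = - 1%:M.

(* Vanishing of the Nijenhuis tensor. *)
Definition integrable : Prop :=
  forall W, open W -> forall X Y, smooth_vfield W X -> smooth_vfield W Y ->
    forall x, W x ->
      let JX := fun y => X y *m Jc y in
      let JY := fun y => Y y *m Jc y in
      bracket X Y x + bracket JX Y x *m Jc x + bracket X JY x *m Jc x
        - bracket JX JY x = 0.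

(* g(v, w) = omega(v, J w). *)
Definition metric (omega : M -> 'M[R]_m) (x : M) : 'M[R]_m :=
  omega x *m (J x)^T.

Definition kahler (omega : M -> 'M[R]_m) : Prop :=
  [/\ almost_complex, integrable,
      forall x, (metric omega x)^T = metric omega x &
      forall x (v : 'rV[R]_m), v != 0 -> 0 < (v *m metric omega x *m v^T) 0 0].

(* A vector field of type (1,0) is holomorphic when its components in local
   holomorphic coordinates are, i.e., when it preserves local holomorphic
   functions. *)
Definition holomorphic_vfield (Z : vfield) : Prop :=
  [/\ smooth_vfield setT Z, forall x, Z x *m Jc x = 'i%C *: Z x &
      forall W, open W -> forall h, holomorphic_on W h ->
        holomorphic_on W (vder Z h)].

(* The same for a bivector field of type (2,0), with components B(dz^i, dz^j). *)
Definition holomorphic_bivector (B : M -> 'M[C]_m) : Prop :=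
  forall W, open W -> forall h1 h2,
    holomorphic_on W h1 -> holomorphic_on W h2 ->
    holomorphic_on W (fun x => form (B x) (diff h1 x) (diff h2 x)).

Definition dbar (f : M -> C) : vfield := fun x => diff f x *m (P01 x)^T.

(* The (1,1) part of d (dbar f). *)
Definition ddbar (f : M -> C) (x : M) : 'M[C]_m :=
  P10 x *m ext_d (dbar f) x *m (P01 x)^T +
  P01 x *m ext_d (dbar f) x *m (P10 x)^T.

(* rho(v, w) = Ric(J v, w). *)
Definition ricci_form (D : vfield -> vfield -> vfield) (x : M) : 'M[C]_m :=
  Jc x *m ricci D x.

End AlmostComplex.

(* A Hermitian line bundle L with, around each x, a unitary frame e_x on
   dom A x: e_x(y) = frame x y . e_y(y). A section of L^k is represented by its
   component psi(y) with respect to e_y(y)^k, so that its local component in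
   the frame e_x^k is psi(y) / (frame x y)^k. *)
Record hermitian_line_bundle := HermitianLineBundle {
  frame : M -> M -> C ;
  frame_self : forall x, frame x x = 1 ;
  frame_unitary : forall x y, dom A x y -> `|frame x y| = 1 ;
  frame_smooth : forall x y,
    csmooth (chart A x @` (dom A x `&` dom A y))
            ((fun z => frame y z / frame x z) \o param A x) }.

Section LineBundle.
Variable L : hermitian_line_bundle.

Definition local_comp (k : nat) (x : M) (psi : M -> C) (y : M) : C :=
  psi y / frame L x y ^+ k.

Definition smooth_section (k : nat) (W : set M) (psi : M -> C) : Prop :=
  forall x, csmooth (chart A x @` (dom A x `&` W)) (local_comp k x psi \o param A x).

Section Connection.
(* The real covector theta x is the value at x of the connection form in the
   frame e_x, i.e., (nabla e_x)(x) = - i theta(x) e_x(x). That theta is real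
   is the compatibility with the Hermitian structure. *)
Variable theta : M -> 'rV[R]_m.

Definition nabla_at (k : nat) (x : M) (v : 'rV[C]_m) (psi : M -> C) : C :=
  pairing v (diff (local_comp k x psi) x)
  - 'i%C * k%:R * pairing v (cx (theta x)) * psi x.

(* The covariant derivative on L^k. *)
Definition nabla (k : nat) (X : vfield) (psi : M -> C) : M -> C :=
  fun x => nabla_at k x (X x) psi.

Definition smooth_connection : Prop :=
  forall W, open W -> forall X psi, smooth_vfield W X -> smooth_section 1 W psi ->
    smooth_section 1 W (nabla 1 X psi).

(* The curvature of L is - i omega. *)
Definition prequantum (omega : M -> 'M[R]_m) : Prop :=
  smooth_connection /\
  forall W, open W -> forall X Y psi,
    smooth_vfield W X -> smooth_vfield W Y -> smooth_section 1 W psi ->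
    forall x, W x ->
      nabla 1 X (nabla 1 Y psi) x - nabla 1 Y (nabla 1 X psi) x
        - nabla 1 (bracket X Y) psi x =
      - 'i%C * form (cx (omega x)) (X x) (Y x) * psi x.

(* B^(i j) nabla_i nabla_j psi, in the chart at x. *)
Definition nabla2 (k : nat) (D : vfield -> vfield -> vfield) (B : M -> 'M[C]_m)
    (psi : M -> C) : M -> C := fun x =>
  \sum_i \sum_j B x i j *
    (nabla k (dcoord x i) (nabla k (dcoord x j) psi) x
     - nabla k (D (dcoord x i) (dcoord x j)) psi x).

Definition laplace (k : nat) (D : vfield -> vfield -> vfield) (B : M -> 'M[C]_m)
    (psi : M -> C) : M -> C := fun x =>
  nabla2 k D B psi x + nabla k (div_bivector D B) psi x.

End Connection.

(* Operators act on sections of L^k; only their values on smooth sections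
   matter. *)
Local Notation operator := ((M -> C) -> (M -> C)).

Definition eq_op_on (k : nat) (P Q : operator) : Prop :=
  forall psi, smooth_section k setT psi -> forall x, P psi x = Q psi x.

Definition mulop (f : M -> C) : operator := fun psi x => f x * psi x.

Definition commop (P Q : operator) : operator :=
  fun psi x => P (Q psi) x - Q (P psi) x.

(* Differential operators of order < r. *)
Fixpoint order_lt (k r : nat) (P : operator) : Prop :=
  match r with
  | 0 => eq_op_on k P (fun _ _ => 0)
  | r'.+1 => forall f, smooth_on setT f -> order_lt k r' (commop P (mulop f))
  end.

(* The algebra D_k. *)
Definition diffop (k : nat) (P : operator) : Prop :=
  [/\ forall psi, smooth_section k setT psi -> smooth_section k setT (P psi),
      forall c psi psi', smooth_section k setT psi -> smooth_section k setT psi' ->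
        forall x, P (fun y => c * psi y + psi' y) x = c * P psi x + P psi' x &
      exists r, order_lt k r P].

(* For a family of operators which are combinations of fixed elements of D_k
   with scalar coefficients depending on s: o(|t|^-1) for t = k + i s and
   s --> +oo, in the finite-dimensional span of these elements. *)
Definition little_o_inv (k : nat) (P : R -> operator) : Prop :=
  exists (N : nat) (c : 'I_N -> R -> C) (Q : 'I_N -> operator),
    [/\ forall j, diffop k (Q j),
        \forall s \near +oo,
          eq_op_on k (P s) (fun psi x => \sum_j c j s * Q j psi x) &
        forall j, (fun s => (Normc.normc (Complex k%:R s) * Normc.normc (c j s)) : R^o)
                    @ +oo --> (0 : R^o)].

End LineBundle.
End Tensors.

Unset Implicit Arguments.

Record hw_setting (R : realType) (m p : nat) := HWSetting {
  mfd : topologicalType ;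
  tei : topologicalType ;
  mfd_atlas : atlas 'rV[R]_m mfd ;
  tei_atlas : complex_atlas R p tei ;
  omega : mfd -> 'M[R]_m ;
  lbundle : hermitian_line_bundle mfd_atlas ;
  theta : mfd -> 'rV[R]_m ;
  Jfam : tei -> mfd -> 'M[R]_m ;
  levi : tei -> (mfd -> 'rV[R[i]]_m) -> (mfd -> 'rV[R[i]]_m) -> (mfd -> 'rV[R[i]]_m) ;
  Fpot : tei -> mfd -> R ;
  lambda : R ;
  omega_symplectic : symplectic mfd_atlas omega ;
  mfd_H1_zero : H1_zero mfd_atlas ;
  lbundle_prequantum : prequantum lbundle theta omega ;
  Jfam_smooth : forall x i j,
    smooth_prod tei_atlas mfd_atlas (dom mfd_atlas x) (fun sigma =>
      endo_comp mfd_atlas x (fun y => map_mx (real_complex R) (Jfam sigma y)) i j) ;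
  Jfam_kahler : forall sigma, kahler mfd_atlas (Jfam sigma) omega ;
  no_holomorphic_functions : forall sigma h,
    holomorphic_on mfd_atlas (Jfam sigma) setT h -> exists c, forall x, h x = c ;
  no_holomorphic_vfields : forall sigma Z,
    holomorphic_vfield mfd_atlas (Jfam sigma) Z -> forall x, Z x = 0 ;
  levi_spec : forall sigma,
    is_levi_civita mfd_atlas (metric (Jfam sigma) omega) (levi sigma) ;
  Fpot_smooth :
    smooth_prod tei_atlas mfd_atlas setT (fun sigma x => (Fpot sigma x)%:C%C) ;
  Fpot_ricci : forall sigma x,
    (2 * 'i%C) *: ddbar mfd_atlas (Jfam sigma) (fun y => (Fpot sigma y)%:C%C) x =
    ricci_form mfd_atlas (Jfam sigma) (levi sigma) x
      - map_mx (real_complex R) (lambda *: omega x) }.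

Arguments mfd {R m p}.
Arguments tei {R m p}.
Arguments mfd_atlas {R m p}.
Arguments tei_atlas {R m p}.
Arguments omega {R m p}.
Arguments lbundle {R m p}.
Arguments theta {R m p}.
Arguments Jfam {R m p}.
Arguments levi {R m p}.
Arguments Fpot {R m p}.
Arguments lambda {R m p}.

Section HitchinWitten.
Variables (R : realType) (m p : nat) (S : hw_setting R m p).
Local Notation C := R[i].
Local Notation section := (mfd S -> C).
Local Notation operator := (section -> section).

Definition FC (sigma : tei S) : mfd S -> C := fun x => (Fpot S sigma x)%:C%C.

Definition gtilde (sigma : tei S) (x : mfd S) : 'M[R]_m :=
  invmx (metric (Jfam S sigma) (omega S) x).

Definition Gtilde (sigma : tei S) (V : cspace R p) (x : mfd S) : 'M[C]_m :=
  - \matrix_(i, j) dT (tei_atlas S) sigma V (fun tau => (gtilde tau x i j)%:C%C).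

(* The parts of type (2,0) and (0,2) of Gtilde. *)
Definition G (sigma : tei S) (V : cspace R p) (x : mfd S) : 'M[C]_m :=
  (P10 (Jfam S sigma) x)^T *m Gtilde sigma V x *m P10 (Jfam S sigma) x.
Definition Gbar (sigma : tei S) (V : cspace R p) (x : mfd S) : 'M[C]_m :=
  (P01 (Jfam S sigma) x)^T *m Gtilde sigma V x *m P01 (Jfam S sigma) x.

Definition holomorphic_family : Prop :=
  forall sigma V x, G sigma (imul V) x = 'i%C *: G sigma V x /\
                    Gbar sigma (imul V) x = - 'i%C *: Gbar sigma V x.

Definition rigid_family : Prop :=
  forall sigma V, holomorphic_bivector (mfd_atlas S) (Jfam S sigma) (G sigma V).

(* V[F], V'[F] and V''[F], where V' = (V - i IV) / 2 and V'' = (V + i IV) / 2. *)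
Definition dF (sigma : tei S) (V : cspace R p) (x : mfd S) : C :=
  dT (tei_atlas S) sigma V (fun tau => FC tau x).
Definition dF10 (sigma : tei S) (V : cspace R p) (x : mfd S) : C :=
  2^-1 * (dF sigma V x - 'i%C * dF sigma (imul V) x).
Definition dF01 (sigma : tei S) (V : cspace R p) (x : mfd S) : C :=
  2^-1 * (dF sigma V x + 'i%C * dF sigma (imul V) x).

Section Level.
Variable k : nat.

Definition b (sigma : tei S) (V : cspace R p) : operator := fun psi x =>
  laplace (lbundle S) (theta S) k (levi S sigma) (G sigma V) psi x
  + 2 * nabla (lbundle S) (theta S) k
          (fun y => diff (mfd_atlas S) (FC sigma) y *m G sigma V y) psi x
  - 2 * (lambda S)%:C%C * dF10 sigma V x * psi x.

Definition bbar (sigma : tei S) (V : cspace R p) : operator := fun psi x =>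
  laplace (lbundle S) (theta S) k (levi S sigma) (Gbar sigma V) psi x
  + 2 * nabla (lbundle S) (theta S) k
          (fun y => diff (mfd_atlas S) (FC sigma) y *m Gbar sigma V y) psi x
  - 2 * (lambda S)%:C%C * dF01 sigma V x * psi x.

Definition smooth_opfamily (D : tei S -> operator) : Prop :=
  (forall sigma, diffop (lbundle S) k (D sigma)) /\
  forall psi, smooth_section (lbundle S) k setT psi ->
    forall x, smooth_prod (tei_atlas S) (mfd_atlas S) (dom (mfd_atlas S) x)
      (fun sigma => local_comp (lbundle S) k x (D sigma psi)).

(* (d^F_T D)(V) = V[D] + [V[F], D]. *)
Definition dF_T (D : tei S -> operator) (sigma : tei S) (V : cspace R p) :
    operator := fun psi x =>
  dT (tei_atlas S) sigma V (fun tau => D tau psi x)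
  + commop (mulop (dF sigma V)) (D sigma) psi x.

Definition tpar (s : R) : C := Complex k%:R s.

Definition nablaEnd (s : R) (D : tei S -> operator) (sigma : tei S)
    (V : cspace R p) : operator := fun psi x =>
  dF_T D sigma V psi x
  + (2 * tpar s)^-1 * commop (b sigma V) (D sigma) psi x
  - (2 * (tpar s)^*%C)^-1 * commop (bbar sigma V) (D sigma) psi x.

End Level.

Record hw_action (Gamma : groupType) := HWAction {
  actT : Gamma -> tei S -> tei S ;
  actM : Gamma -> mfd S -> mfd S ;
  (* The lift maps z.e_x(x) to (lift gamma x * z).e_(gamma x)(gamma x). *)
  lift : Gamma -> mfd S -> C ;
  actT1 : forall sigma, actT 1%g sigma = sigma ;
  actTM : forall g h sigma, actT (g * h)%g sigma = actT g (actT h sigma) ;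
  actM1 : forall x, actM 1%g x = x ;
  actMM : forall g h x, actM (g * h)%g x = actM g (actM h x) ;
  lift1 : forall x, lift 1%g x = 1 ;
  liftM : forall g h x, lift (g * h)%g x = lift g (actM h x) * lift h x ;
  lift_unitary : forall g x, `|lift g x| = 1 ;
  actT_smooth : forall g, smooth_map (tei_atlas S) (tei_atlas S) (actT g) ;
  actT_holo : forall g sigma V,
    tangent_map (tei_atlas S) (tei_atlas S) (actT g) sigma (imul V) =
    imul (tangent_map (tei_atlas S) (tei_atlas S) (actT g) sigma V : cspace R p) ;
  actM_smooth : forall g, smooth_map (mfd_atlas S) (mfd_atlas S) (actM g) ;
  actM_symplectic : forall g x,
    jacobian (mfd_atlas S) (actM g) x *m omega S (actM g x)
      *m (jacobian (mfd_atlas S) (actM g) x)^T = omega S x ;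
  act_equivariant : forall g sigma x,
    Jfam S sigma x *m jacobian (mfd_atlas S) (actM g) x =
    jacobian (mfd_atlas S) (actM g) x *m Jfam S (actT g sigma) (actM g x) ;
  lift_smooth : forall g W psi, open W ->
    smooth_section (lbundle S) 1 W psi ->
    smooth_section (lbundle S) 1 (actM g^-1%g @^-1` W)
      (fun x => lift g (actM g^-1%g x) * psi (actM g^-1%g x)) ;
  lift_connection : forall g W psi, open W ->
    smooth_section (lbundle S) 1 W psi -> forall x, W x -> forall v : 'rV[C]_m,
      nabla_at (lbundle S) (theta S) 1 (actM g x)
        (v *m map_mx (real_complex R) (jacobian (mfd_atlas S) (actM g) x))
        (fun y => lift g (actM g^-1%g y) * psi (actM g^-1%g y)) =
      lift g x * nabla_at (lbundle S) (theta S) 1 x v psi }.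

Arguments actT {Gamma}.
Arguments actM {Gamma}.
Arguments lift {Gamma}.

Section Action.
Variables (k : nat) (Gamma : groupType) (a : hw_action Gamma).

(* The action on sections of L^k, and its conjugation action on operators. *)
Definition act_section (g : Gamma) (psi : section) : section :=
  fun x => lift a g (actM a g^-1%g x) ^+ k * psi (actM a g^-1%g x).

Definition act_op (g : Gamma) (D : operator) : operator :=
  fun psi => act_section g (D (act_section g^-1%g psi)).

End Action.
End HitchinWitten.

Arguments FC {R m p}.
Arguments gtilde {R m p}.
Arguments Gtilde {R m p}.
Arguments dF {R m p}.
Arguments dF10 {R m p}.
Arguments dF01 {R m p}.
Arguments holomorphic_family {R m p}.
Arguments rigid_family {R m p}.
Arguments hw_action {R m p}.
Arguments G {R m p}.
Arguments Gbar {R m p}.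
Arguments b {R m p}.
Arguments bbar {R m p}.
Arguments smooth_opfamily {R m p}.
Arguments dF_T {R m p}.
Arguments tpar {R}.
Arguments nablaEnd {R m p}.
Arguments actT {R m p S Gamma}.
Arguments actM {R m p S Gamma}.
Arguments lift {R m p S Gamma}.
Arguments act_section {R m p S} k {Gamma}.
Arguments act_op {R m p S} k {Gamma}.

(* Main.v *)
(* Let X = df . gtilde be the gradient of f for the metric g_sigma. The solution is
   R1 = - i (nabla_X + X[F] + div X / 2). Since V[gtilde] = - G(V) - Gbar(V), and
   [Delta_B, f] = 2 nabla_{B . df} + div (B . df) for a symmetric bivector field B,
   the derivative of R1 along V is (i/2) [b(V) + bbar(V), f] - i X[V[F]], and the last
   term is cancelled by [V[F], R1]. Here div is the divergence of the Liouville volume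
   form, so that the operator div does not depend on sigma.

   All ingredients of R1 are natural except F. By naturality of the Ricci form, the
   function F_{gamma sigma} o gamma - F_sigma is pluriharmonic; as H^1 = 0, it is then the
   real part of a holomorphic function, hence constant, and only dF enters R1.

   In the last statement, the terms of order 1/s cancel: i/(2s) + 1/(2t) and
   i/(2s) - 1/(2 conj t) are of order 1/s^2. *)
From HB Require Import structures.
Require Import Defs.
From mathcomp Require Import all_boot all_order all_algebra.
From mathcomp Require Import complex ring lra.
From mathcomp Require Import all_classical all_reals all_analysis.
Import Order.TTheory GRing.Theory Num.Theory.
Import numFieldNormedType.Exports.
Set Implicit Arguments.
Unset Strict Implicit.
Unset Printing Implicit Defensive.
Local Open Scope classical_set_scope.
Local Open Scope ring_scope.
(* Restores [diff], [coord] and [lift], which the libraries also define. *)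
Import Defs.

(** * Calculus of C^n maps between normed spaces *)

Section SmoothCalculus.
Variable R : realType.
Implicit Types V W E : normedModType R.

(** The encoding of tensors shapes the proof: components at [y] are taken in the chart at [y], so
    they need not vary smoothly with [y]. Local statements are therefore moved to the frame of one
    fixed chart, where fields, bivectors and sections have genuine component functions, and read off
    at its centre, where this frame is the standard basis.

    The ansatz is of first order because the commutator of a second-order operator with [f] is. That
    G + Gbar is all of Gtilde comes from gtilde omega gtilde = - omega^-1, whose right-hand side
    does not move with sigma. The summand X[F] is there for the term 2 nabla_{B . dF} of [b] and
    [bbar], whose commutator with [f] is 2 (B . df)[F].

    The divergence is differentiated along T by reducing it to that of coordinate fields, which is
    half of tr (omega^-1 d omega): metric compatibility gives dg = K g + g K^T for g = omega J^T,
    and the contribution of dJ has zero trace. So the Levi-Civita connections drop out, and what is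
    left are derivatives of the components of gtilde and of F, which are jointly smooth; on these,
    derivatives along T and along M commute. *)

Lemma near_eq_differentiable V W (f g : V -> W) x :
  {near x, f =1 g} -> differentiable f x -> differentiable g x.
Proof.
move=> fg df.
have fgx : f x = g x by exact: nbhs_singleton fg.
have H : g \o shift x = cst (g x) + 'd f x +o_ 0 id.
  apply/eqaddoP => e e0.
  have /eqaddoP/(_ e e0) := diff_locally df.
  have : \forall y \near (0:V), f (shift x y) = g (shift x y).
    move: fg; rewrite (near_shift 0 x) => fg.
    by apply: filterS fg => y /=; rewrite subr0.
  apply: filter_app2; near=> y => fgy.
  by rewrite !fctE /= -fgx -fgy.
have E := diff_unique (@diff_continuous _ _ _ _ _ df) H.
apply/diff_locallyP; rewrite E; split => //.
exact: (@diff_continuous _ _ _ _ _ df).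
Unshelve. all: by end_near. Qed.

(** A form [c i] that is its own differential everywhere is linear and continuous, so this is a
    finite spanning family with continuous linear coefficients. The notion covers row vectors and
    products at once, hence the charts of both manifolds and of their product. *)
Definition coordinatization V n (e : 'I_n -> V) (c : 'I_n -> V -> R^o) :=
  (forall i v, is_diff v (c i) (c i)) /\ forall v, v = \sum_i c i v *: e i.

Definition finite_dim V := exists n (e : 'I_n -> V) c, coordinatization e c.

Lemma is_diffW V W (f df : V -> W) x : is_diff x f df -> differentiable f x.
Proof. by case. Qed.

Lemma is_diff_mxcoord m (i : 'I_m) (v : 'rV[R]_m) :
  is_diff v (fun u : 'rV[R]_m => u 0 i : R^o) (fun u : 'rV[R]_m => u 0 i : R^o).
Proof.
have @f : {linear 'rV[R]_m -> R^o}.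
  by exists (fun N : 'rV[R]_m => N 0 i); do 2![eexists]; do ?[constructor];
     rewrite ?mxE// => ? *; rewrite ?mxE//; move=> ?; rewrite !mxE.
have fc : continuous f by exact: coord_continuous.
have -> : (fun u : 'rV[R]_m => u 0 i : R^o) = f by [].
by apply: DiffDef; [exact: linear_differentiable|exact: diff_lin].
Qed.

Lemma is_diff_fst V W (v : V * W) : is_diff v (fst : V * W -> V) fst.
Proof.
have l : linear (fst : V * W -> V) by [].
pose f : {linear (V * W)%type -> V} := HB.pack fst (GRing.isLinear.Build _ _ _ _ _ l).
have fc : continuous f by move=> x; exact: cvg_fst.
have -> : (fst : V * W -> V) = f by [].
by apply: DiffDef; [exact: linear_differentiable|exact: diff_lin].
Qed.

Lemma is_diff_snd V W (v : V * W) : is_diff v (snd : V * W -> W) snd.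
Proof.
have l : linear (snd : V * W -> W) by [].
pose f : {linear (V * W)%type -> W} := HB.pack snd (GRing.isLinear.Build _ _ _ _ _ l).
have fc : continuous f by move=> x; exact: cvg_snd.
have -> : (snd : V * W -> W) = f by [].
by apply: DiffDef; [exact: linear_differentiable|exact: diff_lin].
Qed.

Lemma finite_dim_rV m : finite_dim 'rV[R]_m.
Proof.
exists m, (fun i => delta_mx 0 i), (fun i (u : 'rV[R]_m) => u 0 i); split => [i v|v].
  exact: is_diff_mxcoord.
exact: row_sum_delta.
Qed.

Lemma finite_dim_prod V W : finite_dim V -> finite_dim W -> finite_dim (V * W)%type.
Proof.
move=> [n [e [c [c1 c2]]]] [n' [e' [c' [c1' c2']]]].
exists (n + n')%N, (fun i : 'I_(n + n') =>
  match fintype.split i with inl j => (e j, 0) | inr j => (0, e' j) end).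
exists (fun (i : 'I_(n + n')) v =>
  match fintype.split i with inl j => c j v.1 | inr j => c' j v.2 end); split.
  move=> i v; case: (fintype.split i) => j.
    exact: (is_diff_comp (is_diff_fst v) (c1 j v.1)).
  exact: (is_diff_comp (is_diff_snd v) (c1' j v.2)).
move=> [v w]; rewrite big_split_ord /=.
under eq_bigr do rewrite -/(unsplit (inl _)) unsplitK.
under [X in _ + X]eq_bigr do rewrite -/(unsplit (inr _)) unsplitK.
rewrite [LHS](_ : _ = (v, 0) + (0, w)); last first.
  by apply/pair_equal_spec; rewrite /= addr0 add0r.
congr (_ + _).
  rewrite {1}(c2 v); elim/big_ind2 : _ => //= [x1 x2 y1 y2 <- <-|i _].
    by apply/pair_equal_spec; rewrite /= addr0.
  by apply/pair_equal_spec; rewrite /= scaler0.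
rewrite {1}(c2' w); elim/big_ind2 : _ => //= [x1 x2 y1 y2 <- <-|i _].
  by apply/pair_equal_spec; rewrite /= addr0.
by apply/pair_equal_spec; rewrite /= scaler0.
Qed.

Lemma Ck_ext V W n (U : set V) (f g : V -> W) :
  open U -> (forall x, U x -> f x = g x) -> Ck n U f -> Ck n U g.
Proof.
move=> oU; elim: n f g => [|n IH] f g fg.
  move=> /= fc x Ux; have fgx : {near x, f =1 g}.
    by apply: filterS (open_nbhs_nbhs (conj oU Ux)) => y /fg.
  move: (fc x Ux); rewrite /prop_for /continuous_at fg//.
  by move=> h; apply: cvg_trans h; apply: near_eq_cvg; near=> y; apply: (near fgx).
move=> [df cf]; split => [x Ux|v].
  apply: near_eq_differentiable (df x Ux).
  by apply: filterS (open_nbhs_nbhs (conj oU Ux)) => y /fg.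
apply: IH (cf v) => x Ux; apply: near_eq_derive.
by apply: filterS (open_nbhs_nbhs (conj oU Ux)) => y /fg.
Unshelve. all: by end_near. Qed.

Lemma Ck_sub V W n (U U' : set V) (f : V -> W) :
  (forall x, U' x -> U x) -> Ck n U f -> Ck n U' f.
Proof.
move=> UU'; elim: n f => [|n IH] f /=; first by move=> fc x /UU' /fc.
by move=> [df cf]; split => [x /UU' /df //|v]; apply: IH.
Qed.

Lemma CkW V W n (U : set V) (f : V -> W) : Ck n.+1 U f -> Ck n U f.
Proof.
elim: n f => [|n IH] f.
  by move=> /= h x Ux; exact/differentiable_continuous/(h.1 _ Ux).
by move=> [df cf]; split => // v; apply: IH.
Qed.

Lemma Ck_cst V W n (U : set V) (a : W) : open U -> Ck n U (fun=> a).
Proof.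
move=> oU; elim: n a => [|n IH] a; first by move=> x _; apply: cvg_cst.
split => [x _|v]; first exact: differentiable_cst.
by apply: (Ck_ext oU _ (IH 0)) => x _; rewrite derive_cst.
Qed.

Lemma CkD V W n (U : set V) (f g : V -> W) :
  open U -> Ck n U f -> Ck n U g -> Ck n U (fun x => f x + g x).
Proof.
move=> oU; elim: n f g => [|n IH] f g.
  by move=> /= cf cg x Ux; apply: continuousD; [exact: cf|exact: cg].
move=> [df cf] [dg cg]; split => [x Ux|v].
  by apply: differentiableD; [exact: df|exact: dg].
apply: (Ck_ext oU _ (IH _ _ (cf v) (cg v))) => x Ux.
by rewrite deriveD //; apply: diff_derivable; [exact: df|exact: dg].
Qed.

Lemma CkM V n (U : set V) (f g : V -> R^o) :
  open U -> Ck n U f -> Ck n U g -> Ck n U (fun x => f x * g x : R^o).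
Proof.
move=> oU; elim: n f g => [|n IH] f g.
  by move=> /= cf cg x Ux; apply: continuousM; [exact: cf|exact: cg].
move=> hf hg; have [df cf] := hf; have [dg cg] := hg; split => [x Ux|v].
  by apply: differentiableM; [exact: df|exact: dg].
apply: (Ck_ext oU _ (CkD oU (IH _ _ (CkW hf) (cg v)) (IH _ _ (CkW hg) (cf v)))) => x Ux.
by rewrite deriveM //; apply: diff_derivable; [exact: df|exact: dg].
Qed.

Lemma CkN V n (U : set V) (f : V -> R^o) :
  open U -> Ck n U f -> Ck n U (fun x => - f x).
Proof.
move=> oU cf; apply: (Ck_ext oU _ (CkM oU (Ck_cst n (-1 : R^o) oU) cf)) => x _ /=.
by rewrite mulN1r.
Qed.

Lemma Ck_sum V n (U : set V) (I : Type) (r : seq I) (f : I -> V -> R^o) :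
  open U -> (forall i, Ck n U (f i)) -> Ck n U (fun x => \sum_(i <- r) f i x).
Proof.
move=> oU cf; elim: r => [|i r IH].
  by apply: (Ck_ext oU _ (Ck_cst n (0 : R^o) oU)) => x _; rewrite big_nil.
by apply: (Ck_ext oU _ (CkD oU (cf i) IH)) => x _; rewrite big_cons.
Qed.

Lemma CkV V n (U : set V) (f : V -> R^o) :
  open U -> (forall x, U x -> f x != 0) -> Ck n U f -> Ck n U (fun x => (f x)^-1 : R^o).
Proof.
move=> oU f0; elim: n => [|n IH].
  by move=> /= cf x Ux; apply: continuousV; [exact: f0|exact: cf].
move=> hf; have [df cf] := hf; split => [x Ux|v].
  by apply: differentiableV; [exact: df|exact: f0].
have c := IH (CkW hf).
apply: (Ck_ext oU _ (CkN oU (CkM oU (CkM oU c c) (cf v)))) => x Ux.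
rewrite deriveV ?f0//; last by apply: diff_derivable; exact: df.
by rewrite /GRing.scale /= -invfM -expr2 mulNr.
Qed.

Lemma is_diff_lin V W (c : V -> W) (U : set V) n :
  open U -> (forall v, is_diff v c c) -> Ck n U c.
Proof.
move=> oU h; case: n => [|n].
  move=> x _; apply: differentiable_continuous.
  exact: is_diffW (h x).
split => [x _|v]; first exact: is_diffW (h x).
apply: (Ck_ext oU _ (Ck_cst n (c v) oU)) => x _.
by rewrite deriveE; [rewrite diff_val|exact: is_diffW (h x)].
Qed.

Lemma Ck_lin V W E n (U : set V) (f : V -> W) (c : W -> E) :
  open U -> (forall v, is_diff v c c) -> Ck n U f -> Ck n U (fun x => c (f x)).
Proof.
move=> oU h; elim: n f => [|n IH] f.
  move=> /= cf x Ux; apply: continuous_comp; first exact: cf.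
  by apply: differentiable_continuous; exact: is_diffW (h (f x)).
move=> [df cf]; split => [x Ux|v].
  by apply: (differentiable_comp (df _ Ux)); exact: is_diffW (h (f x)).
apply: (Ck_ext oU _ (IH _ (cf v))) => x Ux.
have dc : differentiable c (f x) by exact: is_diffW (h (f x)).
rewrite [RHS]deriveE; last exact: (differentiable_comp (df _ Ux)).
rewrite diff_comp //=; last exact: df.
rewrite -(deriveE _ (df _ Ux)).
by have hx := h (f x); rewrite diff_val.
Qed.

Lemma derive_comp_sum V W n (e : 'I_n -> W) c (g : V -> W) (f : W -> R^o) x v :
  coordinatization e c -> differentiable g x -> differentiable f (g x) ->
  'D_v (fun y => f (g y)) x = \sum_i c i ('D_v g x) * 'D_(e i) f (g x).
Proof.
move=> [c1 c2] dg df.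
rewrite deriveE; last exact: (differentiable_comp dg).
rewrite -[fun y => f (g y)]/(f \o g) diff_comp // -[LHS]/('d f (g x) ('d g x v)).
rewrite -(deriveE _ dg) [in LHS](c2 ('D_v g x)).
pose d : {linear W -> R^o} := 'd f (g x).
rewrite -[LHS]/(d (\sum_i c i ('D_v g x) *: e i)) linear_sum /=.
by apply: eq_bigr => i _; rewrite linearZ (deriveE _ df).
Qed.

(** The derivative of the composite along [v] is a sum of products of [c i ('D_v g x)] and
    ['D_(e i) f (g x)]. The directions [e i] are fixed, so the induction hypothesis applies to these
    derivatives of [f]; finite dimension provides such fixed directions. *)
Lemma Ck_comp V W n (U : set V) (U' : set W) (f : W -> R^o) (g : V -> W) :
  finite_dim W -> open U -> open U' -> (forall x, U x -> U' (g x)) ->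
  Ck n U' f -> Ck n U g -> Ck n U (fun x => f (g x)).
Proof.
move=> [d [e [c ec]]] oU oU' gU; elim: n f => [|n IH] f.
  move=> /= cf cg x Ux; apply: continuous_comp; first exact: cg.
  by apply: cf; apply: gU.
move=> [df cf] hg; have [dg cg] := hg; split => [x Ux|v].
  by apply: (differentiable_comp (dg _ Ux)); apply: df; exact: gU.
have H : Ck n U (fun x => \sum_i c i ('D_v g x) * 'D_(e i) f (g x)).
  apply: Ck_sum => // i; apply: CkM => //.
    by apply: (Ck_lin oU (fun v => ec.1 i v)); exact: cg.
  by apply: (IH _ (cf (e i))); exact: CkW.
apply: (Ck_ext oU _ H) => x Ux; rewrite (derive_comp_sum _ ec) //; first exact: dg.
by apply: df; exact: gU.
Qed.

Lemma is_derive_line V (f : V -> R^o) y v (s : R) :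
  differentiable f (y + s *: v) ->
  is_derive s 1 (fun s => f (y + s *: v)) ('D_v f (y + s *: v)).
Proof.
move=> df.
have dl : is_diff s (fun s : R => y + s *: v) (fun s : R => s *: v).
  have := is_diffD (is_diff_cst y s) (is_diff_scalel s v).
  by rewrite add0r.
have dfl : differentiable (f \o (fun s : R => y + s *: v)) s.
  by apply: differentiable_comp; [exact: is_diffW dl|].
split; first exact: diff_derivable.
rewrite -[X in 'D_1 X s]/(f \o (fun s : R => y + s *: v)) deriveE // diff_comp //.
by rewrite -[LHS]/('d f _ ('d (fun s : R => y + s *: v) s 1)) diff_val scale1r deriveE.
Qed.

(** Two applications of the mean value theorem: to the difference of [f] along two parallel segments
    of direction [v], then to ['D_v f] along [w]. The second difference is symmetric in [v] and [w],
    while the right-hand side displays one order of differentiation. *)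
Lemma second_difference V (U : set V) (f : V -> R^o) x v w (h : R) :
  Ck 2 U f -> 0 < h ->
  (forall s t : R, 0 <= s <= h -> 0 <= t <= h -> U (x + s *: v + t *: w)) ->
  exists s t : R, [/\ 0 <= s <= h, 0 <= t <= h &
  (f (x + h *: v + h *: w) - f (x + h *: v)) - (f (x + h *: w) - f x) =
  'D_w ('D_v f) (x + s *: v + t *: w) * h * h].
Proof.
move=> [df cf] h0 hU.
have U1 (s : R) : 0 <= s <= h -> U (x + s *: v).
  by move=> hs; have := hU s 0 hs; rewrite scale0r addr0 lexx ltW //; apply.
have U2 (s : R) : 0 <= s <= h -> U (x + h *: w + s *: v).
  by move=> hs; have := hU s h hs; rewrite lexx ltW // addrAC; apply.
pose phi (s : R) : R := f (x + h *: w + s *: v) - f (x + s *: v).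
have dphi s : 0 <= s <= h ->
    is_derive s 1 phi ('D_v f (x + h *: w + s *: v) - 'D_v f (x + s *: v)).
  move=> hs; apply: is_deriveB; apply: is_derive_line; apply: df;
  by [exact: U1|exact: U2].
have dcont (p : R -> R) (dp : R -> R) : (forall s, 0 <= s <= h -> is_derive s 1 p (dp s)) ->
    {within `[0, h], continuous p}.
  move=> H; apply: derivable_within_continuous => s; rewrite in_itv /= => hs.
  by have [] := H s hs.
have io (P : R -> Prop) : (forall s, 0 <= s <= h -> P s) -> forall s, s \in `]0, h[ -> P s.
  by move=> HP s; rewrite in_itv /= => /andP[a b]; apply: HP; rewrite !ltW.
have [s] := MVT_segment (ltW h0) (io _ dphi) (dcont _ _ dphi).
rewrite in_itv /= => hs E.
pose psi (t : R) : R := 'D_v f (x + s *: v + t *: w).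
have dpsi t : 0 <= t <= h -> is_derive t 1 psi ('D_w ('D_v f) (x + s *: v + t *: w)).
  by move=> ht; apply: is_derive_line; apply: (cf v).1; exact: hU.
have [t] := MVT_segment (ltW h0) (io _ dpsi) (dcont _ _ dpsi).
rewrite in_itv /= => ht E'.
exists s, t; split => //.
move: E E'; rewrite /phi /psi !scale0r !addr0 subr0 => E E'.
by rewrite -E' (addrAC x (s *: v)) -E (addrAC x (h *: v)).
Qed.

Lemma half_close_absurd (a b c : R) :
  `|a - c| < `|a - b| / 2 -> `|b - c| < `|a - b| / 2 -> False.
Proof.
move=> A B; have : `|a - b| < `|a - b|; last by rewrite ltxx.
rewrite [ltRHS](splitr `|a - b|).
have -> : a - b = (a - c) - (b - c) by rewrite opprB addrA subrK.
apply: le_lt_trans (ler_normB _ _) _.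
by rewrite opprB addrA subrK ltrD.
Qed.

Lemma cancel_square (h a b : R) : h != 0 -> a * h * h = b * h * h -> a = b.
Proof. by move=> hn /(mulIf hn)/(mulIf hn). Qed.

Lemma second_difference_sym (a b c d : R) : (a - b) - (c - d) = (a - c) - (b - d).
Proof. by ring. Qed.

(** Schwarz's theorem. At suitable points near [x], both mixed derivatives equal the same second
    difference divided by [h * h]. If they differed at [x], continuity would keep each within half
    of the gap of its value there, which excludes a common value. *)
Lemma derive_swap V (U : set V) (f : V -> R^o) x v w :
  open U -> U x -> Ck 2 U f -> 'D_v ('D_w f) x = 'D_w ('D_v f) x.
Proof.
move=> oU Ux cf; apply/eqP/negP => /negP ne.
set a := 'D_v ('D_w f) x in ne *; set b := 'D_w ('D_v f) x in ne *.
have e0 : 0 < `|a - b| / 2 by rewrite divr_gt0 // normr_gt0 subr_eq0.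
have cnear v' w' : \forall y \near x, `|'D_v' ('D_w' f) x - 'D_v' ('D_w' f) y| < `|a - b| / 2.
  have c : {for x, continuous ('D_v' ('D_w' f))} by apply: ((cf.2 w').2 v').
  exact: (cvgrPdist_lt _ _).1 c _ e0.
have : \forall y \near x, U y /\ (`|a - 'D_v ('D_w f) y| < `|a - b| / 2 /\
   `|b - 'D_w ('D_v f) y| < `|a - b| / 2).
  apply: filterI; first exact: (open_nbhs_nbhs (conj oU Ux)).
  by apply: filterI; exact: cnear.
move=> /nbhs_ballP[e /= e1 He].
(* The summand 1 keeps [N] positive when both directions vanish; with [h = e / (2 * N)] the whole
   parallelogram spanned by [h *: v] and [h *: w] at [x] lies in the ball of radius [e]. *)
pose N := `|v| + `|w| + 1.
have N0 : 0 < N by rewrite ltr_wpDl // addr_ge0.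
pose h := e / (2 * N).
have h0 : 0 < h by rewrite divr_gt0 // mulr_gt0.
have hb s t : 0 <= s <= h -> 0 <= t <= h -> ball x e (x + s *: v + t *: w).
  move=> /andP[s0 s1] /andP[t0 t1]; rewrite -ball_normE /ball_ /=.
  rewrite -addrA opprD addNKr normrN.
  apply: le_lt_trans (ler_normD _ _) _; rewrite !normrZ !ger0_norm //.
  have -> : e = h * (2 * N) by rewrite /h divfK // mulf_neq0 // gt_eqF.
  apply: (@le_lt_trans _ _ (h * `|v| + h * `|w|)).
    by apply: lerD; apply: ler_wpM2r.
  rewrite -mulrDr ltr_pM2l // /N.
  by have := normr_ge0 v; have := normr_ge0 w; lra.
have [s [t [hs ht E]]] := second_difference cf h0 (fun s t hs ht => (He _ (hb s t hs ht)).1).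
have hb' s' t' : 0 <= s' <= h -> 0 <= t' <= h -> ball x e (x + s' *: w + t' *: v).
  by move=> h1 h2; rewrite addrAC; exact: hb.
have [s' [t' [hs' ht' E']]] := second_difference cf h0 (fun s t hs ht => (He _ (hb' s t hs ht)).1).
have : 'D_w ('D_v f) (x + s *: v + t *: w) = 'D_v ('D_w f) (x + s' *: w + t' *: v).
  have hn : h != 0 by rewrite gt_eqF.
  apply: cancel_square hn _; apply: etrans (esym E) _; apply: etrans E'.
  by rewrite (addrAC x (h *: w)); exact: second_difference_sym.
move=> EE.
have [_ [_ B]] := He _ (hb _ _ hs ht); have [_ [A _]] := He _ (hb' _ _ hs' ht').
rewrite EE in B; set c := 'D_v _ _ in A B.
exact: half_close_absurd A B.
Qed.

End SmoothCalculus.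

(** * Complex-valued functions, through real and imaginary parts *)

Section ComplexCalculus.
Variable R : realType.
Local Notation C := R[i].
Implicit Types V W : normedModType R.
Local Notation Re := (@complex.Re R).
Local Notation Im := (@complex.Im R).

Definition cdifferentiable V (f : V -> C) x :=
  differentiable (fun y => Re (f y) : R^o) x /\
  differentiable (fun y => Im (f y) : R^o) x.

Lemma complexE (z w : C) : Re z = Re w -> Im z = Im w -> z = w.
Proof. by move: z w => [a b] [c d] /= -> ->. Qed.

Lemma ReD (z w : C) : Re (z + w) = Re z + Re w. Proof. by case: z w => [a b] []. Qed.
Lemma ImD (z w : C) : Im (z + w) = Im z + Im w. Proof. by case: z w => [a b] []. Qed.
Lemma ReM (z w : C) : Re (z * w) = Re z * Re w - Im z * Im w.
Proof. by case: z w => [a b] []. Qed.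
Lemma ImM (z w : C) : Im (z * w) = Re z * Im w + Im z * Re w.
Proof. by case: z w => [a b] []. Qed.
Lemma ReV (z : C) : Re z^-1 = Re z * (Re z * Re z + Im z * Im z)^-1.
Proof. by case: z => [a b]; rewrite -!expr2. Qed.
Lemma ImV (z : C) : Im z^-1 = - (Im z * (Re z * Re z + Im z * Im z)^-1).
Proof. by case: z => [a b]; rewrite -!expr2. Qed.

Lemma csmooth_cdifferentiable V (U : set V) (f : V -> C) x :
  csmooth U f -> U x -> cdifferentiable f x.
Proof. by move=> [h1 h2] Ux; split; [exact: (h1 1%N).1|exact: (h2 1%N).1]. Qed.

Lemma csmooth_ext V (U : set V) (f g : V -> C) :
  open U -> (forall x, U x -> f x = g x) -> csmooth U f -> csmooth U g.
Proof.
move=> oU fg [h1 h2]; split=> n.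
  by apply: (Ck_ext oU _ (h1 n)) => x Ux /=; rewrite fg.
by apply: (Ck_ext oU _ (h2 n)) => x Ux /=; rewrite fg.
Qed.

Lemma csmooth_sub V (U U' : set V) (f : V -> C) :
  U' `<=` U -> csmooth U f -> csmooth U' f.
Proof. by move=> UU [h1 h2]; split=> n; [apply: (Ck_sub UU (h1 n))|apply: (Ck_sub UU (h2 n))]. Qed.

Lemma csmooth_cst V (U : set V) (a : C) : open U -> csmooth U (fun=> a).
Proof. by move=> oU; split=> n; exact: Ck_cst. Qed.

Lemma csmoothD V (U : set V) (f g : V -> C) : open U ->
  csmooth U f -> csmooth U g -> csmooth U (fun x => f x + g x).
Proof.
move=> oU [h1 h2] [h3 h4]; split=> n.
  by apply: (Ck_ext oU _ (CkD oU (h1 n) (h3 n))) => x Ux /=; rewrite ReD.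
by apply: (Ck_ext oU _ (CkD oU (h2 n) (h4 n))) => x Ux /=; rewrite ImD.
Qed.

Lemma csmoothM V (U : set V) (f g : V -> C) : open U ->
  csmooth U f -> csmooth U g -> csmooth U (fun x => f x * g x).
Proof.
move=> oU [h1 h2] [h3 h4]; split=> n.
  apply: (Ck_ext oU _ (CkD oU (CkM oU (h1 n) (h3 n)) (CkN oU (CkM oU (h2 n) (h4 n))))).
  by move=> x Ux /=; rewrite ReM.
apply: (Ck_ext oU _ (CkD oU (CkM oU (h1 n) (h4 n)) (CkM oU (h2 n) (h3 n)))).
by move=> x Ux /=; rewrite ImM.
Qed.

Lemma csmooth_sum V (U : set V) (I : Type) (r : seq I) (f : I -> V -> C) : open U ->
  (forall i, csmooth U (f i)) -> csmooth U (fun x => \sum_(i <- r) f i x).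
Proof.
move=> oU cf; elim: r => [|i r IH].
  by apply: (csmooth_ext oU _ (csmooth_cst 0 oU)) => x _; rewrite big_nil.
by apply: (csmooth_ext oU _ (csmoothD oU (cf i) IH)) => x _; rewrite big_cons.
Qed.

Lemma sqr_norm_eq0 (z : C) : z != 0 -> Re z * Re z + Im z * Im z != 0.
Proof.
case: z => a b /=; apply: contra_neq => h.
have a0 : a = 0 by nra.
have b0 : b = 0 by nra.
by rewrite a0 b0.
Qed.

Lemma csmoothV V (U : set V) (f : V -> C) : open U -> (forall x, U x -> f x != 0) ->
  csmooth U f -> csmooth U (fun x => (f x)^-1).
Proof.
move=> oU f0 [h1 h2].
have hn n : Ck n U (fun x => (Re (f x) * Re (f x) + Im (f x) * Im (f x))^-1 : R^o).
  apply: CkV => // [x Ux|]; first exact/sqr_norm_eq0/f0.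
  by apply: CkD => //; apply: CkM.
split=> n.
  by apply: (Ck_ext oU _ (CkM oU (h1 n) (hn n))) => x Ux /=; rewrite ReV.
by apply: (Ck_ext oU _ (CkN oU (CkM oU (h2 n) (hn n)))) => x Ux /=; rewrite ImV.
Qed.

Lemma csmooth_comp V W (U : set V) (U' : set W) (f : W -> C) (g : V -> W) :
  finite_dim W -> open U -> open U' -> (forall x, U x -> U' (g x)) ->
  csmooth U' f -> smooth U g -> csmooth U (fun x => f (g x)).
Proof.
move=> fW oU oU' UU [h1 h2] hg; split=> n.
  exact: (Ck_comp fW oU oU' UU (h1 n) (hg n)).
exact: (Ck_comp fW oU oU' UU (h2 n) (hg n)).
Qed.

Lemma csmooth_derive V (U : set V) (f : V -> C) v :
  csmooth U f -> csmooth U (fun x => cderive f x v).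
Proof. by move=> [h1 h2]; split=> n; [exact: (h1 n.+1).2|exact: (h2 n.+1).2]. Qed.

Lemma cderive_near V (f g : V -> C) x v : (\forall y \near x, f y = g y) ->
  cderive f x v = cderive g x v.
Proof.
move=> fg; apply: complexE => /=; apply: near_eq_derive; apply: filterS fg => y ->//.
Qed.

Lemma cderive_cst V (a : C) (x v : V) : cderive (fun=> a) x v = 0.
Proof. by apply: complexE => /=; rewrite derive_cst. Qed.

Lemma rderiveD V (f g : V -> R^o) x v : differentiable f x -> differentiable g x ->
  'D_v (fun y => f y + g y : R^o) x = 'D_v f x + 'D_v g x.
Proof. by move=> df dg; rewrite -deriveD //; apply: diff_derivable. Qed.

Lemma rderiveB V (f g : V -> R^o) x v : differentiable f x -> differentiable g x ->
  'D_v (fun y => f y - g y : R^o) x = 'D_v f x - 'D_v g x.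
Proof. by move=> df dg; rewrite -deriveB //; apply: diff_derivable. Qed.

Lemma rderiveM V (f g : V -> R^o) x v : differentiable f x -> differentiable g x ->
  'D_v (fun y => f y * g y : R^o) x = f x * 'D_v g x + g x * 'D_v f x.
Proof.
move=> df dg; have := @deriveM _ _ f g x v.
by move=> ->//; apply: diff_derivable.
Qed.

Lemma cderiveD V (f g : V -> C) x v : cdifferentiable f x -> cdifferentiable g x ->
  cderive (fun y => f y + g y) x v = cderive f x v + cderive g x v.
Proof.
move=> [f1 f2] [g1 g2]; apply: complexE; rewrite /cderive ?ReD ?ImD /=.
  by rewrite -rderiveD //; congr ('D_v _ x); apply/funext => y; rewrite ReD.
by rewrite -rderiveD //; congr ('D_v _ x); apply/funext => y; rewrite ImD.
Qed.

Lemma cderiveM V (f g : V -> C) x v : cdifferentiable f x -> cdifferentiable g x ->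
  cderive (fun y => f y * g y) x v = cderive f x v * g x + f x * cderive g x v.
Proof.
move=> [f1 f2] [g1 g2].
have E1 (a b c d a' b' c' d' : R) :
  a * a' + b * b' - (c * c' + d * d') = b' * b - d' * d + (a * a' - c * c') by ring.
have E3 (a b c d a' b' c' d' : R) :
  a * a' + b * b' + (c * c' + d * d') = b' * b + d' * d + (a * a' + c * c').
  by ring.
have dM (p q : V -> R^o) : differentiable p x -> differentiable q x ->
  differentiable (fun y => p y * q y : R^o) x by move=> ? ?; exact: differentiableM.
apply: complexE; rewrite ?ReD ?ImD ?ReM ?ImM /cderive /=.
  rewrite (_ : (fun y => Re (f y * g y) : R^o) =
    (fun y => Re (f y) * Re (g y) - Im (f y) * Im (g y) : R^o)); last first.
    by apply/funext => y; rewrite ReM.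
  rewrite rderiveB; [|exact: dM..].
  by rewrite !rderiveM //; exact: E1.
rewrite (_ : (fun y => Im (f y * g y) : R^o) =
    (fun y => Re (f y) * Im (g y) + Im (f y) * Re (g y) : R^o)); last first.
  by apply/funext => y; rewrite ImM.
rewrite rderiveD; [|exact: dM..].
by rewrite !rderiveM // E3 addrACA [X in X + _]addrC [X in _ + X]addrC addrACA.
Qed.

Lemma cderive_chain V W (f : W -> C) (g : V -> W) x v :
  differentiable g x -> cdifferentiable f (g x) ->
  cderive (fun y => f (g y)) x v = cderive f (g x) ('D_v g x).
Proof.
move=> dg [f1 f2]; apply: complexE; rewrite /cderive /=.
  rewrite [RHS]deriveE // (deriveE _ dg) deriveE; last first.
    exact: (@differentiable_comp _ _ _ _ g _ _ dg f1).
  by have /= -> := @diff_comp _ _ _ _ g _ x dg f1.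
rewrite [RHS]deriveE // (deriveE _ dg) deriveE; last first.
  exact: (@differentiable_comp _ _ _ _ g _ _ dg f2).
by have /= -> := @diff_comp _ _ _ _ g _ x dg f2.
Qed.

Lemma cderive_coord V n (e : 'I_n -> V) c (f : V -> C) x v :
  coordinatization e c -> cdifferentiable f x ->
  cderive f x v = \sum_i (c i v)%:C%C * cderive f x (e i).
Proof.
move=> [_ c2] fd; have [f1 f2] := fd.
have E (h : V -> R^o) : differentiable h x -> 'D_v h x = \sum_i c i v * 'D_(e i) h x.
  move=> dh; rewrite deriveE // [in LHS](c2 v).
  pose d : {linear V -> R^o} := 'd h x.
  rewrite -[LHS]/(d (\sum_i c i v *: e i)) linear_sum /=.
  by apply: eq_bigr => i _; rewrite linearZ (deriveE _ dh).
have P (F : 'I_n -> C) : Re (\sum_i F i) = \sum_i Re (F i) /\ Im (\sum_i F i) = \sum_i Im (F i).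
  split; first by elim/big_ind2 : _ => // a b a' b' <- <-; rewrite ReD.
  by elim/big_ind2 : _ => // a b a' b' <- <-; rewrite ImD.
apply: complexE; rewrite ?(P _).1 ?(P _).2 /cderive /= E //.
  by apply: eq_bigr => i _; rewrite mul0r subr0.
by apply: eq_bigr => i _; rewrite mul0r addr0.
Qed.

Lemma cderive_row m (f : 'rV[R]_m -> C) x v : cdifferentiable f x ->
  cderive f x v = \sum_i (v 0 i)%:C%C * cderive f x (delta_mx 0 i).
Proof.
apply: (@cderive_coord _ _ (fun i => delta_mx 0 i) (fun i (u : 'rV[R]_m) => u 0 i : R^o)).
by split=> [i u|u]; [exact: is_diff_mxcoord|exact: row_sum_delta].
Qed.

Lemma cderive_swap V (U : set V) (f : V -> C) x v w :
  open U -> U x -> csmooth U f ->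
  cderive (fun y => cderive f y w) x v = cderive (fun y => cderive f y v) x w.
Proof.
move=> oU Ux [h1 h2]; apply: complexE; rewrite /cderive /=.
  exact: derive_swap oU Ux (h1 2%N).
exact: derive_swap oU Ux (h2 2%N).
Qed.

Lemma derive_mxcoord V m (g : V -> 'rV[R]_m) x v (i : 'I_m) : differentiable g x ->
  'D_v (fun y => g y 0 i : R^o) x = 'D_v g x 0 i.
Proof.
move=> dg; have hi := is_diff_mxcoord i (g x).
have := @diff_comp _ _ _ _ g (fun u : 'rV[R]_m => u 0 i : R^o) x dg (is_diffW hi).
rewrite diff_val => E; rewrite (deriveE _ dg) deriveE; first by have /= -> := E.
exact: (differentiable_comp dg (is_diffW hi)).
Qed.

End ComplexCalculus.

(** * Functions, vector fields and Lie brackets in charts *)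

Section ManifoldCalculus.
Variables (R : realType) (m : nat) (M : topologicalType) (A : atlas 'rV[R]_m M).
Local Notation C := R[i].
Local Notation vfield := (M -> 'rV[C]_m).
Implicit Types (W : set M) (f g : M -> C) (X Y Z : vfield) (x y : M) (v w : 'rV[C]_m).

(* The derivative of a function along a tangent vector and the coordinate vector
   fields are sealed, since conversion problems involving their bodies are
   intractable. *)
Fact dv_sig : {d : 'rV[C]_m -> (M -> C) -> M -> C | d = fun v f x => pairing v (diff A f x)}.
Proof. by eexists. Qed.
Definition dv := sval dv_sig.
Fact dco_sig : {d : M -> 'I_m -> vfield | d = dcoord A}.
Proof. by eexists. Qed.
Definition dco := sval dco_sig.
Definition vd X f x : C := dv (X x) f x.

Lemma dv_pairing v f x : dv v f x = pairing v (diff A f x).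
Proof. by rewrite /dv (svalP dv_sig). Qed.

Lemma dcoE : dco = dcoord A. Proof. by rewrite /dco (svalP dco_sig). Qed.

Lemma vderE X f : vder A X f = vd X f.
Proof. by apply/funext => x; rewrite /vd dv_pairing. Qed.

Lemma vdE X f x : vd X f x = dv (X x) f x. Proof. by []. Qed.

Lemma smooth_vfieldP W X : smooth_vfield A W X <->
  forall x i, smooth_on A (dom A x `&` W) (vd X (coord A x i)).
Proof. by split=> h x i; have := h x i; rewrite vderE. Qed.

Lemma pairingE v w : pairing v w = \sum_i v 0 i * w 0 i.
Proof. by rewrite /pairing mxE; apply: eq_bigr => i _; rewrite mxE. Qed.

Lemma dvE v f x : dv v f x =
  \sum_i v 0 i * cderive (f \o param A x) (chart A x x) (delta_mx 0 i).
Proof. by rewrite dv_pairing pairingE; apply: eq_bigr => i _; rewrite mxE. Qed.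

Lemma chart_imageP x W z : (chart A x @` (dom A x `&` W)) z ->
  [/\ dom A x (param A x z), W (param A x z) & chart A x (param A x z) = z].
Proof. by move=> [y [dy Wy] <-]; rewrite chartK. Qed.

Lemma chart_image_open x W : open W -> open (chart A x @` (dom A x `&` W)).
Proof.
move=> oW; rewrite openE => z Hz; have [d w E] := chart_imageP Hz.
have Iz : (chart A x @` dom A x) z by exists (param A x z).
have n1 : \forall z' \near z, (chart A x @` dom A x) z'.
  exact: open_nbhs_nbhs (conj (chart_open A x) Iz).
have n2 : \forall z' \near z, W (param A x z').
  by apply: (param_continuous Iz); exact: open_nbhs_nbhs.
apply: filterS2 n1 n2 => z' [y dy <-]; rewrite chartK // => Wy.
by exists y.
Qed.

Lemma near_chart x W y : open W -> W y -> dom A x y ->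
  \forall z \near chart A x y,
    [/\ dom A x (param A x z), W (param A x z) & chart A x (param A x z) = z].
Proof.
move=> oW Wy dy; have h : (chart A x @` (dom A x `&` W)) (chart A x y) by exists y.
have n := open_nbhs_nbhs (conj (chart_image_open (x:=x) oW) h).
by apply: filterS n => z; exact: chart_imageP.
Qed.

Lemma smooth_on_sub W W' f : W' `<=` W -> smooth_on A W f -> smooth_on A W' f.
Proof.
move=> WW sf x; apply: csmooth_sub (sf x) => _ [y [dy wy] <-].
by exists y => //; split => //; exact: WW.
Qed.

Lemma smooth_on_ext W f g : open W -> (forall x, W x -> f x = g x) ->
  smooth_on A W f -> smooth_on A W g.
Proof.
move=> oW fg sf x; apply: csmooth_ext (sf x); first exact: chart_image_open.
by move=> z /chart_imageP[_ Wz _] /=; exact: fg.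
Qed.

Lemma smooth_on_cst W (a : C) : open W -> smooth_on A W (fun=> a).
Proof. by move=> oW x; apply: csmooth_cst; exact: chart_image_open. Qed.

Lemma smooth_onD W f g : open W -> smooth_on A W f -> smooth_on A W g ->
  smooth_on A W (fun x => f x + g x).
Proof. by move=> oW sf sg x; apply: csmoothD => //; exact: chart_image_open. Qed.

Lemma smooth_onM W f g : open W -> smooth_on A W f -> smooth_on A W g ->
  smooth_on A W (fun x => f x * g x).
Proof. by move=> oW sf sg x; apply: csmoothM => //; exact: chart_image_open. Qed.

Lemma smooth_onN W f : open W -> smooth_on A W f -> smooth_on A W (fun x => - f x).
Proof.
move=> oW sf; apply: (smooth_on_ext oW _ (smooth_onM oW (smooth_on_cst (-1) oW) sf)).
by move=> x _; rewrite mulN1r.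
Qed.

Lemma smooth_onB W f g : open W -> smooth_on A W f -> smooth_on A W g ->
  smooth_on A W (fun x => f x - g x).
Proof. by move=> oW sf sg; apply: smooth_onD => //; exact: smooth_onN. Qed.

Lemma smooth_on_sum W (I : Type) (r : seq I) (f : I -> M -> C) : open W ->
  (forall i, smooth_on A W (f i)) -> smooth_on A W (fun x => \sum_(i <- r) f i x).
Proof. by move=> oW sf x; apply: csmooth_sum => [|i]; [exact: chart_image_open|exact: sf]. Qed.

Lemma smooth_onV W f : open W -> (forall x, W x -> f x != 0) ->
  smooth_on A W f -> smooth_on A W (fun x => (f x)^-1).
Proof.
move=> oW f0 sf x; apply: csmoothV => //; first exact: chart_image_open.
by move=> z /chart_imageP[_ Wz _] /=; exact: f0.
Qed.

Lemma Ck_local (V V' : normedModType R) n (U : set V) (h : V -> V') :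
  (forall z : V, U z -> exists2 U' : set V, U' z & Ck n U' h) -> Ck n U h.
Proof.
elim: n h => [|n IH] h H; first by move=> x /H[U' U'x]; apply.
split=> [x /H[U' U'x [df _]]|v]; first exact: df.
by apply: IH => x /H[U' U'x [_ cf]]; exists U' => //; exact: cf.
Qed.

Lemma smooth_on_local W f :
  (forall x, W x -> exists2 W', W' x & smooth_on A W' f) -> smooth_on A W f.
Proof.
move=> H x; split=> n; apply: Ck_local => z /chart_imageP[d w E];
  have [W' W'z sf] := H _ w; exists (chart A x @` (dom A x `&` W'));
  by [exists (param A x z)|exact: (sf x).1|exact: (sf x).2].
Qed.

Lemma cdifferentiable_chart x W f y : smooth_on A W f -> W y -> dom A x y ->
  cdifferentiable (f \o param A x) (chart A x y).
Proof. by move=> sf Wy dy; apply: csmooth_cdifferentiable (sf x) _; exists y. Qed.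

Lemma transition_differentiable x y z : dom A x z -> dom A y z ->
  differentiable (chart A y \o param A x) (chart A x z).
Proof. by move=> dx dy; apply: (@transition_smooth _ _ _ A x y 1%N).1; exists z. Qed.

Lemma cderive_transition x y f W : open W -> smooth_on A W f -> W y -> dom A x y ->
  forall z u, dom A z y ->
  cderive (f \o param A z) (chart A z y) u =
  cderive (f \o param A x) (chart A x y) ('D_u (chart A x \o param A z) (chart A z y)).
Proof.
move=> oW sf Wy dx z u dz.
have K : (chart A x \o param A z) (chart A z y) = chart A x y by rewrite /= chartK.
rewrite -[in RHS]K -cderive_chain; first last.
- by rewrite K; exact: cdifferentiable_chart sf Wy dx.
- exact: transition_differentiable.
apply: cderive_near; apply: filterS (near_chart (openI oW (@dom_open _ _ _ A x)) (conj Wy dx) dz).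
by move=> t [_ [_ d] _] /=; rewrite chartK.
Qed.

Lemma diff_coord x y u j : dom A x y ->
  cderive (coord A x j \o param A y) (chart A y y) u =
  ('D_u (chart A x \o param A y) (chart A y y) 0 j)%:C%C.
Proof.
move=> dx; apply: complexE => /=; last by rewrite derive_cst.
by rewrite -derive_mxcoord //; apply: transition_differentiable => //; exact: dom_self.
Qed.

Lemma dv_chart x y f W v : open W -> smooth_on A W f -> W y -> dom A x y ->
  dv v f y = \sum_j dv v (coord A x j) y *
    cderive (f \o param A x) (chart A x y) (delta_mx 0 j).
Proof.
move=> oW sf Wy dx; rewrite dvE.
under eq_bigr => i _.
  rewrite (cderive_transition oW sf Wy dx _ (dom_self A y)).
  rewrite (cderive_row _ (cdifferentiable_chart sf Wy dx)) big_distrr /=.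
  over.
rewrite exchange_big; apply: eq_bigr => j _; rewrite dvE big_distrl /=.
by apply: eq_bigr => i _; rewrite diff_coord // mulrA.
Qed.

Lemma dv_dcoord x y j f W : open W -> smooth_on A W f -> W y -> dom A x y ->
  dv (dco x j y) f y = cderive (f \o param A x) (chart A x y) (delta_mx 0 j).
Proof.
move=> oW sf Wy dx; rewrite dvE (cderive_transition oW sf Wy (dom_self A y)) //.
rewrite (cderive_row _ (cdifferentiable_chart sf Wy (dom_self A y))).
by apply: eq_bigr => i _; rewrite dcoE mxE.
Qed.

Lemma dv_expand x y f W v : open W -> smooth_on A W f -> W y -> dom A x y ->
  dv v f y = \sum_j dv v (coord A x j) y * dv (dco x j y) f y.
Proof.
move=> oW sf Wy dx; rewrite (dv_chart _ oW sf Wy dx).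
by apply: eq_bigr => j _; rewrite (dv_dcoord _ oW sf Wy dx).
Qed.

Lemma coord_smooth x j : smooth_on A (dom A x) (coord A x j).
Proof.
move=> y; split=> n.
  apply: (Ck_lin _ (is_diff_mxcoord j)).
    by apply: chart_image_open; exact: dom_open.
  exact: transition_smooth.
by apply: (@Ck_cst _ _ _ n _ (0 : R^o)); apply: chart_image_open; exact: dom_open.
Qed.

Lemma dv_dcoord_coord x y i j : dom A x y ->
  dv (dco x i y) (coord A x j) y = (i == j)%:R.
Proof.
move=> dx; rewrite (dv_dcoord i (@dom_open _ _ _ A x) (coord_smooth x j) dx dx).
rewrite (@cderive_near _ _ _ (fun z : 'rV[R]_m => (z 0 j)%:C%C)); last first.
  apply: filterS (near_chart (@dom_open _ _ _ A x) dx dx) => z [_ _ /= E].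
  by rewrite /coord E.
apply: complexE => /=; rewrite ?derive_cst.
  have h := is_diff_mxcoord j (chart A x y).
  rewrite deriveE ?diff_val; last exact: is_diffW h.
  by rewrite mxE /= eq_sym; case: eqP.
by case: eqP.
Qed.

(** The entries of a vector at [y] are its derivatives of the coordinates of the chart at [y], so
    the expansion of derivations in the frame of the chart at [x] is also an expansion of
    vectors. *)
Lemma vec_expand x y v : dom A x y ->
  v = \sum_j dv v (coord A x j) y *: dco x j y.
Proof.
move=> dx; apply/rowP => l.
have E w : w 0 l = dv w (coord A y l) y.
  rewrite dvE (bigD1 l) //= big1 ?addr0 => [|i il].
    have := dv_dcoord_coord l l (dom_self A y).
    rewrite (dv_dcoord l (@dom_open _ _ _ A y) (coord_smooth y l)) ?eqxx; try exact: dom_self.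
    by move=> ->; rewrite mulr1.
  have := dv_dcoord_coord i l (dom_self A y).
  rewrite (dv_dcoord i (@dom_open _ _ _ A y) (coord_smooth y l)) ?(negbTE il); try exact: dom_self.
  by move=> ->; rewrite mulr0.
rewrite E (dv_expand _ (@dom_open _ _ _ A y) (coord_smooth y l) (dom_self A y) dx).
by rewrite summxE; apply: eq_bigr => j _; rewrite mxE E.
Qed.

(** The bridge between the frame of a fixed chart and the pointwise components: a chart composed
    with its own parametrization is the identity near the centre. *)
Lemma dcoord_center x j : dco x j x = delta_mx 0 j.
Proof.
rewrite dcoE /dcoord; set u := derive _ _ _; have -> : u = delta_mx 0 j.
  rewrite /u (@near_eq_derive _ _ _ _ id) ?derive_id //.
  by apply: filterS (near_chart (@dom_open _ _ _ A x) (dom_self A x) (dom_self A x)) => z [].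
by rewrite map_delta_mx.
Qed.

Lemma dv_coord_center x j v : dv v (coord A x j) x = v 0 j.
Proof.
rewrite [in RHS](vec_expand v (dom_self A x)) summxE (bigD1 j) //= big1.
  by rewrite mxE dcoord_center mxE !eqxx mulr1 addr0.
by move=> i ij; rewrite mxE dcoord_center mxE [j == i]eq_sym (negbTE ij) andbF mulr0.
Qed.

Lemma diff_center x f i : diff A f x 0 i = dv (dco x i x) f x.
Proof.
rewrite dcoord_center dv_pairing pairingE (bigD1 i) //= big1 ?addr0 => [|j ij].
  by rewrite !mxE !eqxx mul1r.
by rewrite !mxE (negbTE ij) andbF mul0r.
Qed.

Lemma dvDl v w f x : dv (v + w) f x = dv v f x + dv w f x.
Proof. by rewrite !dv_pairing /pairing mulmxDl mxE. Qed.

Lemma dvZl a v f x : dv (a *: v) f x = a * dv v f x.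
Proof. by rewrite !dv_pairing /pairing -scalemxAl mxE. Qed.

Lemma dv0l f x : dv 0 f x = 0.
Proof. by rewrite !dv_pairing /pairing mul0mx mxE. Qed.

Lemma dvNl v f x : dv (- v) f x = - dv v f x.
Proof. by rewrite -scaleN1r dvZl mulN1r. Qed.

Lemma dvBl v w f x : dv (v - w) f x = dv v f x - dv w f x.
Proof. by rewrite dvDl dvNl. Qed.

Lemma dv_suml (I : Type) (r : seq I) (F : I -> 'rV[C]_m) f x :
  dv (\sum_(i <- r) F i) f x = \sum_(i <- r) dv (F i) f x.
Proof. by elim/big_ind2 : _ => [|a b c d <- <-|//]; rewrite ?dv0l // dvDl. Qed.

Lemma dv_ext W f g x v : open W -> W x -> (forall y, W y -> f y = g y) ->
  dv v f x = dv v g x.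
Proof.
move=> oW Wx fg; rewrite !dvE; apply: eq_bigr => i _; congr (_ * _).
apply: cderive_near; apply: filterS (near_chart oW Wx (dom_self A x)).
by move=> z [_ Wz _]; exact: fg.
Qed.

Lemma dv_cst (a : C) x v : dv v (fun=> a) x = 0.
Proof. by rewrite dvE big1 // => i _; rewrite cderive_cst mulr0. Qed.

Lemma dvD W f g x v : W x -> smooth_on A W f -> smooth_on A W g ->
  dv v (fun y => f y + g y) x = dv v f x + dv v g x.
Proof.
move=> Wx sf sg; rewrite !dvE -big_split /=; apply: eq_bigr => i _.
rewrite -mulrDr; congr (_ * _).
have d := dom_self A x.
exact: (cderiveD _ (cdifferentiable_chart sf Wx d) (cdifferentiable_chart sg Wx d)).
Qed.

Lemma dvM W f g x v : W x -> smooth_on A W f -> smooth_on A W g ->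
  dv v (fun y => f y * g y) x = dv v f x * g x + f x * dv v g x.
Proof.
move=> Wx sf sg; rewrite !dvE big_distrl big_distrr -big_split /=; apply: eq_bigr => i _.
have d := dom_self A x.
have -> := cderiveM (delta_mx 0 i) (cdifferentiable_chart sf Wx d) (cdifferentiable_chart sg Wx d).
by rewrite /= chartK // mulrDr mulrA mulrCA.
Qed.

Lemma dvN W f x v : open W -> W x -> smooth_on A W f ->
  dv v (fun y => - f y) x = - dv v f x.
Proof.
move=> oW Wx sf; rewrite -mulN1r -[RHS]add0r -[0 in RHS](mul0r (f x)) -[in RHS](dv_cst (-1) x v).
rewrite -(dvM _ Wx (smooth_on_cst _ oW) sf).
by apply: (dv_ext _ oW Wx) => y _; rewrite mulN1r.
Qed.

Lemma dvB W f g x v : open W -> W x -> smooth_on A W f -> smooth_on A W g ->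
  dv v (fun y => f y - g y) x = dv v f x - dv v g x.
Proof.
move=> oW Wx sf sg; rewrite (dvD _ Wx sf (smooth_onN oW sg)); congr (_ + _).
exact: dvN oW Wx sg.
Qed.

Lemma dvZ W f x v (a : C) : open W -> W x -> smooth_on A W f ->
  dv v (fun y => a * f y) x = a * dv v f x.
Proof.
by move=> oW Wx sf; rewrite (dvM _ Wx (smooth_on_cst _ oW) sf) dv_cst mul0r add0r.
Qed.

Lemma dv_sum W (I : Type) (r : seq I) (f : I -> M -> C) x v : open W -> W x ->
  (forall i, smooth_on A W (f i)) ->
  dv v (fun y => \sum_(i <- r) f i y) x = \sum_(i <- r) dv v (f i) x.
Proof.
move=> oW Wx sf; elim: r => [|i r IH].
  rewrite big_nil -[RHS](dv_cst 0 x v); apply: (dv_ext _ oW Wx) => y _.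
  by rewrite big_nil.
rewrite big_cons -IH -(dvD _ Wx (sf i) (smooth_on_sum r oW sf)).
by apply: (dv_ext _ oW Wx) => y _; rewrite big_cons.
Qed.

Lemma vec_eq x y v w : dom A x y ->
  (forall j, dv v (coord A x j) y = dv w (coord A x j) y) -> v = w.
Proof.
move=> dx H; rewrite (vec_expand v dx) (vec_expand w dx).
by apply: eq_bigr => j _; rewrite H.
Qed.

(** Smooth transition maps make one chart covering [W] enough, although [smooth_on] asks for all
    charts. *)
Lemma smooth_on_chart x W f : open W -> W `<=` dom A x ->
  csmooth (chart A x @` W) (f \o param A x) -> smooth_on A W f.
Proof.
move=> oW Wx sf y.
have o : open (chart A y @` (dom A y `&` W)) by exact: chart_image_open.
have o' : open (chart A x @` W).
  by rewrite -(setIidr Wx); exact: chart_image_open.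
have H : csmooth (chart A y @` (dom A y `&` W))
    (fun z => (f \o param A x) ((chart A x \o param A y) z)).
  apply: (csmooth_comp (finite_dim_rV _ _) o o' _ sf).
    by move=> z /chart_imageP[_ Wz _]; exists (param A y z).
  move=> n; apply: Ck_sub (@transition_smooth _ _ _ A y x n).
  by move=> _ [z [dz Wz] <-]; exists z => //; split => //; exact: Wx.
apply: csmooth_ext H => // z /chart_imageP[_ /Wx Wz _] /=.
by rewrite chartK.
Qed.

Lemma smooth_vd W X f : open W -> smooth_vfield A W X -> smooth_on A W f ->
  smooth_on A W (vd X f).
Proof.
move=> oW sX sf x.
have o := chart_image_open (x:=x) oW.
have H : csmooth (chart A x @` (dom A x `&` W)) (fun z => \sum_j
   (vd X (coord A x j) \o param A x) z * cderive (f \o param A x) z (delta_mx 0 j)).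
  apply: csmooth_sum => // j; apply: csmoothM => //.
    apply: csmooth_sub ((smooth_vfieldP _ _).1 sX x j x) => _ [y [dy wy] <-]; by exists y.
  exact: csmooth_derive (sf x).
apply: csmooth_ext H => // z /chart_imageP[d w E].
rewrite /= vdE (dv_chart _ oW sf w d) E.
by apply: eq_bigr => j _; rewrite vdE.
Qed.

Lemma smooth_dcoord x i : smooth_vfield A (dom A x) (dco x i).
Proof.
apply/smooth_vfieldP => y j; set W := _ `&` _.
have oW : open W by apply: openI; exact: dom_open.
apply: (@smooth_on_chart x) => //; first by move=> z [].
have sc : smooth_on A W (coord A y j) by apply: smooth_on_sub (coord_smooth y j) => z [].
have o : open (chart A x @` W).
  have -> : W = dom A x `&` W by apply/seteqP; split=> z; rewrite /W /=; tauto.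
  exact: chart_image_open.
have h : csmooth (chart A x @` W) (coord A y j \o param A x).
  by apply: csmooth_sub (sc x) => _ [z Wz <-]; exists z => //; split => //; case: Wz.
apply: csmooth_ext (csmooth_derive (delta_mx 0 i) h) => // _ [z [dy dx] <-] /=.
by rewrite vdE chartK // (dv_dcoord _ oW sc).
Qed.

Lemma smooth_vfield_sub W W' X : W' `<=` W -> smooth_vfield A W X -> smooth_vfield A W' X.
Proof.
move=> WW /smooth_vfieldP sX; apply/smooth_vfieldP => x i.
by apply: smooth_on_sub (sX x i) => y [? /WW].
Qed.

Lemma smooth_vfield_ext W X Y : open W -> (forall x, W x -> X x = Y x) ->
  smooth_vfield A W X -> smooth_vfield A W Y.
Proof.
move=> oW XY /smooth_vfieldP sX; apply/smooth_vfieldP => x i; apply: smooth_on_ext (sX x i).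
  by apply: openI => //; exact: dom_open.
by move=> y [_ Wy]; rewrite !vdE XY.
Qed.

Lemma smooth_vfieldD W X Y : open W -> smooth_vfield A W X -> smooth_vfield A W Y ->
  smooth_vfield A W (fun x => X x + Y x).
Proof.
move=> oW /smooth_vfieldP sX /smooth_vfieldP sY; apply/smooth_vfieldP => x i.
have o : open (dom A x `&` W) by apply: openI => //; exact: dom_open.
apply: (smooth_on_ext o _ (smooth_onD o (sX x i) (sY x i))) => y _.
by rewrite !vdE dvDl.
Qed.

Lemma smooth_vfieldZ W f X : open W -> smooth_on A W f -> smooth_vfield A W X ->
  smooth_vfield A W (fun x => f x *: X x).
Proof.
move=> oW sf /smooth_vfieldP sX; apply/smooth_vfieldP => x i.
have o : open (dom A x `&` W) by apply: openI => //; exact: dom_open.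
apply: (smooth_on_ext o _ (smooth_onM o _ (sX x i))); last first.
  by apply: smooth_on_sub sf => y [].
by move=> y _; rewrite !vdE dvZl.
Qed.

Lemma smooth_vfield0 W : open W -> smooth_vfield A W (fun=> 0).
Proof.
move=> oW; apply/smooth_vfieldP => x i.
have o : open (dom A x `&` W) by apply: openI => //; exact: dom_open.
apply: (smooth_on_ext o _ (smooth_on_cst 0 o)) => y _.
by rewrite vdE dv0l.
Qed.

Lemma smooth_vfield_sum W (I : Type) (r : seq I) (X : I -> vfield) : open W ->
  (forall i, smooth_vfield A W (X i)) -> smooth_vfield A W (fun x => \sum_(i <- r) X i x).
Proof.
move=> oW sX; elim: r => [|i r IH].
  by apply: (smooth_vfield_ext oW _ (smooth_vfield0 oW)) => x _; rewrite big_nil.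
by apply: (smooth_vfield_ext oW _ (smooth_vfieldD oW (sX i) IH)) => x _; rewrite big_cons.
Qed.

(** Both sides are iterated partial derivatives in the one chart at [x], to which Schwarz's theorem
    applies. *)
Lemma dcoord_swap x i j f W y : open W -> smooth_on A W f -> W y -> dom A x y ->
  vd (dco x i) (vd (dco x j) f) y =
  vd (dco x j) (vd (dco x i) f) y.
Proof.
move=> oW sf Wy dx.
have oW' : open (dom A x `&` W) by apply: openI => //; exact: dom_open.
have sf' : smooth_on A (dom A x `&` W) f by apply: smooth_on_sub sf => z [].
have E k l : vd (dco x k) (vd (dco x l) f) y =
    cderive (fun z => cderive (f \o param A x) z (delta_mx 0 l)) (chart A x y) (delta_mx 0 k).
  rewrite vdE (dv_dcoord k oW' (smooth_vd oW' _ sf')) //; last first.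
    by apply: smooth_vfield_sub (smooth_dcoord x l) => z [].
  apply: cderive_near; apply: filterS (near_chart oW Wy dx) => z [d w e] /=.
  by rewrite vdE (dv_dcoord l oW sf) // e.
have Iy : (chart A x @` (dom A x `&` W)) (chart A x y) by exists y.
rewrite (E i j) (E j i).
have := cderive_swap (delta_mx 0 i) (delta_mx 0 j) (chart_image_open (x:=x) oW) Iy (sf x).
exact.
Qed.

(** [bracket] is defined by its action on the coordinates of the chart at [x]. When X[Y[f]] and
    Y[X[f]] are expanded in the frame of this chart, the second derivatives of [f] form a sum
    symmetric in [X] and [Y]; after subtraction only the action on the coordinates remains. *)
Lemma dv_bracket W X Y f x : open W -> W x -> smooth_vfield A W X -> smooth_vfield A W Y ->
  smooth_on A W f ->
  dv (bracket A X Y x) f x = vd X (vd Y f) x - vd Y (vd X f) x.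
Proof.
move: W => W0 oW0 W0x sX0 sY0 sf0.
pose W := dom A x `&` W0.
have oW : open W by apply: openI => //; exact: dom_open.
have Wx : W x by split => //; exact: dom_self.
have sub : W `<=` W0 by move=> y [].
have sX := smooth_vfield_sub sub sX0; have sY := smooth_vfield_sub sub sY0.
have sf := smooth_on_sub sub sf0.
have sd j : smooth_on A W (vd (dco x j) f).
  by apply: smooth_vd => //; apply: smooth_vfield_sub (smooth_dcoord x j) => y [].
have sc Z j : smooth_vfield A W Z -> smooth_on A W (vd Z (coord A x j)).
  by move=> sZ; apply: smooth_vd => //; apply: smooth_on_sub (coord_smooth x j) => y [].
have E Y' Z : smooth_vfield A W Y' -> smooth_vfield A W Z ->
    vd Y' (vd Z f) x = \sum_j (vd Y' (vd Z (coord A x j)) x * vd (dco x j) f x)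
   + \sum_j \sum_i (Z x 0 j * (Y' x 0 i * vd (dco x i) (vd (dco x j) f) x)).
  move=> sY' sZ; rewrite -big_split /=.
  rewrite vdE (@dv_ext W _ (fun y => \sum_j vd Z (coord A x j) y * vd (dco x j) f y)) //.
    rewrite (@dv_sum W) //; last first.
      by move=> j; apply: smooth_onM => //; exact: sc.
    apply: eq_bigr => j _; rewrite (@dvM W) //; last exact: sc.
    rewrite -(vdE Y'); congr (_ + _).
    rewrite vdE dv_coord_center (dv_expand _ oW (sd j) Wx (dom_self A x)) big_distrr.
    by apply: eq_bigr => i _; rewrite dv_coord_center vdE.
  by move=> y [dy wy]; rewrite vdE (dv_expand _ oW0 sf0 wy dy).
have S : \sum_j \sum_i (Y x 0 j * (X x 0 i * vd (dco x i) (vd (dco x j) f) x))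
  = \sum_j \sum_i (X x 0 j * (Y x 0 i * vd (dco x i) (vd (dco x j) f) x)).
  rewrite exchange_big; apply: eq_bigr => j _; apply: eq_bigr => i _.
  by rewrite mulrCA (dcoord_swap _ _ oW sf Wx (dom_self A x)).
rewrite !E // S opprD addrACA subrr addr0 -sumrB.
rewrite (dv_expand _ oW sf Wx (dom_self A x)); apply: eq_bigr => j _.
by rewrite -mulrBl dv_coord_center mxE !vderE.
Qed.

(** Sealed for the same reason as [dv] and [dco]. *)
Fact brk_sig : {d : vfield -> vfield -> vfield | d = bracket A}.
Proof. by eexists. Qed.
Definition brk := sval brk_sig.
Lemma brkE : brk = bracket A. Proof. by rewrite /brk (svalP brk_sig). Qed.

Lemma dv_brk W X Y f x : open W -> W x -> smooth_vfield A W X -> smooth_vfield A W Y ->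
  smooth_on A W f -> dv (brk X Y x) f x = vd X (vd Y f) x - vd Y (vd X f) x.
Proof. by rewrite brkE; exact: dv_bracket. Qed.

Lemma smooth_vfieldN W X : open W -> smooth_vfield A W X -> smooth_vfield A W (fun x => - X x).
Proof.
move=> oW sX; apply: (smooth_vfield_ext oW _ (smooth_vfieldZ oW (smooth_on_cst (-1) oW) sX)).
by move=> x _; rewrite scaleN1r.
Qed.

Lemma smooth_vfieldB W X Y : open W -> smooth_vfield A W X -> smooth_vfield A W Y ->
  smooth_vfield A W (fun x => X x - Y x).
Proof. by move=> oW sX sY; apply: smooth_vfieldD => //; exact: smooth_vfieldN. Qed.

Lemma smooth_brk W X Y : open W -> smooth_vfield A W X -> smooth_vfield A W Y ->
  smooth_vfield A W (brk X Y).
Proof.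
move=> oW sX sY; apply/smooth_vfieldP => x i; set W' := _ `&` _.
have oW' : open W' by apply: openI => //; exact: dom_open.
have sub : W' `<=` W by move=> y [].
have sX' := smooth_vfield_sub sub sX; have sY' := smooth_vfield_sub sub sY.
have sc : smooth_on A W' (coord A x i) by apply: smooth_on_sub (coord_smooth x i) => y [].
have H := smooth_onB oW' (smooth_vd oW' sX' (smooth_vd oW' sY' sc))
  (smooth_vd oW' sY' (smooth_vd oW' sX' sc)).
by apply: (smooth_on_ext oW' _ H) => y Wy; rewrite [RHS]vdE (dv_brk oW' Wy sX' sY' sc).
Qed.

Lemma brk_dco x i j y : dom A x y -> brk (dco x i) (dco x j) y = 0.
Proof.
move=> dx; have oD := @dom_open _ _ _ A x; apply: (vec_eq dx) => l.
rewrite dv0l (dv_brk oD dx (smooth_dcoord x i) (smooth_dcoord x j) (coord_smooth x l)).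
by rewrite (dcoord_swap _ _ oD (coord_smooth x l) dx dx) subrr.
Qed.

End ManifoldCalculus.

(** * Connections on vector fields and the divergence *)

Section Connections.
Variables (R : realType) (m : nat) (M : topologicalType) (A : atlas 'rV[R]_m M).
Local Notation C := R[i].
Local Notation vfield := (M -> 'rV[C]_m).
Local Notation smoothv := (smooth_vfield A).
Local Notation smoothf := (smooth_on A).
Implicit Types (W : set M) (f g h : M -> C) (X Y Z : vfield) (x y : M) (v w : 'rV[C]_m).

Lemma form_sum (B : 'M[C]_m) v w : form B v w = \sum_i \sum_j v 0 i * B i j * w 0 j.
Proof.
rewrite /form mxE exchange_big; apply: eq_bigr => j _; rewrite !mxE big_distrl.
by apply: eq_bigr => i _.
Qed.
Lemma formDl (B : 'M[C]_m) u v w : form B (u + v) w = form B u w + form B v w.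
Proof. by rewrite /form !mulmxDl mxE. Qed.
Lemma formZl (B : 'M[C]_m) a v w : form B (a *: v) w = a * form B v w.
Proof. by rewrite /form -!scalemxAl mxE. Qed.
Lemma formZr (B : 'M[C]_m) a v w : form B v (a *: w) = a * form B v w.
Proof. by rewrite /form linearZ /= -scalemxAr mxE. Qed.
Lemma formNl (B : 'M[C]_m) v w : form B (- v) w = - form B v w.
Proof. by rewrite -scaleN1r formZl mulN1r. Qed.
Lemma formBl (B : 'M[C]_m) u v w : form B (u - v) w = form B u w - form B v w.
Proof. by rewrite formDl formNl. Qed.
Lemma form_tr (B : 'M[C]_m) v w : form B^T v w = form B w v.
Proof.
by rewrite !form_sum exchange_big; apply: eq_bigr => i _; apply: eq_bigr => j _;
   rewrite mxE mulrC mulrA mulrAC.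
Qed.
Lemma form_delta (B : 'M[C]_m) i j : form B (delta_mx 0 i) (delta_mx 0 j) = B i j.
Proof. by rewrite /form -rowE trmx_delta -colE !mxE. Qed.

Lemma dom_openI x W : open W -> open (dom A x `&` W).
Proof. by move=> oW; apply: openI => //; exact: dom_open. Qed.

Section OneConnection.
Variables (D : vfield -> vfield -> vfield) (hD : is_connection A D).

Lemma conn_smooth W X Y : open W -> smoothv W X -> smoothv W Y -> smoothv W (D X Y).
Proof.
by move=> oW sX sY; have [] := hD oW sX sX sY sY (smooth_on_cst A 0 oW).
Qed.

Lemma connDl W X X' Y x : open W -> W x -> smoothv W X -> smoothv W X' -> smoothv W Y ->
  D (fun y => X y + X' y) Y x = D X Y x + D X' Y x.
Proof.
move=> oW Wx sX sX' sY.
by have [_ /(_ x Wx)[]] := hD oW sX sX' sY sY (smooth_on_cst A 0 oW).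
Qed.

Lemma connZl W f X Y x : open W -> W x -> smoothf W f -> smoothv W X -> smoothv W Y ->
  D (fun y => f y *: X y) Y x = f x *: D X Y x.
Proof.
by move=> oW Wx sf sX sY; have [_ /(_ x Wx)[]] := hD oW sX sX sY sY sf.
Qed.

Lemma connDr W X Y Y' x : open W -> W x -> smoothv W X -> smoothv W Y -> smoothv W Y' ->
  D X (fun y => Y y + Y' y) x = D X Y x + D X Y' x.
Proof.
move=> oW Wx sX sY sY'.
by have [_ /(_ x Wx)[]] := hD oW sX sX sY sY' (smooth_on_cst A 0 oW).
Qed.

Lemma connZr W f X Y x : open W -> W x -> smoothf W f -> smoothv W X -> smoothv W Y ->
  D X (fun y => f y *: Y y) x = vd A X f x *: Y x + f x *: D X Y x.
Proof.
move=> oW Wx sf sX sY; have [_ /(_ x Wx)[_ _ _ ->]] := hD oW sX sX sY sY sf.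
by rewrite vderE.
Qed.

(* Multiplying by the indicator of the complement of [W] shows that the values
   of a connection on [W] only depend on the restrictions to [W]. *)
Let off W (y : M) : C := if `[< W y >] then 0 else 1.

Let smooth_off W : open W -> smoothf W (off W).
Proof.
move=> oW; apply: (smooth_on_ext oW _ (smooth_on_cst A 0 oW)) => y Wy.
by rewrite /off asboolT.
Qed.

Let off_scale W Z : (forall y, W y -> Z y = 0) -> (fun y => off W y *: Z y) = Z.
Proof.
move=> Z0; apply/funext => y; rewrite /off.
by case: asboolP => [/Z0 ->|_]; rewrite ?scaler0 ?scale1r.
Qed.

Lemma conn_extr W X Y Y' x : open W -> W x -> smoothv W X -> smoothv W Y ->
  (forall y, W y -> Y y = Y' y) -> D X Y x = D X Y' x.
Proof.
move=> oW Wx sX sY E; have sY' := smooth_vfield_ext oW E sY.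
pose Z y := Y' y - Y y.
have Z0 y : W y -> Z y = 0 by move=> /E Ey; rewrite /Z Ey subrr.
have sZ : smoothv W Z by apply: smooth_vfieldB.
have -> : Y' = fun y => Y y + Z y by apply/funext => y; rewrite /Z addrC subrK.
rewrite (connDr oW Wx sX sY sZ) -(off_scale Z0) (connZr oW Wx (smooth_off oW) sX sZ).
by rewrite Z0 // scaler0 /off asboolT // scale0r !addr0.
Qed.

Lemma conn_extl W X X' Y x : open W -> W x -> smoothv W X -> smoothv W Y ->
  (forall y, W y -> X y = X' y) -> D X Y x = D X' Y x.
Proof.
move=> oW Wx sX sY E; have sX' := smooth_vfield_ext oW E sX.
pose Z y := X' y - X y.
have Z0 y : W y -> Z y = 0 by move=> /E Ey; rewrite /Z Ey subrr.
have sZ : smoothv W Z by apply: smooth_vfieldB.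
have -> : X' = fun y => X y + Z y by apply/funext => y; rewrite /Z addrC subrK.
rewrite (connDl oW Wx sX sZ sY) -(off_scale Z0) (connZl oW Wx (smooth_off oW) sZ sY).
by rewrite /off asboolT // scale0r !addr0.
Qed.

Lemma conn0l W Y x : open W -> W x -> smoothv W Y -> D (fun=> 0) Y x = 0.
Proof.
move=> oW Wx sY; have s0 := smooth_vfield0 A oW.
have := connZl oW Wx (smooth_on_cst A 0 oW) s0 sY.
by rewrite !(scaler0, scale0r).
Qed.

Lemma conn_suml W (I : Type) (r : seq I) (f : I -> M -> C) (X : I -> vfield) Y x :
  open W -> W x -> (forall i, smoothf W (f i)) -> (forall i, smoothv W (X i)) ->
  smoothv W Y ->
  D (fun y => \sum_(i <- r) f i y *: X i y) Y x = \sum_(i <- r) f i x *: D (X i) Y x.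
Proof.
move=> oW Wx sf sX sY.
have sfX i : smoothv W (fun y => f i y *: X i y) by apply: smooth_vfieldZ.
elim: r => [|i r IH].
  rewrite big_nil -[RHS](conn0l oW Wx sY).
  by apply: (conn_extl oW Wx (smooth_vfield_sum [::] oW sfX) sY) => y _; rewrite big_nil.
rewrite big_cons -IH -(connZl oW Wx (sf i) (sX i) sY).
rewrite -(connDl oW Wx (sfX i) (smooth_vfield_sum r oW sfX) sY).
apply: (conn_extl oW Wx (smooth_vfield_sum (i :: r) oW sfX) sY) => y _.
by rewrite big_cons.
Qed.

(** The matrix of the endomorphism v |-> D_v X of the tangent space at [x]; vectors multiply it from
    the left, so row [l] is the derivative along the [l]-th basis vector. *)
Definition covmx X x : 'M[C]_m := \matrix_l D (dco A x l) X x.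

(** Near [x], the field [X] is a combination of coordinate fields, and [D] is linear over functions
    in this argument; so only the value of [X] at [x] counts. *)
Lemma conn_covmx W X Y x : open W -> W x -> smoothv W X -> smoothv W Y ->
  D X Y x = X x *m covmx Y x.
Proof.
move=> oW0 W0x sX0 sY0; pose W1 := dom A x `&` W.
have oW : open W1 by exact: dom_openI.
have Wx : W1 x by split => //; exact: dom_self.
have sub : W1 `<=` W by move=> y [].
have sX := smooth_vfield_sub sub sX0; have sY := smooth_vfield_sub sub sY0.
have sd j : smoothv W1 (dco A x j) by apply: smooth_vfield_sub (smooth_dcoord A x j) => y [].
have sc j : smoothf W1 (vd A X (coord A x j)).
  by apply: smooth_vd => //; apply: smooth_on_sub (coord_smooth A x j) => y [].
rewrite (conn_extl (X' := fun y => \sum_j vd A X (coord A x j) y *: dco A x j y) oW Wx sX sY).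
  rewrite (conn_suml _ oW Wx sc sd sY) mulmx_sum_row; apply: eq_bigr => j _.
  by rewrite rowK vdE dv_coord_center.
by move=> y [dy _]; rewrite [LHS](vec_expand _ dy).
Qed.

Definition divv X x : C := \tr (covmx X x).

Lemma divvE X x : divv X x = \sum_l D (dco A x l) X x 0 l.
Proof. by apply: eq_bigr => l _; rewrite mxE. Qed.

(** [divv] at [y] is a trace in the chart at [y], which does not show how it varies with [y]. The
    trace is the same in the frame of a fixed chart: [P] and [Q] hold that frame and its dual
    coframe. *)
Lemma divv_chart W X x y : open W -> W y -> dom A x y -> smoothv W X ->
  divv X y = \sum_l vd A (D (dco A x l) X) (coord A x l) y.
Proof.
move=> oW0 W0y dx sX0; pose W1 := dom A x `&` W.
have oW : open W1 by exact: dom_openI.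
have Wy : W1 y by split => //; exact: dom_self.
have sub : W1 `<=` W by move=> z [].
have sX := smooth_vfield_sub sub sX0.
have sd j : smoothv W1 (dco A x j) by apply: smooth_vfield_sub (smooth_dcoord A x j) => z [].
pose P := \matrix_l dco A x l y.
pose Q := (\matrix_l diff A (coord A x l) y)^T.
have QP : Q *m P = 1%:M.
  apply/row_matrixP => i; rewrite row_mul mulmx_sum_row row1.
  rewrite [RHS](vec_expand _ dx); apply: eq_bigr => j _; rewrite !mxE rowK.
  by rewrite dv_pairing pairingE (bigD1 i) //= big1 ?mxE ?eqxx ?mul1r ?addr0 // => k ki;
     rewrite mxE (negbTE ki) andbF mul0r.
rewrite /divv -[covmx X y]mulmx1 -QP mulmxA mxtrace_mulC mulmxA.
apply: eq_bigr => l _; rewrite vdE (conn_covmx oW Wy (sd l) sX) dv_pairing /pairing.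
rewrite mxE [RHS]mxE; apply: eq_bigr => j _; congr (_ * _); last by rewrite !mxE.
by rewrite mxE [RHS]mxE; apply: eq_bigr => k _; rewrite mxE.
Qed.

Lemma smooth_divv W X : open W -> smoothv W X -> smoothf W (divv X).
Proof.
move=> oW sX; apply: smooth_on_local => x Wx; pose W1 := dom A x `&` W.
have oW1 : open W1 by exact: dom_openI.
exists W1; first by split => //; exact: dom_self.
have sub : W1 `<=` W by move=> z [].
have H : smoothf W1 (fun y => \sum_l vd A (D (dco A x l) X) (coord A x l) y).
  apply: smooth_on_sum => // l; apply: smooth_vd => //.
    apply: conn_smooth => //; last exact: smooth_vfield_sub sX.
    by apply: smooth_vfield_sub (smooth_dcoord A x l) => z [].
  by apply: smooth_on_sub (coord_smooth A x l) => z [].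
by apply: (smooth_on_ext oW1 _ H) => y [dy Wy]; rewrite [RHS](divv_chart oW Wy dy sX).
Qed.

Lemma divvD W X Y x : open W -> W x -> smoothv W X -> smoothv W Y ->
  divv (fun y => X y + Y y) x = divv X x + divv Y x.
Proof.
move=> oW0 W0x sX0 sY0; pose W1 := dom A x `&` W.
have oW : open W1 by exact: dom_openI.
have Wx : W1 x by split => //; exact: dom_self.
have sub : W1 `<=` W by move=> y [].
have sX := smooth_vfield_sub sub sX0; have sY := smooth_vfield_sub sub sY0.
rewrite !divvE -big_split; apply: eq_bigr => l _ /=.
rewrite (connDr oW Wx _ sX sY) ?mxE //.
by apply: smooth_vfield_sub (smooth_dcoord A x l) => z [].
Qed.

Lemma divvZ W f X x : open W -> W x -> smoothf W f -> smoothv W X ->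
  divv (fun y => f y *: X y) x = vd A X f x + f x * divv X x.
Proof.
move=> oW0 W0x sf0 sX0; pose W1 := dom A x `&` W.
have oW : open W1 by exact: dom_openI.
have Wx : W1 x by split => //; exact: dom_self.
have sub : W1 `<=` W by move=> y [].
have sX := smooth_vfield_sub sub sX0; have sf := smooth_on_sub sub sf0.
rewrite !divvE vdE (dv_expand _ oW sf Wx (dom_self A x)) big_distrr -big_split.
apply: eq_bigr => l _ /=; rewrite (connZr oW Wx sf _ sX) ?mxE.
  by rewrite vdE dv_coord_center mulrC.
by apply: smooth_vfield_sub (smooth_dcoord A x l) => z [].
Qed.

Lemma divv_ext W X Y x : open W -> W x -> smoothv W X ->
  (forall y, W y -> X y = Y y) -> divv X x = divv Y x.
Proof.
move=> oW0 W0x sX0 E; pose W1 := dom A x `&` W.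
have oW : open W1 by exact: dom_openI.
have Wx : W1 x by split => //; exact: dom_self.
have sX : smoothv W1 X by apply: smooth_vfield_sub sX0 => y [].
rewrite !divvE; apply: eq_bigr => l _.
have sd : smoothv W1 (dco A x l) by apply: smooth_vfield_sub (smooth_dcoord A x l) => z [].
by rewrite (conn_extr oW Wx sd sX (fun y e => E y e.2)).
Qed.

Lemma divv_sum W (I : Type) (r : seq I) (f : I -> M -> C) (X : I -> vfield) x :
  open W -> W x -> (forall i, smoothf W (f i)) -> (forall i, smoothv W (X i)) ->
  divv (fun y => \sum_(i <- r) f i y *: X i y) x =
  \sum_(i <- r) (vd A (X i) (f i) x + f i x * divv (X i) x).
Proof.
move=> oW Wx sf sX.
have sfX i : smoothv W (fun y => f i y *: X i y) by apply: smooth_vfieldZ.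
have s0 := smooth_vfield0 A oW.
elim: r => [|i r IH].
  rewrite big_nil (@divv_ext W _ (fun=> 0)) //.
  - rewrite (@divv_ext W _ (fun y => (fun=> 0 : C) y *: (fun=> 0 : 'rV[C]_m) y)) //.
      by rewrite (divvZ oW Wx (smooth_on_cst A 0 oW) s0) mul0r addr0 vdE dv0l.
    by move=> y _; rewrite scaler0.
  - exact: (smooth_vfield_sum [::] oW sfX).
  - by move=> y _; rewrite big_nil.
rewrite big_cons -IH -(divvZ oW Wx (sf i) (sX i)).
rewrite -(divvD oW Wx (sfX i) (smooth_vfield_sum r oW sfX)).
apply: (divv_ext oW Wx (smooth_vfield_sum (i :: r) oW sfX)) => y _.
by rewrite big_cons.
Qed.

(** The connection is left only in the divergences of the coordinate fields. To compare connections,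
    or to differentiate along a family of them, it is enough to control these. *)
Lemma divv_coord W X x y : open W -> W y -> dom A x y -> smoothv W X ->
  divv X y = \sum_q (vd A (dco A x q) (vd A X (coord A x q)) y
    + vd A X (coord A x q) y * divv (dco A x q) y).
Proof.
move=> oW0 W0y dx sX0; pose W1 := dom A x `&` W.
have oW : open W1 by exact: dom_openI.
have Wy : W1 y by split.
have sX : smoothv W1 X by apply: smooth_vfield_sub sX0 => z [].
have sd j : smoothv W1 (dco A x j) by apply: smooth_vfield_sub (smooth_dcoord A x j) => z [].
have sc j : smoothf W1 (vd A X (coord A x j)).
  by apply: smooth_vd => //; apply: smooth_on_sub (coord_smooth A x j) => z [].
rewrite -(divv_sum _ oW Wy sc sd); apply: (divv_ext oW Wy sX) => z [dz _].
exact: vec_expand.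
Qed.

End OneConnection.
End Connections.

(** * Matrix-valued functions and their derivatives *)

Section MatrixCalculus.
Variables (R : realType) (m : nat) (M : topologicalType) (A : atlas 'rV[R]_m M).
Local Notation C := R[i].
Implicit Types (W : set M) (x : M) (v : 'rV[C]_m) (F H : M -> 'M[C]_m).

Definition smooth_mx W F := forall i j, smooth_on A W (fun y => F y i j).

Definition dmx v F x : 'M[C]_m := \matrix_(i, j) dv A v (fun y => F y i j) x.

Lemma dmxM W v F H x : open W -> W x -> smooth_mx W F -> smooth_mx W H ->
  dmx v (fun y => F y *m H y) x = dmx v F x *m H x + F x *m dmx v H x.
Proof.
move=> oW Wx sF sH; apply/matrixP => i j; rewrite !mxE -big_split /=.
rewrite (@dv_ext _ _ _ _ W _ (fun y => \sum_k F y i k * H y k j)) //; last first.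
  by move=> y _; rewrite mxE.
rewrite (dv_sum _ _ oW Wx); last by move=> k; apply: smooth_onM.
by apply: eq_bigr => k _; rewrite (dvM _ Wx (sF i k) (sH k j)) !mxE.
Qed.

Lemma smooth_mxM W F H : open W -> smooth_mx W F -> smooth_mx W H ->
  smooth_mx W (fun y => F y *m H y).
Proof.
move=> oW sF sH i j.
have s : smooth_on A W (fun y => \sum_k F y i k * H y k j).
  by apply: smooth_on_sum => // k; apply: smooth_onM.
by apply: (smooth_on_ext oW _ s) => y _; rewrite mxE.
Qed.

Lemma smooth_mx_tr W F : smooth_mx W F -> smooth_mx W (fun y => (F y)^T).
Proof.
move=> sF i j; rewrite (_ : (fun y => _) = fun y => F y j i) //.
by apply/funext => y; rewrite mxE.
Qed.

Lemma dmx_tr v F x : dmx v (fun y => (F y)^T) x = (dmx v F x)^T.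
Proof.
apply/matrixP => i j; rewrite !mxE (_ : (fun y => _) = fun y => F y j i) //.
by apply/funext => y; rewrite mxE.
Qed.

Lemma dmx_ext W v F H x : open W -> W x -> (forall y, W y -> F y = H y) ->
  dmx v F x = dmx v H x.
Proof.
move=> oW Wx E; apply/matrixP => i j; rewrite !mxE.
by apply: (dv_ext _ _ oW Wx) => y Wy; rewrite E.
Qed.

Lemma dmx_cst v (B : 'M[C]_m) x : dmx v (fun=> B) x = 0.
Proof. by apply/matrixP => i j; rewrite !mxE dv_cst. Qed.

End MatrixCalculus.

(** [O], [I] and [O *m I^T] stand for the symplectic form, the complex structure and the metric in a
    frame, [dO] and [dI] for derivatives. Multiplying the last hypothesis by the inverse of
    [O *m I^T] and taking traces gives twice the trace of [K] on the right. On the left, the term in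
    [dI] is, up to sign, the trace of [I *m dI], which vanishes by the derivative of I^2 = -1. *)
Lemma two_trace (F : numFieldType) n (O I K dO dI : 'M[F]_n) :
  O \in unitmx -> I *m I = - 1%:M -> dI *m I + I *m dI = 0 ->
  dO *m I^T + O *m dI^T = K *m (O *m I^T) + O *m I^T *m K^T ->
  2 * \tr K = \tr (invmx O *m dO).
Proof.
move=> uO II dII E.
have uI : I^T \in unitmx.
  have /mulmx1_unit[uI _] : I *m (- I) = 1%:M by rewrite mulmxN II opprK.
  by rewrite unitmx_tr.
have trI : \tr (I *m dI) = 0.
  have := congr1 mxtrace dII; rewrite mxtrace0 mxtraceD (mxtrace_mulC dI) -mulr2n.
  by move/eqP; rewrite mulrn_eq0 /= => /eqP.
have invI : invmx I^T = - I^T.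
  have h : I^T *m (- I^T) = 1%:M by rewrite mulmxN -trmx_mul II linearN /= trmx1 opprK.
  by rewrite -[LHS]mulmx1 -h mulmxA mulVmx // mul1mx.
have hO := mulVmx uO; have hI := mulVmx uI; have hI' := mulmxV uI.
move: (invmx O) (invmx I^T) hO hI hI' invI => Oi Ii hO hI hI' invI.
have e1 : \tr (Ii *m Oi *m (K *m (O *m I^T))) = \tr K.
  by rewrite mxtrace_mulC -!mulmxA (mulmxA I^T) hI' mul1mx (mulmx1C hO) mulmx1.
have e2 : \tr (Ii *m Oi *m (O *m I^T *m K^T)) = \tr K.
  by rewrite -!mulmxA (mulmxA Oi) hO mul1mx mulmxA hI mul1mx mxtrace_tr.
have e3 : \tr (Ii *m Oi *m (dO *m I^T)) = \tr (Oi *m dO).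
  by rewrite mxtrace_mulC -!mulmxA (mulmxA I^T) hI' mul1mx mxtrace_mulC.
have e4 : \tr (Ii *m Oi *m (O *m dI^T)) = 0.
  rewrite -mulmxA (mulmxA Oi) hO mul1mx invI mulNmx linearN /= -trmx_mul.
  by rewrite mxtrace_tr mxtrace_mulC trI oppr0.
have := congr1 (fun B => \tr (Ii *m Oi *m B)) E.
rewrite [X in \tr X = _]mulmxDr [X in _ = \tr X]mulmxDr [LHS]mxtraceD [RHS]mxtraceD.
rewrite e1 e2 e3 e4 addr0 => ->.
by rewrite -mulr2n mulr_natl.
Qed.

(** * Levi-Civita connections and the symplectic divergence *)

Section LeviCivita.
Variables (R : realType) (m : nat) (M : topologicalType) (A : atlas 'rV[R]_m M).
Local Notation C := R[i].
Local Notation vfield := (M -> 'rV[C]_m).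
Local Notation cx := (map_mx (real_complex R)).
Local Notation smoothv := (smooth_vfield A).
Local Notation smoothf := (smooth_on A).
Implicit Types (W : set M) (f h : M -> C) (X Y Z : vfield) (x y : M) (v w : 'rV[C]_m).

Lemma smooth_dco x W j : W `<=` dom A x -> smoothv W (dco A x j).
Proof. by move=> Wx; apply: smooth_vfield_sub (smooth_dcoord A x j). Qed.

Definition jfield (J : M -> 'M[R]_m) X : vfield := fun y => X y *m cx (J y).

Lemma endo_compE (B : M -> 'M[C]_m) x i j y :
  endo_comp A x B i j y = dv A (dco A x i y *m B y) (coord A x j) y.
Proof. by rewrite dv_pairing dcoE. Qed.

Lemma form_compE (B : M -> 'M[C]_m) x i j y :
  form_comp A x B i j y = form (B y) (dco A x i y) (dco A x j y).
Proof. by rewrite dcoE. Qed.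

Lemma dv_endo (B : M -> 'M[C]_m) x v j y : dom A x y ->
  dv A (v *m B y) (coord A x j) y = \sum_i dv A v (coord A x i) y * endo_comp A x B i j y.
Proof.
move=> dx; rewrite [in LHS](vec_expand v dx) mulmx_suml dv_suml; apply: eq_bigr => i _.
by rewrite -scalemxAl dvZl endo_compE.
Qed.

Lemma smooth_jfield J W X :
  (forall x i j, smoothf (dom A x) (endo_comp A x (cx \o J) i j)) -> open W ->
  smoothv W X -> smoothv W (jfield J X).
Proof.
move=> sJ oW sX; apply/smooth_vfieldP => x j.
have oW' : open (dom A x `&` W) by exact: dom_openI.
have s : smoothf (dom A x `&` W) (fun y => \sum_i vd A X (coord A x i) y * endo_comp A x (cx \o J) i j y).
  apply: smooth_on_sum => // i; apply: smooth_onM => //.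
    by move/smooth_vfieldP: sX; apply.
  by apply: smooth_on_sub (sJ x i j) => y [].
apply: (smooth_on_ext oW' _ s) => y [dy _].
by rewrite [RHS]vdE (dv_endo (cx \o J)).
Qed.

Section LC.
Variables (g : M -> 'M[R]_m) (D : vfield -> vfield -> vfield).
Hypothesis hLC : is_levi_civita A g D.

Definition gform X Y : M -> C := fun y => form (cx (g y)) (X y) (Y y).

Lemma lc_torsion W X Y x : open W -> W x -> smoothv W X -> smoothv W Y ->
  D X Y x - D Y X x = brk A X Y x.
Proof.
move=> oW Wx sX sY; have [-> _] := hLC.2 W oW X Y Y sX sY sY x Wx.
by rewrite brkE.
Qed.

Lemma lc_metric W X Y Z x : open W -> W x -> smoothv W X -> smoothv W Y -> smoothv W Z ->
  vd A X (gform Y Z) x =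
  form (cx (g x)) (D X Y x) (Z x) + form (cx (g x)) (Y x) (D X Z x).
Proof.
move=> oW Wx sX sY sZ; have [_ <-] := hLC.2 W oW X Y Z sX sY sZ x Wx.
by rewrite vderE.
Qed.

Hypothesis g_sym : forall x, (g x)^T = g x.

Lemma formC x v w : form (cx (g x)) v w = form (cx (g x)) w v.
Proof. by rewrite -form_tr matrix.map_trmx g_sym. Qed.

(** Metric compatibility expands the three derivatives, vanishing torsion the three brackets. The
    formula determines [D] from the metric and the brackets alone; this makes the connection natural
    under isometries. *)
Lemma koszul W X Y Z x : open W -> W x -> smoothv W X -> smoothv W Y -> smoothv W Z ->
  2 * form (cx (g x)) (D X Y x) (Z x) =
  vd A X (gform Y Z) x + vd A Y (gform X Z) x - vd A Z (gform X Y) x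
  + form (cx (g x)) (brk A X Y x) (Z x) - form (cx (g x)) (brk A X Z x) (Y x)
  - form (cx (g x)) (brk A Y Z x) (X x).
Proof.
move=> oW Wx sX sY sZ.
rewrite !(lc_metric oW Wx) // -!(lc_torsion oW Wx) // !formBl.
rewrite (formC _ (Y x) (D X Z x)) (formC _ (X x) (D Y Z x)) (formC _ (X x) (D Z Y x)).
by move: (form _ _ _) (form _ _ _) (form _ _ _) (form _ _ _) (form _ _ _) (form _ _ _) => *; ring.
Qed.

(** Coordinate fields commute, so by vanishing torsion the derivatives of the frame along its [q]-th
    field are the rows of [covmx] of that field, whose trace is its divergence. Metric compatibility
    then gives the derivative of the Gram matrix. *)
Lemma lc_frame x q W : open W -> W x -> W `<=` dom A x ->
  dmx A (dco A x q x) (fun y => \matrix_(i, j) gform (dco A x i) (dco A x j) y) x =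
  covmx A D (dco A x q) x *m cx (g x) + cx (g x) *m (covmx A D (dco A x q) x)^T.
Proof.
move=> oW Wx sub; set K := covmx A D _ x.
have E i : D (dco A x q) (dco A x i) x = row i K.
  rewrite rowK; apply/eqP; rewrite -subr_eq0.
  by rewrite (lc_torsion oW Wx) ?brk_dco //; [exact: dom_self|exact: smooth_dco..].
apply/matrixP => i j; rewrite [LHS]mxE [RHS]mxE.
rewrite (@dv_ext _ _ _ _ W _ (gform (dco A x i) (dco A x j))) //; last first.
  by move=> y _; rewrite mxE.
rewrite -[LHS]/(vd A (dco A x q) _ x) (lc_metric oW Wx); try exact: smooth_dco.
rewrite !E !dcoord_center; congr (_ + _).
  by rewrite /form -row_mul trmx_delta -colE !mxE.
by rewrite /form -rowE [LHS]mxE [RHS]mxE; apply: eq_bigr => k _; rewrite !mxE.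
Qed.

End LC.

Section KahlerDivergence.
Variables (J omega : M -> 'M[R]_m) (D : vfield -> vfield -> vfield).
Hypothesis hLC : is_levi_civita A (metric J omega) D.
Hypothesis om_smooth : forall x i j, smoothf (dom A x) (form_comp A x (cx \o omega) i j).
Hypothesis J_smooth : forall x i j, smoothf (dom A x) (endo_comp A x (cx \o J) i j).
Hypothesis J2 : almost_complex J.
Hypothesis om_unit : forall x, omega x \in unitmx.

Lemma unitmx_cx n (B : 'M[R]_n) : (cx B \in unitmx) = (B \in unitmx).
Proof. exact: map_unitmx. Qed.

(* The term coming from [J] drops out because J^2 = -1 gives tr(J dJ) = 0. *)
Lemma divv_dco_symplectic x q :
  2 * divv A D (dco A x q) x = \tr (invmx (cx (omega x)) *m
    dmx A (dco A x q x) (fun y => \matrix_(i, j) form_comp A x (cx \o omega) i j y) x).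
Proof.
have oD := @dom_open _ _ _ A x; have dx := dom_self A x.
pose Om y := \matrix_(i, j) form_comp A x (cx \o omega) i j y : 'M[C]_m.
pose Jm y := \matrix_(i, j) endo_comp A x (cx \o J) i j y : 'M[C]_m.
have Omx : Om x = cx (omega x).
  by apply/matrixP => i j; rewrite mxE form_compE !dcoord_center form_delta.
have Jmx : Jm x = cx (J x).
  apply/matrixP => i j; rewrite mxE endo_compE dcoord_center dv_coord_center.
  by rewrite /= -rowE !mxE.
have sOm : smooth_mx A (dom A x) Om.
  move=> i j; apply: (smooth_on_ext oD _ (om_smooth x i j)) => y _; by rewrite mxE.
have sJm : smooth_mx A (dom A x) Jm.
  move=> i j; apply: (smooth_on_ext oD _ (J_smooth x i j)) => y _; by rewrite mxE.
have JJ y : dom A x y -> Jm y *m Jm y = - 1%:M.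
  move=> dy; apply/matrixP => i j; rewrite mxE.
  under eq_bigr do rewrite !mxE [X in X * _]endo_compE.
  rewrite -(dv_endo (cx \o J)) //= -mulmxA -map_mxM J2 map_mxN map_mx1 mulmxN mulmx1.
  by rewrite dvNl dv_dcoord_coord // !mxE.
have GE y : dom A x y ->
    \matrix_(i, j) gform (metric J omega) (dco A x i) (dco A x j) y = Om y *m (Jm y)^T.
  move=> dy; apply/matrixP => i j; rewrite !mxE /gform /metric map_mxM -matrix.map_trmx.
  rewrite /form -mulmxA -mulmxA -trmx_mul.
  rewrite [X in (_ *m (_ *m X^T))](vec_expand _ dy) linear_sum /= !mulmx_sumr summxE.
  apply: eq_bigr => k _.
  have -> : Om y i k = form (cx (omega y)) (dco A x i y) (dco A x k y).
    by rewrite mxE form_compE.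
  have -> : (Jm y)^T k j = dv A (dco A x j y *m cx (J y)) (coord A x k) y.
    by rewrite !mxE endo_compE.
  by rewrite [RHS]mulrC -formZr /form mulmxA.
have := lc_frame hLC q oD dx (fun y => id).
rewrite (dmx_ext _ _ oD dx GE) (dmxM _ oD dx sOm (smooth_mx_tr sJm)) dmx_tr.
have -> : cx (metric J omega x) = Om x *m (Jm x)^T.
  by rewrite Omx Jmx /metric map_mxM matrix.map_trmx.
have uO : Om x \in unitmx by rewrite Omx unitmx_cx.
have dJ : dmx A (dco A x q x) Jm x *m Jm x + Jm x *m dmx A (dco A x q x) Jm x = 0.
  by rewrite -(dmxM _ oD dx sJm sJm) (dmx_ext _ _ oD dx JJ) dmx_cst.
by move=> /(two_trace uO (JJ _ dx) dJ); rewrite Omx.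
Qed.

End KahlerDivergence.

(** In coordinates the connection enters only through the divergences of coordinate fields, and
    twice such a divergence is an expression in [omega] alone. *)
Lemma divv_symplectic (J1 J2 omega : M -> 'M[R]_m) D1 D2 W X x :
  is_levi_civita A (metric J1 omega) D1 -> is_levi_civita A (metric J2 omega) D2 ->
  (forall x i j, smoothf (dom A x) (form_comp A x (cx \o omega) i j)) ->
  (forall x i j, smoothf (dom A x) (endo_comp A x (cx \o J1) i j)) ->
  (forall x i j, smoothf (dom A x) (endo_comp A x (cx \o J2) i j)) ->
  almost_complex J1 -> almost_complex J2 -> (forall x, omega x \in unitmx) ->
  open W -> W x -> smoothv W X -> divv A D1 X x = divv A D2 X x.
Proof.
move=> h1 h2 so s1 s2 a1 a2 u oW Wx sX; have dx := dom_self A x.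
rewrite (divv_coord h1.1 oW Wx dx sX) (divv_coord h2.1 oW Wx dx sX).
apply: eq_bigr => q _; congr (_ + _ * _).
have n2 : (2 : C) != 0 by rewrite pnatr_eq0.
by apply: (mulfI n2); rewrite (divv_dco_symplectic h1) // (divv_dco_symplectic h2).
Qed.

End LeviCivita.

Lemma row_cancel2 (F : comPzRingType) n (a b c d : 'rV[F]_n) :
  a - (b + c) - (d - b) = a - c - d.
Proof. by apply/rowP => l; rewrite !mxE; ring. Qed.

Lemma row_cancel4 (F : comPzRingType) n (a b c d e g h : 'rV[F]_n) :
  (a + b + (c + d)) - (e + c + (b + g)) - (a - e + h) = d - g - h.
Proof. by apply/rowP => l; rewrite !mxE; ring. Qed.

(** * Curvature as a tensor *)

Section Curvature.
Variables (R : realType) (m : nat) (M : topologicalType) (A : atlas 'rV[R]_m M).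
Local Notation C := R[i].
Local Notation vfield := (M -> 'rV[C]_m).
Local Notation smoothv := (smooth_vfield A).
Local Notation smoothf := (smooth_on A).
Implicit Types (W : set M) (f : M -> C) (X Y Z : vfield) (x y : M) (v w : 'rV[C]_m).

(** Locality is a separate clause because fields are total functions that are only controlled on
    [W]: the expansion of a field in a frame holds on [W], not everywhere. *)
Definition tensorial W x (T : vfield -> 'rV[C]_m) :=
  [/\ forall X Y, smoothv W X -> (forall y, W y -> X y = Y y) -> T X = T Y,
      forall X Y, smoothv W X -> smoothv W Y -> T (fun y => X y + Y y) = T X + T Y &
      forall f X, smoothf W f -> smoothv W X -> T (fun y => f y *: X y) = f x *: T X].

Lemma tensorial_sum W x T (I : Type) (r : seq I) (f : I -> M -> C) (X : I -> vfield) :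
  open W -> tensorial W x T -> (forall i, smoothf W (f i)) -> (forall i, smoothv W (X i)) ->
  T (fun y => \sum_(i <- r) f i y *: X i y) = \sum_(i <- r) f i x *: T (X i).
Proof.
move=> oW [Te TD TZ] sf sX.
have sfX i : smoothv W (fun y => f i y *: X i y) by apply: smooth_vfieldZ.
have s0 := smooth_vfield0 A oW.
elim: r => [|i r IH].
  rewrite big_nil -[RHS](scale0r (T (fun=> 0))) -(TZ _ _ (smooth_on_cst A 0 oW) s0).
  apply: Te => [|y _]; first exact: (smooth_vfield_sum [::] oW sfX).
  by rewrite big_nil scaler0.
rewrite big_cons -IH -(TZ _ _ (sf i) (sX i)) -(TD _ _ (sfX i) (smooth_vfield_sum r oW sfX)).
apply: Te => [|y _]; first exact: (smooth_vfield_sum (i :: r) oW sfX).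
by rewrite big_cons.
Qed.

Lemma brk_ext W X X' Y Y' x : open W -> W x -> smoothv W X -> smoothv W Y ->
  (forall y, W y -> X y = X' y) -> (forall y, W y -> Y y = Y' y) ->
  brk A X Y x = brk A X' Y' x.
Proof.
move=> oW0 W0x sX0 sY0 EX EY; pose W1 := dom A x `&` W.
have oW : open W1 by exact: dom_openI.
have Wx : W1 x by split => //; exact: dom_self.
have sub : W1 `<=` W by move=> y [].
have sX := smooth_vfield_sub sub sX0; have sY := smooth_vfield_sub sub sY0.
have sX' := smooth_vfield_ext oW (fun y e => EX y (sub y e)) sX.
have sY' := smooth_vfield_ext oW (fun y e => EY y (sub y e)) sY.
apply: (vec_eq (dom_self A x)) => j.
have sc : smoothf W1 (coord A x j) by apply: smooth_on_sub (coord_smooth A x j) => z [].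
rewrite (dv_brk oW Wx sX sY sc) (dv_brk oW Wx sX' sY' sc) !vdE EX ?EY //.
by congr (_ - _); apply: (dv_ext _ _ oW Wx) => y /sub Wy; rewrite !vdE ?EX ?EY.
Qed.

Lemma brkC W X Y x : open W -> W x -> smoothv W X -> smoothv W Y ->
  brk A Y X x = - brk A X Y x.
Proof.
move=> oW0 W0x sX0 sY0; pose W1 := dom A x `&` W.
have oW : open W1 by exact: dom_openI.
have Wx : W1 x by split => //; exact: dom_self.
have sub : W1 `<=` W by move=> y [].
have sX := smooth_vfield_sub sub sX0; have sY := smooth_vfield_sub sub sY0.
apply: (vec_eq (dom_self A x)) => j.
have sc : smoothf W1 (coord A x j) by apply: smooth_on_sub (coord_smooth A x j) => z [].
by rewrite dvNl (dv_brk oW Wx sX sY sc) (dv_brk oW Wx sY sX sc) opprB.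
Qed.

Lemma brkDl W X X' Y x : open W -> W x -> smoothv W X -> smoothv W X' -> smoothv W Y ->
  brk A (fun y => X y + X' y) Y x = brk A X Y x + brk A X' Y x.
Proof.
move=> oW0 W0x sX0 sX0' sY0; pose W1 := dom A x `&` W.
have oW : open W1 by exact: dom_openI.
have Wx : W1 x by split => //; exact: dom_self.
have sub : W1 `<=` W by move=> y [].
have sX := smooth_vfield_sub sub sX0; have sY := smooth_vfield_sub sub sY0.
have sX' := smooth_vfield_sub sub sX0'.
apply: (vec_eq (dom_self A x)) => j.
have sc : smoothf W1 (coord A x j) by apply: smooth_on_sub (coord_smooth A x j) => z [].
rewrite dvDl !(dv_brk oW Wx _ _ sc) //; last exact: smooth_vfieldD.
rewrite [X in _ - X](_ : _ = vd A Y (vd A X (coord A x j)) x + vd A Y (vd A X' (coord A x j)) x).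
  by rewrite !vdE dvDl opprD addrACA.
rewrite !vdE -(dvD _ Wx (smooth_vd oW sX sc) (smooth_vd oW sX' sc)).
by apply: (dv_ext _ _ oW Wx) => y _; rewrite !vdE dvDl.
Qed.

Lemma brkZl W f X Y x : open W -> W x -> smoothf W f -> smoothv W X -> smoothv W Y ->
  brk A (fun y => f y *: X y) Y x = f x *: brk A X Y x - vd A Y f x *: X x.
Proof.
move=> oW0 W0x sf0 sX0 sY0; pose W1 := dom A x `&` W.
have oW : open W1 by exact: dom_openI.
have Wx : W1 x by split => //; exact: dom_self.
have sub : W1 `<=` W by move=> y [].
have sX := smooth_vfield_sub sub sX0; have sY := smooth_vfield_sub sub sY0.
have sf := smooth_on_sub sub sf0.
apply: (vec_eq (dom_self A x)) => j.
have sc : smoothf W1 (coord A x j) by apply: smooth_on_sub (coord_smooth A x j) => z [].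
rewrite dvBl !dvZl !(dv_brk oW Wx _ _ sc) //; last exact: smooth_vfieldZ.
rewrite [X in _ - X](_ : _ = vd A Y f x * vd A X (coord A x j) x + f x * vd A Y (vd A X (coord A x j)) x).
  by rewrite !vdE dvZl mulrBr opprD addrA addrAC.
rewrite !vdE -(dvM _ Wx sf (smooth_vd oW sX sc)).
by apply: (dv_ext _ _ oW Wx) => y _; rewrite !vdE dvZl.
Qed.

Section Curv.
Variables (D : vfield -> vfield -> vfield) (hD : is_connection A D).

Lemma curvatureC W X Y Z x : open W -> W x -> smoothv W X -> smoothv W Y -> smoothv W Z ->
  curvature A D Y X Z x = - curvature A D X Y Z x.
Proof.
move=> oW Wx sX sY sZ; rewrite /curvature -brkE.
have sB := smooth_brk oW sX sY.
have E y : W y -> (fun y => -1 *: brk A X Y y) y = brk A Y X y.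
  by move=> Wy; rewrite (brkC oW Wy sX sY) scaleN1r.
rewrite -(conn_extl hD oW Wx (smooth_vfieldZ oW (smooth_on_cst A (-1) oW) sB) sZ E).
rewrite (connZl hD oW Wx (smooth_on_cst A (-1) oW) sB sZ) scaleN1r opprK.
by rewrite !opprD !opprK [- _ + _]addrC.
Qed.

(** For [f *: X], the term Y[f] D_X Z arises from differentiating f D_X Z along [Y], and again from
    [f X, Y] = f [X, Y] - Y[f] X; the two cancel. *)
Lemma curvature_tensorial1 W Y Z x : open W -> W x -> smoothv W Y -> smoothv W Z ->
  tensorial W x (fun X => curvature A D X Y Z x).
Proof.
move=> oW Wx sY sZ; have sDYZ := conn_smooth hD oW sY sZ.
split=> [X X' sX E|X X' sX sX'|f X sf sX]; rewrite /curvature -brkE.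
- rewrite (conn_extl hD oW Wx sX sDYZ E).
  rewrite (conn_extr hD oW Wx sY (conn_smooth hD oW sX sZ)
     (fun y e => conn_extl hD oW e sX sZ E)).
  have EB y : W y -> brk A X Y y = brk A X' Y y.
    by move=> Wy; exact: (brk_ext oW Wy sX sY E).
  by rewrite (conn_extl hD oW Wx (smooth_brk oW sX sY) sZ EB).
- have sB := smooth_brk oW sX sY; have sB' := smooth_brk oW sX' sY.
  have sDX := conn_smooth hD oW sX sZ; have sDX' := conn_smooth hD oW sX' sZ.
  rewrite (connDl hD oW Wx sX sX' sDYZ).
  rewrite -(conn_extr hD oW Wx sY (smooth_vfieldD oW sDX sDX')
     (fun y e => esym (connDl hD oW e sX sX' sZ))).
  rewrite (connDr hD oW Wx sY sDX sDX').
  rewrite -(conn_extl hD oW Wx (smooth_vfieldD oW sB sB') sZ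
     (fun y e => esym (brkDl oW e sX sX' sY))) (connDl hD oW Wx sB sB' sZ).
  by apply/rowP => l; rewrite !mxE; ring.
- have sB := smooth_brk oW sX sY; have sDX := conn_smooth hD oW sX sZ.
  rewrite (connZl hD oW Wx sf sX sDYZ).
  rewrite -(conn_extr hD oW Wx sY (smooth_vfieldZ oW sf sDX)
     (fun y e => esym (connZl hD oW e sf sX sZ))).
  rewrite (connZr hD oW Wx sf sY sDX).
  have sfB := smooth_vfieldZ oW sf sB.
  have sYf := smooth_vd oW sY sf.
  have sYfX := smooth_vfieldN oW (smooth_vfieldZ oW sYf sX).
  rewrite -(conn_extl hD oW Wx (smooth_vfieldD oW sfB sYfX) sZ
     (fun y e => esym (brkZl oW e sf sX sY))) (connDl hD oW Wx sfB sYfX sZ).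
  rewrite (connZl hD oW Wx sf sB sZ).
  have EN y : W y -> (fun y => (- vd A Y f y) *: X y) y = - (vd A Y f y *: X y).
    by move=> _; rewrite scaleNr.
  rewrite -(conn_extl hD oW Wx (smooth_vfieldZ oW (smooth_onN oW sYf) sX) sZ EN).
  rewrite (connZl hD oW Wx (smooth_onN oW sYf) sX sZ) scaleNr !scalerBr.
  exact: row_cancel2.
Qed.

(** For [f *: Z], the mixed terms X[f] D_Y Z and Y[f] D_X Z occur in both second derivatives and
    cancel, and the coefficient of [Z] is X[Y[f]] - Y[X[f]] - [X, Y][f] = 0. *)
Lemma curvature_tensorial3 W X Y x : open W -> W x -> smoothv W X -> smoothv W Y ->
  tensorial W x (fun Z => curvature A D X Y Z x).
Proof.
move=> oW Wx sX sY; have sB := smooth_brk oW sX sY.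
split=> [Z Z' sZ E|Z Z' sZ sZ'|f Z sf sZ]; rewrite /curvature -brkE.
- rewrite (conn_extr hD oW Wx sX (conn_smooth hD oW sY sZ)
     (fun y e => conn_extr hD oW e sY sZ E)).
  rewrite (conn_extr hD oW Wx sY (conn_smooth hD oW sX sZ)
     (fun y e => conn_extr hD oW e sX sZ E)).
  by rewrite (conn_extr hD oW Wx sB sZ E).
- have sDX := conn_smooth hD oW sX sZ; have sDX' := conn_smooth hD oW sX sZ'.
  have sDY := conn_smooth hD oW sY sZ; have sDY' := conn_smooth hD oW sY sZ'.
  rewrite -(conn_extr hD oW Wx sX (smooth_vfieldD oW sDY sDY')
     (fun y e => esym (connDr hD oW e sY sZ sZ'))).
  rewrite (connDr hD oW Wx sX sDY sDY').
  rewrite -(conn_extr hD oW Wx sY (smooth_vfieldD oW sDX sDX')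
     (fun y e => esym (connDr hD oW e sX sZ sZ'))).
  rewrite (connDr hD oW Wx sY sDX sDX') (connDr hD oW Wx sB sZ sZ').
  by apply/rowP => l; rewrite !mxE; ring.
- have sDX := conn_smooth hD oW sX sZ; have sDY := conn_smooth hD oW sY sZ.
  have sXf := smooth_vd oW sX sf; have sYf := smooth_vd oW sY sf.
  rewrite -(conn_extr hD oW Wx sX
     (smooth_vfieldD oW (smooth_vfieldZ oW sYf sZ) (smooth_vfieldZ oW sf sDY))
     (fun y e => esym (connZr hD oW e sf sY sZ))).
  rewrite (connDr hD oW Wx sX (smooth_vfieldZ oW sYf sZ) (smooth_vfieldZ oW sf sDY)).
  rewrite (connZr hD oW Wx sYf sX sZ) (connZr hD oW Wx sf sX sDY).
  rewrite -(conn_extr hD oW Wx sY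
     (smooth_vfieldD oW (smooth_vfieldZ oW sXf sZ) (smooth_vfieldZ oW sf sDX))
     (fun y e => esym (connZr hD oW e sf sX sZ))).
  rewrite (connDr hD oW Wx sY (smooth_vfieldZ oW sXf sZ) (smooth_vfieldZ oW sf sDX)).
  rewrite (connZr hD oW Wx sXf sY sZ) (connZr hD oW Wx sf sY sDX).
  rewrite (connZr hD oW Wx sf sB sZ) [vd A (brk A X Y) f x](dv_brk oW Wx sX sY sf).
  by rewrite scalerBl !scalerBr; exact: row_cancel4.
Qed.

End Curv.
End Curvature.

Lemma unitmx_mul1 (F : fieldType) n (P Q : 'M[F]_n) : P *m Q = 1%:M -> P \in unitmx.
Proof. by case/mulmx1_unit. Qed.

Lemma row_unitmx_eq0 (F : fieldType) n (B : 'M[F]_n) (u : 'rV[F]_n) :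
  B \in unitmx -> u *m B = 0 -> u = 0.
Proof. by move=> uB E; rewrite -(mulmxK uB u) E mul0mx. Qed.

(** * Transport by diffeomorphisms and isometries *)

Section Diffeomorphisms.
Variables (R : realType) (m : nat) (M : topologicalType) (A : atlas 'rV[R]_m M).
Local Notation C := R[i].
Local Notation vfield := (M -> 'rV[C]_m).
Local Notation cx := (map_mx (real_complex R)).
Local Notation smoothv := (smooth_vfield A).
Local Notation smoothf := (smooth_on A).
Implicit Types (W : set M) (f h : M -> C) (X Y Z : vfield) (x y : M) (v w : 'rV[C]_m).

Definition jac (phi : M -> M) x : 'M[C]_m := cx (jacobian A phi x).

Section OneMap.
Variables (phi : M -> M) (hphi : smooth_map A A phi).

Lemma preimage_open W : open W -> open (phi @^-1` W).
Proof. by move=> oW; apply: open_comp => // x _; exact: hphi.1. Qed.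

Lemma smooth_comp W f : open W -> smoothf W f -> smoothf (phi @^-1` W) (f \o phi).
Proof.
move=> oW sf; apply: smooth_on_local => y Wy.
pose W' := dom A (phi y) `&` W.
have oW' : open W' by exact: dom_openI.
exists (phi @^-1` W'); first by split => //; exact: dom_self.
move=> x.
have o := chart_image_open (A := A) (x:=x) (preimage_open oW').
have H : csmooth (chart A x @` (dom A x `&` phi @^-1` W'))
    (fun z => (f \o param A (phi y)) ((chart A (phi y) \o phi \o param A x) z)).
  apply: (csmooth_comp (finite_dim_rV _ _) o (chart_image_open (x := phi y) oW) _ (sf (phi y))).
    by move=> z /chart_imageP[_ [d w] _]; exists (phi (param A x z)).
  move=> n; apply: Ck_sub (hphi.2 x (phi y) n) => _ [z [dz [d w]] <-].
  by exists z.
apply: csmooth_ext H => // z /chart_imageP[_ [d w] _] /=.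
by rewrite chartK.
Qed.

Lemma dv_comp W f x v : open W -> W (phi x) -> smoothf W f ->
  dv A v (f \o phi) x = dv A (v *m jac phi x) f (phi x).
Proof.
move=> oW Wx sf; set y := phi x.
have E i : cderive (f \o phi \o param A x) (chart A x x) (delta_mx 0 i) =
    \sum_j jac phi x i j * cderive (f \o param A y) (chart A y y) (delta_mx 0 j).
  have K : (chart A y \o phi \o param A x) (chart A x x) = chart A y y.
    by rewrite /= chartK //; exact: dom_self.
  have dd : differentiable (chart A y \o phi \o param A x) (chart A x x).
    apply: (hphi.2 x y 1%N).1; exists x => //; split; first exact: dom_self.
    exact: dom_self.
  have cd := cdifferentiable_chart sf Wx (dom_self A y).
  transitivity (cderive (fun z => (f \o param A y) ((chart A y \o phi \o param A x) z))
     (chart A x x) (delta_mx 0 i)).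
    apply: cderive_near.
    have oV := preimage_open (@dom_open _ _ _ A y).
    apply: filterS (near_chart oV (dom_self A y) (dom_self A x)) => z [_ d _] /=.
    by rewrite chartK.
  rewrite cderive_chain ?K // cderive_row //.
  by apply: eq_bigr => j _; rewrite !mxE.
rewrite !dvE; under eq_bigr do rewrite E big_distrr /=.
rewrite exchange_big; apply: eq_bigr => j _; rewrite !mxE big_distrl /=.
by apply: eq_bigr => i _; rewrite mulrA.
Qed.

End OneMap.

Section Diffeo.
Variables (phi psi : M -> M) (hphi : smooth_map A A phi) (hpsi : smooth_map A A psi).
Hypotheses (phiK : cancel phi psi) (psiK : cancel psi phi).

Lemma jacK x : jac phi x *m jac psi (phi x) = 1%:M.
Proof.
apply/row_matrixP => i; rewrite row1 rowE mulmxA.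
apply: (vec_eq (dom_self A x)) => j; have oD := @dom_open _ _ _ A x.
have Wx : dom A x (psi (phi x)) by rewrite phiK; exact: dom_self.
have sc := coord_smooth A x j.
have := dv_comp hpsi (delta_mx 0 i *m jac phi x) oD Wx sc; rewrite phiK => <-.
rewrite -(dv_comp hphi _ (preimage_open hpsi oD) Wx (smooth_comp hpsi oD sc)).
apply: (dv_ext _ _ oD (dom_self A x)) => y _ /=; by rewrite phiK.
Qed.

Lemma jac_unit x : jac phi x \in unitmx.
Proof. exact: (unitmx_mul1 (jacK x)). Qed.

Definition push X : vfield := fun y => X (psi y) *m jac phi (psi y).

Lemma vd_push W X h y : open W -> W y -> smoothf W h ->
  vd A (push X) h y = vd A X (h \o phi) (psi y).
Proof.
move=> oW Wy sh; have Wy' : W (phi (psi y)) by rewrite psiK.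
by rewrite !vdE (dv_comp hphi _ oW Wy' sh) psiK.
Qed.

Lemma smooth_push W X : open W -> smoothv W X -> smoothv (psi @^-1` W) (push X).
Proof.
move=> oW sX; apply/smooth_vfieldP => y i.
have oD := @dom_open _ _ _ A y; have sc := coord_smooth A y i.
pose W' := W `&` phi @^-1` dom A y.
have oW' : open W' by apply: openI => //; exact: preimage_open.
have s : smoothf W' (vd A X (coord A y i \o phi)).
  apply: smooth_vd => //; first by apply: smooth_vfield_sub sX => z [].
  by apply: smooth_on_sub (smooth_comp hphi oD sc) => z [].
have o : open (dom A y `&` psi @^-1` W) by apply: openI => //; exact: preimage_open.
have s' : smoothf (dom A y `&` psi @^-1` W) (vd A X (coord A y i \o phi) \o psi).
  apply: smooth_on_sub (smooth_comp hpsi oW' s) => z [dz wz]; split => //=.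
  by rewrite /preimage /= psiK.
by apply: (smooth_on_ext o _ s') => z [dz _]; rewrite (vd_push _ oD dz sc).
Qed.

Lemma vd_push_comp W X Y h x : open W -> W x -> smoothv W Y -> smoothf (psi @^-1` W) h ->
  vd A (push X) (vd A (push Y) h) (phi x) = vd A X (vd A Y (h \o phi)) x.
Proof.
move=> oW Wx sY sh; have o := preimage_open hpsi oW.
have W'x : (psi @^-1` W) (phi x) by rewrite /preimage /= phiK.
rewrite (vd_push _ o W'x (smooth_vd o (smooth_push oW sY) sh)) phiK !vdE.
apply: (dv_ext _ _ oW Wx) => y Wy /=.
by rewrite (vd_push _ o _ sh) ?phiK // /preimage /= phiK.
Qed.

(** A bracket is determined by its second-order action on functions, and composition with [phi]
    carries this action over. *)
Lemma brk_push W X Y x : open W -> W x -> smoothv W X -> smoothv W Y ->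
  brk A (push X) (push Y) (phi x) = brk A X Y x *m jac phi x.
Proof.
move=> oW0 W0x sX0 sY0; pose W1 := W `&` phi @^-1` dom A (phi x).
have oD := @dom_open _ _ _ A (phi x).
have oW : open W1 by apply: openI => //; exact: preimage_open.
have Wx : W1 x by split => //; exact: dom_self.
have sub : W1 `<=` W by move=> y [].
have sX := smooth_vfield_sub sub sX0; have sY := smooth_vfield_sub sub sY0.
have o := preimage_open hpsi oW.
have W'x : (psi @^-1` W1) (phi x) by rewrite /preimage /= phiK.
apply: (vec_eq (dom_self A (phi x))) => j.
have sc' : smoothf (psi @^-1` W1) (coord A (phi x) j).
  apply: smooth_on_sub (coord_smooth A (phi x) j) => z [_].
  by rewrite /preimage /= psiK.
have sc : smoothf W1 (coord A (phi x) j \o phi).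
  by apply: smooth_on_sub (smooth_comp hphi oD (coord_smooth A (phi x) j)) => z [].
rewrite (dv_brk o W'x (smooth_push oW sX) (smooth_push oW sY) sc').
rewrite -(dv_comp hphi _ o W'x sc') (dv_brk oW Wx sX sY sc).
by rewrite (vd_push_comp _ oW Wx sY sc') (vd_push_comp _ oW Wx sX sc').
Qed.

Section Isometry.
Variables (g1 g2 : M -> 'M[R]_m) (D1 D2 : vfield -> vfield -> vfield).
Hypotheses (h1 : is_levi_civita A g1 D1) (h2 : is_levi_civita A g2 D2).
Hypotheses (g1_sym : forall x, (g1 x)^T = g1 x) (g2_sym : forall x, (g2 x)^T = g2 x).
Hypothesis g2_unit : forall x, g2 x \in unitmx.
Hypothesis isom : forall x,
  jacobian A phi x *m g2 (phi x) *m (jacobian A phi x)^T = g1 x.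

Lemma form_isom x v w :
  form (cx (g2 (phi x))) (v *m jac phi x) (w *m jac phi x) = form (cx (g1 x)) v w.
Proof.
by rewrite -isom !map_mxM -matrix.map_trmx /form trmx_mul !mulmxA.
Qed.

Lemma gform_push X Y x : gform g2 (push X) (push Y) (phi x) = gform g1 X Y x.
Proof. by rewrite /gform /push phiK form_isom. Qed.

Hypothesis g1_smooth : forall W Y Z, open W -> smoothv W Y -> smoothv W Z ->
  smoothf W (gform g1 Y Z).

Lemma vd_gform_push W X Y Z x : open W -> W x -> smoothv W Y -> smoothv W Z ->
  vd A (push X) (gform g2 (push Y) (push Z)) (phi x) = vd A X (gform g1 Y Z) x.
Proof.
move=> oW Wx sY sZ; have sg := g1_smooth oW sY sZ; have o := preimage_open hpsi oW.
have W'x : (psi @^-1` W) (phi x) by rewrite /preimage /= phiK.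
rewrite vdE (@dv_ext _ _ _ _ (psi @^-1` W) _ (gform g1 Y Z \o psi)) //.
  rewrite -vdE (vd_push _ o W'x (smooth_comp hpsi oW sg)) phiK.
  by apply: (dv_ext _ _ oW Wx) => y _ /=; rewrite phiK.
by move=> y _ /=; rewrite -gform_push psiK.
Qed.

(** Koszul's formula writes the inner products of both sides with the images of the basis vectors by
    means of the metric and brackets, which are natural. As [g2] is nondegenerate and the Jacobian
    invertible, these inner products determine the vector. *)
Lemma lc_push W X Y x : open W -> W x -> smoothv W X -> smoothv W Y ->
  D2 (push X) (push Y) (phi x) = D1 X Y x *m jac phi x.
Proof.
move=> oW0 W0x sX0 sY0; pose W1 := dom A x `&` W.
have oW : open W1 by exact: dom_openI.
have Wx : W1 x by split => //; exact: dom_self.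
have sub : W1 `<=` W by move=> z [].
have sX := smooth_vfield_sub sub sX0; have sY := smooth_vfield_sub sub sY0.
have o := preimage_open hpsi oW.
have W'x : (psi @^-1` W1) (phi x) by rewrite /preimage /= phiK.
set u := D2 _ _ _; set u' := _ *m _.
have E i : form (cx (g2 (phi x))) u (delta_mx 0 i *m jac phi x) =
    form (cx (g2 (phi x))) u' (delta_mx 0 i *m jac phi x).
  have sZ : smoothv W1 (dco A x i) by apply: smooth_dco => z [].
  have n2 : (2 : C) != 0 by rewrite pnatr_eq0.
  have pE X' : push X' (phi x) = X' x *m jac phi x by rewrite /push phiK.
  apply: (mulfI n2); rewrite form_isom.
  have K1 := koszul h1 g1_sym oW Wx sX sY sZ.
  have K2 := koszul h2 g2_sym o W'x (smooth_push oW sX) (smooth_push oW sY) (smooth_push oW sZ).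
  rewrite dcoord_center in K1; rewrite {}K1.
  rewrite !(vd_gform_push _ oW Wx) // in K2.
  rewrite (brk_push oW Wx sX sY) (brk_push oW Wx sX sZ) (brk_push oW Wx sY sZ) in K2.
  by rewrite !pE !form_isom dcoord_center in K2.
have : (u - u') *m (cx (g2 (phi x)) *m (jac phi x)^T) = 0.
  apply/rowP => i; rewrite mulmxA [RHS]mxE.
  have : form (cx (g2 (phi x))) (u - u') (delta_mx 0 i *m jac phi x) = 0.
    by rewrite formBl E subrr.
  by move=> <-; rewrite /form -rowE tr_row [LHS]mxE [RHS]mxE; apply: eq_bigr => k _; rewrite !mxE.
have uG : cx (g2 (phi x)) *m (jac phi x)^T \in unitmx.
  by rewrite unitmx_mul unitmx_cx g2_unit unitmx_tr jac_unit.
by move=> /(row_unitmx_eq0 uG) /eqP; rewrite subr_eq0 => /eqP.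
Qed.

(** The Jacobian conjugates the endomorphism v |-> D1_v X into the one of the transported field, and
    traces are invariant under conjugation. *)
Lemma divv_push W X x : open W -> W x -> smoothv W X ->
  divv A D2 (push X) (phi x) = divv A D1 X x.
Proof.
move=> oW0 W0x sX0; pose W1 := dom A x `&` W.
have oW : open W1 by exact: dom_openI.
have Wx : W1 x by split => //; exact: dom_self.
have sX : smoothv W1 X by apply: smooth_vfield_sub sX0 => z [].
have o := preimage_open hpsi oW.
have W'x : (psi @^-1` W1) (phi x) by rewrite /preimage /= phiK.
have E : covmx A D1 X x *m jac phi x = jac phi x *m covmx A D2 (push X) (phi x).
  apply/row_matrixP => i; rewrite !row_mul rowK.
  have sd : smoothv W1 (dco A x i) by apply: smooth_dco => z [].
  rewrite -(lc_push oW Wx sd sX) (conn_covmx h2.1 o W'x (smooth_push oW sd) (smooth_push oW sX)).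
  by rewrite {1}/push phiK dcoord_center -rowE.
have := congr1 (fun B => \tr (B *m jac psi (phi x))) E.
by rewrite -mulmxA jacK mulmx1 mxtrace_mulC mulmxA (mulmx1C (jacK x)) mul1mx.
Qed.

Lemma curvature_push W X Y Z x : open W -> W x -> smoothv W X -> smoothv W Y -> smoothv W Z ->
  curvature A D2 (push X) (push Y) (push Z) (phi x) = curvature A D1 X Y Z x *m jac phi x.
Proof.
move=> oW Wx sX sY sZ; have o := preimage_open hpsi oW.
have W'x : (psi @^-1` W) (phi x) by rewrite /preimage /= phiK.
have E X' Y' z : smoothv W X' -> smoothv W Y' -> (psi @^-1` W) z ->
    push (D1 X' Y') z = D2 (push X') (push Y') z.
  by move=> sX' sY' Wz; rewrite {1}/push -(lc_push oW Wz sX' sY') psiK.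
have EB z : (psi @^-1` W) z -> push (brk A X Y) z = brk A (push X) (push Y) z.
  by move=> Wz; rewrite {1}/push -(brk_push oW Wz sX sY) psiK.
have sDYZ := conn_smooth h1.1 oW sY sZ; have sDXZ := conn_smooth h1.1 oW sX sZ.
have sB := smooth_brk oW sX sY.
rewrite /curvature -!brkE.
rewrite -(conn_extr h2.1 o W'x (smooth_push oW sX) (smooth_push oW sDYZ) (fun z => E Y Z z sY sZ)).
rewrite -(conn_extr h2.1 o W'x (smooth_push oW sY) (smooth_push oW sDXZ) (fun z => E X Z z sX sZ)).
rewrite -(conn_extl h2.1 o W'x (smooth_push oW sB) (smooth_push oW sZ) EB).
by rewrite !(lc_push oW Wx) // !mulmxBl.
Qed.

(** [ricci] is a trace over the coordinate frame at [x], but the push-forward of this frame is not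
    the coordinate frame at [phi x]. Tensoriality of the curvature in each argument re-expands it
    there, with the entries of the Jacobian as coefficients. *)
Lemma ricci_push x : ricci A D1 x = jac phi x *m ricci A D2 (phi x) *m (jac phi x)^T.
Proof.
set y := phi x; set P := jac phi x.
pose e := dco A x; pose e' := dco A y.
have oW := @dom_open _ _ _ A x; have dx := dom_self A x; have dy := dom_self A y.
pose V := dom A y `&` psi @^-1` dom A x.
have oV : open V by apply: dom_openI; exact: preimage_open.
have Vy : V y by split => //; rewrite /preimage /= /y phiK.
have se i : smoothv (dom A x) (e i) by exact: smooth_dcoord.
have sE i : smoothv V (push (e i)).
  by apply: smooth_vfield_sub (smooth_push oW (se i)) => z [].
have se' a : smoothv V (e' a) by apply: smooth_dco => z [].
have sM i a : smoothf V (vd A (push (e i)) (coord A y a)).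
  by apply: smooth_vd => //; apply: smooth_on_sub (coord_smooth A y a) => z [].
have My i a : vd A (push (e i)) (coord A y a) y = P i a.
  by rewrite vdE dv_coord_center /push /y phiK /e dcoord_center -rowE mxE.
have EE i z : V z -> push (e i) z = \sum_a vd A (push (e i)) (coord A y a) z *: e' a z.
  by move=> [dz _]; exact: vec_expand.
have sS i : smoothv V (fun z => \sum_a vd A (push (e i)) (coord A y a) z *: e' a z).
  by apply: smooth_vfield_sum => // a; apply: smooth_vfieldZ.
have T1 i Y Z : smoothv V Y -> smoothv V Z ->
    curvature A D2 (push (e i)) Y Z y = \sum_a P i a *: curvature A D2 (e' a) Y Z y.
  move=> sY sZ; have T := curvature_tensorial1 h2.1 oV Vy sY sZ.
  have [Te _ _] := T; rewrite (Te _ _ (sE i) (EE i)).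
  rewrite (tensorial_sum _ oV T (sM i) se'); apply: eq_bigr => a _; by rewrite My.
have T2 i X Z : smoothv V X -> smoothv V Z ->
    curvature A D2 X (push (e i)) Z y = \sum_a P i a *: curvature A D2 X (e' a) Z y.
  move=> sX sZ; rewrite (curvatureC h2.1 oV Vy (sE i) sX sZ) T1 // -sumrN.
  by apply: eq_bigr => a _; rewrite (curvatureC h2.1 oV Vy sX (se' a) sZ) scalerN opprK.
have T3 i X Y : smoothv V X -> smoothv V Y ->
    curvature A D2 X Y (push (e i)) y = \sum_a P i a *: curvature A D2 X Y (e' a) y.
  move=> sX sY; have T := curvature_tensorial3 h2.1 oV Vy sX sY.
  have [Te _ _] := T; rewrite (Te _ _ (sE i) (EE i)).
  rewrite (tensorial_sum _ oV T (sM i) se'); apply: eq_bigr => a _; by rewrite My.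
pose K1 i j := \matrix_l curvature A D1 (e l) (e i) (e j) x.
pose K2 i j := \matrix_l curvature A D2 (e' l) (e' i) (e' j) y.
(* [K1 i j] and [K2 i j] are the endomorphisms X |-> R(X, e_i) e_j at [x] and at [y]. [P]
   intertwines them in the first argument and acts linearly on each of the other two. *)
have H i j : K1 i j *m P = \sum_b \sum_c (P i b * P j c) *: (P *m K2 b c).
  apply/row_matrixP => l; rewrite row_mul rowK /P -(curvature_push oW dx (se l) (se i) (se j)) -/y.
  rewrite T2 //; rewrite !linear_sum; apply: eq_bigr => b _.
  rewrite T3 //; rewrite scaler_sumr !linear_sum; apply: eq_bigr => c _.
  rewrite T1 // scalerA linearZ /= row_mul mulmx_sum_row; congr (_ *: _).
  apply: eq_bigr => a _; rewrite rowK.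
  by rewrite !mxE.
apply/matrixP => i j; rewrite mxE.
have -> : \sum_l curvature A D1 (dcoord A x l) (dcoord A x i) (dcoord A x j) x 0 l = \tr (K1 i j).
  by rewrite -(dcoE A); apply: eq_bigr => l _; rewrite [RHS]mxE.
have -> : \tr (K1 i j) = \tr (K1 i j *m P *m jac psi y) by rewrite -mulmxA jacK mulmx1.
rewrite H mulmx_suml linear_sum /= mxE; under [RHS]eq_bigr do rewrite !mxE big_distrl /=.
rewrite [RHS]exchange_big; apply: eq_bigr => b _.
rewrite mulmx_suml linear_sum /=; apply: eq_bigr => c _.
rewrite -scalemxAl linearZ /= mxtrace_mulC mulmxA (mulmx1C (jacK x)) mul1mx.
rewrite mulrAC; congr (_ * _ * _).
  by rewrite [RHS]mxE -(dcoE A); apply: eq_bigr => l _; rewrite [LHS]mxE.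
by rewrite !mxE.
Qed.

End Isometry.
End Diffeo.
End Diffeomorphisms.

(** Used with [U] the identity and [V = i *: J], for which [U - V] and [U + V] are twice the
    projections on the types (1,0) and (0,1). *)
Lemma polarization (F : comNzRingType) n (U V N : 'M[F]_n) :
  (U - V) *m N *m (U + V)^T + (U + V) *m N *m (U - V)^T =
  2 *: (U *m N *m U^T - V *m N *m V^T).
Proof.
rewrite [(U + V)^T]linearD [(U - V)^T]linearB /= !mulmxBl !mulmxDl !mulmxBr !mulmxDr.
move: (U *m N *m U^T) (V *m N *m U^T) (U *m N *m V^T) (V *m N *m V^T) => a b c d.
by apply/matrixP => k l; rewrite !mxE; ring.
Qed.

Lemma type_projections (F : comNzRingType) n (i : F) (J N : 'M[F]_n) : i * i = -1 ->
  (1%:M - i *: J) *m N *m (1%:M + i *: J)^T + (1%:M + i *: J) *m N *m (1%:M - i *: J)^T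
  = 2 *: (N + J *m N *m J^T).
Proof.
move=> ii; rewrite polarization trmx1 mul1mx mulmx1 linearZ /=.
by rewrite -!scalemxAl -scalemxAr scalerA ii scaleN1r opprK.
Qed.

Lemma mulrBmul (F : comPzRingType) (a b p q : F) : a * (p - q) * b = a * b * p - b * a * q.
Proof. by ring. Qed.

Lemma antisym_comb (F : comPzRingType) (h e a b c d : F) : c = d ->
  h * e * (a - b) = h * (c + e * a) - h * (d + e * b).
Proof. by move=> ->; ring. Qed.

(** For [U] and [V] the two type projections this is the (1,1) part of the bilinear form [N];
    [ddbar] has this shape. *)
Definition mixed_part (F : comNzRingType) n (U V N : 'M[F]_n) : 'M[F]_n :=
  U *m N *m V^T + V *m N *m U^T.

Lemma mixed_part_conj (F : comNzRingType) n (U V U' V' N P : 'M[F]_n) :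
  U *m P = P *m U' -> V *m P = P *m V' ->
  mixed_part U V (P *m N *m P^T) = P *m mixed_part U' V' N *m P^T.
Proof.
move=> EU EV.
have E (S T S' T' : 'M[F]_n) : S *m P = P *m S' -> T *m P = P *m T' ->
    S *m (P *m N *m P^T) *m T^T = P *m (S' *m N *m T'^T) *m P^T.
  by move=> ES ET; rewrite !mulmxA ES -!mulmxA -trmx_mul ET trmx_mul.
by rewrite /mixed_part mulmxDr mulmxDl (E U V U' V') // (E V U V' U').
Qed.

(** By [type_projections] the (1,1) part is (N + J N J^T) / 2. *)
Lemma mixed_part_type (F : numFieldType) n (i : F) (J N : 'M[F]_n) :
  i * i = -1 -> J *m N *m J^T = N ->
  mixed_part (2^-1 *: (1%:M - i *: J)) (2^-1 *: (1%:M + i *: J)) N = N.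
Proof.
move=> ii JN; have := type_projections J N ii; rewrite JN => E.
rewrite /mixed_part ![(_ *: _)^T]linearZ /= -!scalemxAl -!scalemxAr -!scalerDr E.
by apply/matrixP => k l; rewrite !mxE; field.
Qed.

Lemma antisym_cancel (F : comPzRingType) (p q r s : F) :
  r - s = p + r - (q + s) - (p - q).
Proof. by ring. Qed.

(** * Exterior derivatives, the operator dbar and pluriharmonic functions *)

Section Forms.
Variables (R : realType) (m : nat) (M : topologicalType) (A : atlas 'rV[R]_m M).
Local Notation C := R[i].
Local Notation vfield := (M -> 'rV[C]_m).
Local Notation cx := (map_mx (real_complex R)).
Local Notation smoothv := (smooth_vfield A).
Local Notation smoothf := (smooth_on A).
Implicit Types (W : set M) (f h : M -> C) (X Y Z a : vfield) (x y : M) (v w : 'rV[C]_m).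

Lemma imag_sqr : ('i%C : C) * 'i%C = -1.
Proof. by apply: complexE; rewrite ?ReM ?ImM /=; ring. Qed.

Definition pr X a : M -> C := fun y => pairing (X y) (a y).
Definition smooth_cov W a := forall x i, smoothf (dom A x `&` W) (cov_comp A x a i).

Lemma cov_compE x a i : cov_comp A x a i = pr (dco A x i) a.
Proof. by rewrite dcoE. Qed.

Lemma pairingDl v w (b : 'rV[C]_m) : pairing (v + w) b = pairing v b + pairing w b.
Proof. by rewrite /pairing mulmxDl mxE. Qed.
Lemma pairingZl k v (b : 'rV[C]_m) : pairing (k *: v) b = k * pairing v b.
Proof. by rewrite /pairing -scalemxAl mxE. Qed.
Lemma pairing_suml (I : Type) (r : seq I) (F : I -> 'rV[C]_m) (b : 'rV[C]_m) :
  pairing (\sum_(i <- r) F i) b = \sum_(i <- r) pairing (F i) b.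
Proof. by rewrite /pairing mulmx_suml summxE. Qed.
Lemma pairing_mulr v (b : 'rV[C]_m) (B : 'M[C]_m) : pairing v (b *m B^T) = pairing (v *m B) b.
Proof. by rewrite /pairing trmx_mul trmxK mulmxA. Qed.

Lemma pairing_expand x v (b : 'rV[C]_m) y : dom A x y ->
  pairing v b = \sum_i dv A v (coord A x i) y * pairing (dco A x i y) b.
Proof.
move=> dx; rewrite [in LHS](vec_expand v dx) pairing_suml.
by apply: eq_bigr => i _; rewrite pairingZl.
Qed.

Lemma smooth_pr W X a : open W -> smoothv W X -> smooth_cov W a -> smoothf W (pr X a).
Proof.
move=> oW sX sa; apply: smooth_on_local => x Wx; exists (dom A x `&` W).
  by split => //; exact: dom_self.
have o := dom_openI A x oW.
have s : smoothf (dom A x `&` W) (fun y => \sum_i vd A X (coord A x i) y * cov_comp A x a i y).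
  apply: smooth_on_sum => // i; apply: smooth_onM => //.
  by move/smooth_vfieldP: sX; apply.
apply: (smooth_on_ext o _ s) => y [dy _]; rewrite /pr (pairing_expand _ _ dy).
by apply: eq_bigr => i _; rewrite cov_compE.
Qed.

Lemma ext_d_coord a x i j : ext_d A a x i j =
  dv A (dco A x i x) (cov_comp A x a j) x - dv A (dco A x j x) (cov_comp A x a i) x.
Proof. by rewrite -(diff_center A x (cov_comp A x a j)) -(diff_center A x (cov_comp A x a i)) mxE. Qed.

Lemma ext_dE W X Y a x : open W -> W x -> smoothv W X -> smoothv W Y -> smooth_cov W a ->
  form (ext_d A a x) (X x) (Y x) =
  vd A X (pr Y a) x - vd A Y (pr X a) x - pairing (brk A X Y x) (a x).
Proof.
move=> oW0 W0x sX0 sY0 sa0; pose W1 := dom A x `&` W.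
have oW : open W1 by exact: dom_openI.
have Wx : W1 x by split => //; exact: dom_self.
have sub : W1 `<=` W by move=> y [].
have sX := smooth_vfield_sub sub sX0; have sY := smooth_vfield_sub sub sY0.
have sa i : smoothf W1 (cov_comp A x a i) by exact: sa0.
have sc i : smoothf W1 (coord A x i) by apply: smooth_on_sub (coord_smooth A x i) => z [].
pose E Z Z' i j := Z x 0 i * Z' x 0 j * vd A (dco A x i) (cov_comp A x a j) x.
have H Z Z' : smoothv W1 Z -> smoothv W1 Z' -> vd A Z (pr Z' a) x =
    \sum_j vd A Z (vd A Z' (coord A x j)) x * cov_comp A x a j x + \sum_i \sum_j E Z Z' i j.
  move=> sZ sZ'.
  have s j := smooth_vd oW sZ' (sc j).
  rewrite vdE (@dv_ext _ _ _ _ W1 _ (fun y => \sum_j vd A Z' (coord A x j) y * cov_comp A x a j y)) //.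
    rewrite (dv_sum _ _ oW Wx); last by move=> j; apply: smooth_onM.
    rewrite exchange_big -big_split; apply: eq_bigr => j _ /=.
    rewrite (dvM _ Wx (s j) (sa j)) vdE; congr (_ + _).
    rewrite (dv_expand _ oW (sa j) Wx (dom_self A x)) big_distrr; apply: eq_bigr => i _ /=.
    by rewrite /E !vdE !dv_coord_center; ring.
  move=> y [dy _]; rewrite /pr (pairing_expand _ _ dy).
  by apply: eq_bigr => i _; rewrite cov_compE.
rewrite !H // (pairing_expand _ _ (dom_self A x)) form_sum.
have -> : \sum_i dv A (brk A X Y x) (coord A x i) x * pairing (dco A x i x) (a x) =
  \sum_j vd A X (vd A Y (coord A x j)) x * cov_comp A x a j x -
  \sum_j vd A Y (vd A X (coord A x j)) x * cov_comp A x a j x.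
  rewrite -sumrB; apply: eq_bigr => j _.
  by rewrite (dv_brk oW Wx sX sY (sc j)) mulrBl cov_compE.
have -> : \sum_i \sum_j X x 0 i * ext_d A a x i j * Y x 0 j =
   \sum_i \sum_j E X Y i j - \sum_i \sum_j E Y X i j.
  rewrite [X in _ - X]exchange_big -sumrB; apply: eq_bigr => i _.
  rewrite -sumrB; apply: eq_bigr => j _.
  by rewrite ext_d_coord; exact: mulrBmul.
exact: antisym_cancel.
Qed.

Lemma dbarE (J : M -> 'M[R]_m) f v x : pairing v (dbar A J f x) = dv A (v *m P01 J x) f x.
Proof. by rewrite /dbar pairing_mulr dv_pairing. Qed.

Lemma mul_P01 (J : M -> 'M[R]_m) v x :
  v *m P01 J x = 2^-1 *: (v + 'i%C *: (v *m cx (J x))).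
Proof. by rewrite /P01 -scalemxAr mulmxDr mulmx1 -scalemxAr. Qed.

Section Dbar.
Variables (J : M -> 'M[R]_m).
Hypothesis J_smooth : forall x i j, smoothf (dom A x) (endo_comp A x (cx \o J) i j).

Lemma smooth_P01field W X : open W -> smoothv W X -> smoothv W (fun y => X y *m P01 J y).
Proof.
move=> oW sX; have sJX := smooth_jfield J_smooth oW sX.
have s := smooth_vfieldZ oW (smooth_on_cst A (2^-1) oW)
  (smooth_vfieldD oW sX (smooth_vfieldZ oW (smooth_on_cst A 'i%C oW) sJX)).
by apply: (smooth_vfield_ext oW _ s) => y _; rewrite mul_P01.
Qed.

Lemma smooth_dbar W f : open W -> smoothf W f -> smooth_cov W (dbar A J f).
Proof.
move=> oW sf x i; have o := dom_openI A x oW.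
have sd : smoothv (dom A x `&` W) (dco A x i) by apply: smooth_dco => z [].
have s := smooth_vd o (smooth_P01field o sd) (smooth_on_sub (fun z => @proj2 _ _) sf).
by apply: (smooth_on_ext o _ s) => y _; rewrite cov_compE /pr dbarE.
Qed.

Lemma pr_dbar X f y : pr X (dbar A J f) y = vd A (fun z => X z *m P01 J z) f y.
Proof. by rewrite /pr dbarE. Qed.

End Dbar.

Section DdbarPush.
Variables (phi psi : M -> M) (hphi : smooth_map A A phi) (hpsi : smooth_map A A psi).
Hypotheses (phiK : cancel phi psi) (psiK : cancel psi phi).
Variables (J1 J2 : M -> 'M[R]_m).
Hypothesis J1_smooth : forall x i j, smoothf (dom A x) (endo_comp A x (cx \o J1) i j).
Hypothesis J2_smooth : forall x i j, smoothf (dom A x) (endo_comp A x (cx \o J2) i j).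
Hypothesis J_equiv : forall x,
  J1 x *m jacobian A phi x = jacobian A phi x *m J2 (phi x).

Lemma Jc_equiv x : cx (J1 x) *m jac A phi x = jac A phi x *m cx (J2 (phi x)).
Proof. by rewrite /jac -!map_mxM J_equiv. Qed.

Lemma P01_equiv x : P01 J1 x *m jac A phi x = jac A phi x *m P01 J2 (phi x).
Proof.
have E := Jc_equiv x; rewrite /P01 -scalemxAl -scalemxAr mulmxDl mulmxDr mul1mx mulmx1.
by rewrite -scalemxAl -scalemxAr /= E.
Qed.

Lemma P10_equiv x : P10 J1 x *m jac A phi x = jac A phi x *m P10 J2 (phi x).
Proof.
have E := Jc_equiv x; rewrite /P10 -scalemxAl -scalemxAr mulmxBl mulmxBr mul1mx mulmx1.
by rewrite -scalemxAl -scalemxAr /= E.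
Qed.

Lemma pr_dbar_push f X z : smoothf setT f ->
  pr X (dbar A J1 (f \o phi)) z = pr (push A phi psi X) (dbar A J2 f) (phi z).
Proof.
move=> sf; apply: etrans (dbarE _ _ _ _) _; apply: etrans (esym (dbarE _ _ _ _)).
have E : push A phi psi X (phi z) *m P01 J2 (phi z) = X z *m P01 J1 z *m jac A phi z.
  by rewrite /push phiK -mulmxA -P01_equiv mulmxA.
rewrite E; exact: (dv_comp hphi _ openT I sf).
Qed.

(** Cartan's formula for the coordinate fields at [x] and for their push-forwards: the brackets
    vanish on both sides, and the remaining derivatives correspond under [phi]. *)
Lemma ext_d_dbar_push f x : smoothf setT f ->
  ext_d A (dbar A J1 (f \o phi)) x =
  jac A phi x *m ext_d A (dbar A J2 f) (phi x) *m (jac A phi x)^T.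
Proof.
move=> sf; apply/matrixP => i j; rewrite -!form_delta.
have oD := @dom_open _ _ _ A x; have dx := dom_self A x.
have sd l := smooth_dcoord A x l.
have o := preimage_open hpsi oD.
have W'x : (psi @^-1` dom A x) (phi x) by rewrite /preimage /= phiK.
have sp l := smooth_push hphi hpsi psiK oD (sd l).
have sf1 : smoothf (dom A x) (f \o phi).
  by apply: smooth_on_sub (smooth_comp hphi openT sf).
have sf2 : smoothf (psi @^-1` dom A x) f by apply: smooth_on_sub sf.
have sb := smooth_dbar J2_smooth o sf2.
rewrite -{1}(dcoord_center A x i) -{1}(dcoord_center A x j).
rewrite (ext_dE oD dx (sd i) (sd j) (smooth_dbar J1_smooth oD sf1)).
have Hd k l : vd A (dco A x k) (pr (dco A x l) (dbar A J1 (f \o phi))) x =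
   vd A (push A phi psi (dco A x k)) (pr (push A phi psi (dco A x l)) (dbar A J2 f)) (phi x).
  rewrite (vd_push hphi psiK _ o W'x (smooth_pr o (sp l) sb)) phiK.
  by apply: (dv_ext _ _ oD dx) => z _; exact: pr_dbar_push.
rewrite !Hd brk_dco // /pairing mul0mx mxE subr0.
have := ext_dE o W'x (sp i) (sp j) sb.
rewrite (brk_push hphi hpsi phiK psiK oD dx (sd i) (sd j)) brk_dco // mul0mx.
rewrite /pairing mul0mx mxE subr0 => <-.
by rewrite /push phiK !dcoord_center /form trmx_mul !mulmxA.
Qed.

Lemma ddbar_push f x : smoothf setT f ->
  ddbar A J1 (f \o phi) x = jac A phi x *m ddbar A J2 f (phi x) *m (jac A phi x)^T.
Proof.
move=> sf; apply: (etrans (congr1 (mixed_part (P10 J1 x) (P01 J1 x)) (ext_d_dbar_push x sf))).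
exact: mixed_part_conj (P10_equiv x) (P01_equiv x).
Qed.

End DdbarPush.

Section Pluriharmonic.
Variables (J : M -> 'M[R]_m).
Hypothesis J_smooth : forall x i j, smoothf (dom A x) (endo_comp A x (cx \o J) i j).
Hypotheses (J2 : almost_complex J) (J_int : integrable A J).
Variables (u : M -> R).
Local Notation uC := (fun y => (u y)%:C%C : C).
Hypothesis u_smooth : smoothf setT uC.

Definition rdiff x : 'rV[R]_m :=
  \row_i 'D_(delta_mx 0 i) (fun z => u (param A x z) : R^o) (chart A x x).

Lemma rdiffE x : diff A uC x = cx (rdiff x).
Proof.
apply/rowP => i; rewrite !mxE; apply: complexE => //=.
by rewrite derive_cst.
Qed.

(** The 1-form du o J, which is d^c u up to sign conventions. It is kept real so that the assumption
    on de Rham cohomology applies to it. *)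
Let dcu x : 'rV[R]_m := rdiff x *m (J x)^T.

Lemma pairing_dcu v x : pairing v (cx (dcu x)) = dv A (v *m cx (J x)) uC x.
Proof. by rewrite /dcu map_mxM -matrix.map_trmx -rdiffE pairing_mulr dv_pairing. Qed.

Lemma mulJJ v x : v *m cx (J x) *m cx (J x) = - v.
Proof. by rewrite -mulmxA -map_mxM J2 map_mxN map_mx1 mulmxN mulmx1. Qed.

Lemma smooth_dcu W : open W -> smooth_cov W (cx \o dcu).
Proof.
move=> oW x i; have o := dom_openI A x oW.
have sd : smoothv (dom A x `&` W) (dco A x i) by apply: smooth_dco => z [].
have s := smooth_vd o (smooth_jfield J_smooth o sd) (smooth_on_sub (fun z _ => I) u_smooth).
by apply: (smooth_on_ext o _ s) => y _; rewrite cov_compE /pr /= pairing_dcu.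
Qed.

(* Integrability makes the 2-form d(du o J) of type (1,1). *)
Lemma ext_dcu_type x :
  cx (J x) *m ext_d A (cx \o dcu) x *m (cx (J x))^T = ext_d A (cx \o dcu) x.
Proof.
apply/matrixP => i j; rewrite -!form_delta.
have oD := @dom_open _ _ _ A x; have dx := dom_self A x.
pose X := dco A x i; pose Y := dco A x j.
have sX : smoothv (dom A x) X by exact: smooth_dcoord.
have sY : smoothv (dom A x) Y by exact: smooth_dcoord.
have sJX := smooth_jfield J_smooth oD sX; have sJY := smooth_jfield J_smooth oD sY.
have sc := smooth_dcu oD.
have su : smoothf (dom A x) uC by apply: smooth_on_sub u_smooth.
have -> : form (cx (J x) *m ext_d A (cx \o dcu) x *m (cx (J x))^T) (delta_mx 0 i) (delta_mx 0 j)
   = form (ext_d A (cx \o dcu) x) (jfield J X x) (jfield J Y x).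
  by rewrite /jfield /X /Y !dcoord_center /form trmx_mul !mulmxA.
rewrite (ext_dE oD dx sJX sJY sc).
rewrite -(dcoord_center A x i) -(dcoord_center A x j) (ext_dE oD dx sX sY sc).
have prE Z : pr Z (cx \o dcu) = vd A (jfield J Z) uC.
  by apply/funext => y; rewrite /pr /= pairing_dcu.
have prJ Z Z' : smoothv (dom A x) Z ->
    vd A Z' (pr (jfield J Z) (cx \o dcu)) x = - vd A Z' (vd A Z uC) x.
  move=> sZ; rewrite prE !vdE -(dvN _ oD dx (smooth_vd oD sZ su)).
  by apply: (dv_ext _ _ oD dx) => y _; rewrite !vdE /jfield mulJJ dvNl.
rewrite !prJ // !prE !pairing_dcu -/X -/Y.
have B1 := dv_brk oD dx sX sJY su; have B2 := dv_brk oD dx sJX sY su.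
have := J_int oD sX sY dx; rewrite /= -brkE -/(jfield J X) -/(jfield J Y) => NJ.
have : dv A (brk A X Y x *m cx (J x)) uC x - dv A (brk A (jfield J X) (jfield J Y) x *m cx (J x)) uC x
   = dv A (brk A (jfield J X) Y x) uC x + dv A (brk A X (jfield J Y) x) uC x.
  rewrite -dvBl -mulmxBl -dvDl.
  have -> : brk A X Y x - brk A (jfield J X) (jfield J Y) x =
     - (brk A (jfield J X) Y x *m cx (J x) + brk A X (jfield J Y) x *m cx (J x)).
    by apply/eqP; rewrite -addr_eq0 -NJ /= addrAC !addrA.
  by rewrite mulNmx mulmxDl !mulJJ -opprD opprK.
rewrite B1 B2 => /eqP; rewrite subr_eq => /eqP ->.
by move: (dv _ _ _ _) (vd _ _ _ _) (vd _ _ _ _) (vd _ _ _ _) (vd _ _ _ _) => *; ring.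
Qed.

(** dbar u is (du + i du o J) / 2, and d(du) = 0 because coordinate fields commute. *)
Lemma ext_d_dbar x : ext_d A (dbar A J uC) x = (2^-1 * 'i%C) *: ext_d A (cx \o dcu) x.
Proof.
have oD := @dom_open _ _ _ A x; have dx := dom_self A x.
have su : smoothf (dom A x) uC by apply: smooth_on_sub u_smooth.
have sd l := smooth_dcoord A x l.
have sc l : smoothf (dom A x) (cov_comp A x (cx \o dcu) l).
  by apply: smooth_on_sub (smooth_dcu openT x l) => z.
have E k l : dv A (dco A x k x) (cov_comp A x (dbar A J uC) l) x =
   2^-1 * (vd A (dco A x k) (vd A (dco A x l) uC) x +
   'i%C * dv A (dco A x k x) (cov_comp A x (cx \o dcu) l) x).
  have s1 := smooth_vd oD (sd l) su.
  have s2 := smooth_onM oD (smooth_on_cst A 'i%C oD) (sc l).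
  rewrite vdE -(dvZ _ _ oD dx (sc l)) -(dvD _ dx s1 s2) -(dvZ _ _ oD dx (smooth_onD oD s1 s2)).
  apply: (dv_ext _ _ oD dx) => y _; rewrite !cov_compE /pr dbarE mul_P01 /= pairing_dcu.
  by rewrite dvZl dvDl dvZl vdE.
apply/matrixP => i j; apply: etrans (ext_d_coord _ _ _ _) _.
apply: etrans (congr2 (fun p q => p - q) (E i j) (E j i)) _.
rewrite [RHS]mxE; symmetry; apply: etrans (congr1 _ (ext_d_coord _ _ _ _)) _.
exact: (antisym_comb _ _ _ _ (dcoord_swap i j oD su dx dx)).
Qed.

Lemma ddbar_eq0_const :
  H1_zero A -> (forall h, holomorphic_on A J setT h -> exists c, forall x, h x = c) ->
  (forall x, ddbar A J uC x = 0) -> exists c, forall x, u x = c.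
Proof.
move=> H1 Hhol Hd.
(* d(dbar u) is a nonzero multiple of d(du o J), which is already of type (1,1); so the vanishing of
   [ddbar] is that of the whole 2-form. *)
have closed x : ext_d A (cx \o dcu) x = 0.
  set N := ext_d _ _ _.
  have H : mixed_part (P10 J x) (P01 J x) ((2^-1 * 'i%C) *: N) = 0.
    by have := Hd x; rewrite /ddbar ext_d_dbar.
  have T : cx (J x) *m ((2^-1 * 'i%C) *: N) *m (cx (J x))^T = (2^-1 * 'i%C) *: N.
    by rewrite -scalemxAr -scalemxAl ext_dcu_type.
  move: H; rewrite (mixed_part_type imag_sqr T) => /eqP; rewrite scaler_eq0 => /orP[|/eqP //].
  rewrite mulf_eq0 invr_eq0 pnatr_eq0 /= => /eqP i0.
  by have := imag_sqr; rewrite i0 mul0r => /eqP; rewrite eq_sym oppr_eq0 oner_eq0.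
have [v v_smooth dvE] : exists2 f : M -> R, smooth_on A setT (fun x => (f x)%:C%C) &
      forall x, diff A (fun y => (f y)%:C%C) x = cx (dcu x).
  apply: H1 => // x i.
  by apply: smooth_on_sub (smooth_dcu openT x i) => z.
(* As dv = du o J, the function u - i v satisfies the Cauchy-Riemann equations. *)
pose h x : C := uC x - 'i%C * (v x)%:C%C.
have sv := smooth_onM openT (smooth_on_cst A 'i%C openT) v_smooth.
have [|c hc] := Hhol h; last first.
  by exists (complex.Re c) => x; rewrite -(hc x) /h ReD /=; ring.
have sh : smoothf setT h by exact: (smooth_onB openT u_smooth sv).
split; first exact: sh.
move=> x _ w; rewrite -!dv_pairing !(dvB _ openT I u_smooth sv) !(dvZ _ _ openT I v_smooth).
rewrite !(dv_pairing _ _ (fun y => (v y)%:C%C)) !dvE !pairing_dcu mulJJ dvNl.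
set p := dv _ _ _ _; set q := dv _ _ _ _.
have -> : 'i%C * (q - 'i%C * p) = 'i%C * q - ('i%C * 'i%C) * p by ring.
by rewrite imag_sqr; ring.
Qed.

End Pluriharmonic.
End Forms.

(** * Sections of the powers of the line bundle and their covariant derivatives *)

Section Sections.
Variables (R : realType) (m : nat) (M : topologicalType) (A : atlas 'rV[R]_m M).
Local Notation C := R[i].
Local Notation vfield := (M -> 'rV[C]_m).
Local Notation cx := (map_mx (real_complex R)).
Local Notation smoothv := (smooth_vfield A).
Local Notation smoothf := (smooth_on A).
Implicit Types (W : set M) (f h : M -> C) (X Y Z : vfield) (x y : M) (v w : 'rV[C]_m).

Lemma dvX W f x v n : open W -> W x -> smoothf W f ->
  smoothf W (fun y => f y ^+ n) /\
  dv A v (fun y => f y ^+ n) x = n%:R * f x ^+ n.-1 * dv A v f x.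
Proof.
move=> oW Wx sf; elim: n => [|n [IH1 IH2]].
  split; first exact: smooth_on_cst.
  by rewrite (dv_cst A 1 x v) !mul0r.
split.
  apply: (smooth_on_ext oW _ (smooth_onM oW sf IH1)) => y _; by rewrite exprS.
rewrite (@dv_ext _ _ _ _ W _ (fun y => f y * f y ^+ n)) //; last by move=> y _; rewrite exprS.
rewrite (dvM _ Wx sf IH1) IH2 /=; case: n {IH1 IH2} => [|n] /=.
  by rewrite expr0 !mul0r mulr0 addr0 mulr1 !mul1r.
by rewrite [in RHS]mulrS exprS; move: (dv _ _ _ _) (f x) (f x ^+ n) => p q r; ring.
Qed.

Variables (L : hermitian_line_bundle A).
Local Notation fr := (frame L).
Local Notation ssec := (smooth_section L).
Implicit Types (psi : M -> C) (k : nat).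

Lemma frame_neq0 x y : dom A x y -> fr x y != 0.
Proof. by move=> dx; rewrite -normr_eq0 (frame_unitary L dx) oner_eq0. Qed.

Lemma frame_ratio_smooth x z : smoothf (dom A z `&` dom A x) (fun y => fr x y / fr z y).
Proof.
apply: (@smooth_on_chart _ _ _ _ z); first exact: openI (dom_open _ _) (dom_open _ _).
  by move=> y [].
exact: frame_smooth.
Qed.

Lemma smooth_sectionP k W psi : open W ->
  ssec k W psi <-> forall x, smoothf (dom A x `&` W) (local_comp L k x psi).
Proof.
move=> oW; split=> H x.
  have o := dom_openI A x oW.
  by apply: (@smooth_on_chart _ _ _ _ x) => // y [].
by apply: csmooth_sub (H x x) => _ [y [dy Wy] <-]; exists y.
Qed.

(** Two frames differ by a smooth function without zeros, so the component in a single frame decides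
    smoothness. *)
Lemma smooth_section_frame k W x psi : open W -> W `<=` dom A x ->
  smoothf W (local_comp L k x psi) -> ssec k W psi.
Proof.
move=> oW Wx s; apply/(smooth_sectionP _ _ oW) => z.
have o := dom_openI A z oW.
have s1 : smoothf (dom A z `&` W) (fun y => fr x y / fr z y).
  by apply: smooth_on_sub (frame_ratio_smooth x z) => y [dz /Wx].
apply: smooth_on_local => y Wy; exists (dom A z `&` W) => //.
have [s2 _] := dvX 0 k o Wy s1.
have s3 := smooth_onM o (smooth_on_sub (fun y => @proj2 _ _) s) s2.
apply: (smooth_on_ext o _ s3) => t [dz Wt].
have n1 := frame_neq0 dz; have n2 := frame_neq0 (Wx _ Wt).
by rewrite /local_comp exprMn exprVn mulrA divfK ?expf_neq0.
Qed.

Lemma smooth_section_sub k W W' psi : W' `<=` W -> ssec k W psi -> ssec k W' psi.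
Proof.
move=> WW H x; apply: csmooth_sub (H x) => _ [y [dy Wy] <-].
by exists y => //; split => //; exact: WW.
Qed.

Lemma smooth_section_local k W psi : open W ->
  (forall x, W x -> exists2 W', W' x /\ open W' & ssec k W' psi) -> ssec k W psi.
Proof.
move=> oW H; apply/(smooth_sectionP _ _ oW) => x; apply: smooth_on_local => y [dy /H[W' [W'y o'] s]].
by exists (dom A x `&` W') => //; move/(smooth_sectionP _ _ o'): s; apply.
Qed.

Lemma local_compD k x psi psi' y :
  local_comp L k x (fun z => psi z + psi' z) y = local_comp L k x psi y + local_comp L k x psi' y.
Proof. by rewrite /local_comp mulrDl. Qed.

Lemma local_compM k x f psi y :
  local_comp L k x (fun z => f z * psi z) y = f y * local_comp L k x psi y.
Proof. by rewrite /local_comp mulrA. Qed.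

Lemma ssecD k W psi psi' : open W -> ssec k W psi -> ssec k W psi' ->
  ssec k W (fun y => psi y + psi' y).
Proof.
move=> oW /(smooth_sectionP _ _ oW) s /(smooth_sectionP _ _ oW) s'.
apply/(smooth_sectionP _ _ oW) => x; have o := dom_openI A x oW.
by apply: (smooth_on_ext o _ (smooth_onD o (s x) (s' x))) => y _; rewrite local_compD.
Qed.

Lemma ssecM k W f psi : open W -> smoothf W f -> ssec k W psi ->
  ssec k W (fun y => f y * psi y).
Proof.
move=> oW sf /(smooth_sectionP _ _ oW) s.
apply/(smooth_sectionP _ _ oW) => x; have o := dom_openI A x oW.
have sf' : smoothf (dom A x `&` W) f by apply: smooth_on_sub sf => y [].
by apply: (smooth_on_ext o _ (smooth_onM o sf' (s x))) => y _; rewrite local_compM.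
Qed.

Lemma ssec0 k W : open W -> ssec k W (fun=> 0).
Proof.
move=> oW; apply/(smooth_sectionP _ _ oW) => x; have o := dom_openI A x oW.
by apply: (smooth_on_ext o _ (smooth_on_cst A 0 o)) => y _; rewrite /local_comp mul0r.
Qed.

Lemma ssec_ext k W psi psi' : open W -> (forall y, W y -> psi y = psi' y) ->
  ssec k W psi -> ssec k W psi'.
Proof.
move=> oW E /(smooth_sectionP _ _ oW) s.
apply/(smooth_sectionP _ _ oW) => x; have o := dom_openI A x oW.
by apply: (smooth_on_ext o _ (s x)) => y [_ /E Ey]; rewrite /local_comp Ey.
Qed.

Lemma ssec_sum k W (I : Type) (r : seq I) (psi : I -> M -> C) : open W ->
  (forall i, ssec k W (psi i)) -> ssec k W (fun y => \sum_(i <- r) psi i y).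
Proof.
move=> oW s; elim: r => [|i r IH].
  by apply: (ssec_ext oW _ (ssec0 k oW)) => y _; rewrite big_nil.
by apply: (ssec_ext oW _ (ssecD oW (s i) IH)) => y _; rewrite big_cons.
Qed.

Lemma frame_section x : ssec 1 (dom A x) (fr x).
Proof.
apply: (@smooth_section_frame _ _ x) => //; first exact: dom_open.
have oD := @dom_open _ _ _ A x.
apply: (smooth_on_ext oD _ (smooth_on_cst A 1 oD)) => y dy.
by rewrite /local_comp expr1 divff // frame_neq0.
Qed.

Variable theta : M -> 'rV[R]_m.

(** The covariant derivative at one point, sealed like [dv]. *)
Fact nb_sig : {d : nat -> M -> 'rV[C]_m -> (M -> C) -> C |
  d = fun k y v psi => nabla_at L theta k y v psi}.
Proof. by eexists. Qed.
Definition nb := sval nb_sig.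

Lemma nb_nabla_at k y v psi : nb k y v psi = nabla_at L theta k y v psi.
Proof. by rewrite /nb (svalP nb_sig). Qed.

Lemma nb_nabla k X psi y : nabla L theta k X psi y = nb k y (X y) psi.
Proof. by rewrite nb_nabla_at. Qed.

Lemma nbE k y v psi : nb k y v psi = dv A v (local_comp L k y psi) y
  - 'i%C * k%:R * pairing v (cx (theta y)) * psi y.
Proof. by rewrite nb_nabla_at /nabla_at dv_pairing. Qed.

Lemma local_comp_center k x psi : local_comp L k x psi x = psi x.
Proof. by rewrite /local_comp frame_self expr1n divr1. Qed.

Lemma nbDl k y v w psi : nb k y (v + w) psi = nb k y v psi + nb k y w psi.
Proof.
rewrite !nbE dvDl pairingDl; move: (dv _ _ _ _) (dv _ _ _ _) (pairing _ _) (pairing _ _) => *; ring.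
Qed.

Lemma nbZl k y a v psi : nb k y (a *: v) psi = a * nb k y v psi.
Proof.
by rewrite !nbE dvZl pairingZl; move: (dv _ _ _ _) (pairing _ _) => *; ring.
Qed.

Lemma nb_suml k y (I : Type) (r : seq I) (F : I -> 'rV[C]_m) psi :
  nb k y (\sum_(i <- r) F i) psi = \sum_(i <- r) nb k y (F i) psi.
Proof.
have nb0 : nb k y 0 psi = 0 by rewrite -(scale0r 0) nbZl mul0r.
by elim/big_ind2 : _ => [|a b c d <- <-|//]; rewrite ?nb0 // nbDl.
Qed.

Section Local.
Variables (k : nat) (W : set M) (y : M).
Hypotheses (oW : open W) (Wy : W y).
Let W1 := dom A y `&` W.
Let oW1 : open W1. Proof. exact: dom_openI. Qed.
Let W1y : W1 y. Proof. by split => //; exact: dom_self. Qed.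
Let lsm psi : ssec k W psi -> smoothf W1 (local_comp L k y psi).
Proof. by move/(smooth_sectionP _ _ oW); apply. Qed.

Lemma nb_ext v psi psi' : (forall z, W z -> psi z = psi' z) -> nb k y v psi = nb k y v psi'.
Proof.
move=> E; rewrite !nbE E //; congr (_ - _).
by apply: (dv_ext _ _ oW Wy) => z /E Ez; rewrite /local_comp Ez.
Qed.

Lemma nbD v psi psi' : ssec k W psi -> ssec k W psi' ->
  nb k y v (fun z => psi z + psi' z) = nb k y v psi + nb k y v psi'.
Proof.
move=> s s'; rewrite !nbE.
rewrite (dv_ext (g := fun z => local_comp L k y psi z + local_comp L k y psi' z) _ _ oW Wy); last first.
  by move=> z _; rewrite local_compD.
rewrite (dvD _ W1y (lsm s) (lsm s')).
by move: (dv _ _ _ _) (dv _ _ _ _) (pairing _ _) => *; ring.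
Qed.

Lemma nbM v f psi : smoothf W f -> ssec k W psi ->
  nb k y v (fun z => f z * psi z) = dv A v f y * psi y + f y * nb k y v psi.
Proof.
move=> sf s; have sf1 : smoothf W1 f by apply: smooth_on_sub sf => z [].
rewrite !nbE.
rewrite (dv_ext (g := fun z => f z * local_comp L k y psi z) _ _ oW Wy); last first.
  by move=> z _; rewrite local_compM.
rewrite (dvM _ W1y sf1 (lsm s)) local_comp_center.
by move: (dv _ _ _ _) (dv _ _ _ _) (pairing _ _) => *; ring.
Qed.

Lemma nb_sum v (I : Type) (r : seq I) (psi : I -> M -> C) : (forall i, ssec k W (psi i)) ->
  nb k y v (fun z => \sum_(i <- r) psi i z) = \sum_(i <- r) nb k y v (psi i).
Proof.
move=> s; elim: r => [|i r IH].
  rewrite big_nil (@nb_ext _ _ (fun z => 0 * (fun=> 0) z)); last first.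
    by move=> z _; rewrite big_nil mul0r.
  by rewrite (nbM _ (smooth_on_cst A 0 oW) (ssec0 k oW)) dv_cst !mul0r addr0.
rewrite big_cons -IH -(nbD _ (s i) (ssec_sum r oW s)).
by apply: nb_ext => z _; rewrite big_cons.
Qed.

(* The connection on the power [L^k] is induced from that on [L]. *)
Lemma nb_power v f psi : smoothf W f -> ssec 1 W psi ->
  nb k y v (fun z => f z * psi z ^+ k) =
  dv A v f y * psi y ^+ k + k%:R * f y * psi y ^+ k.-1 * nb 1 y v psi.
Proof.
move=> sf /(smooth_sectionP _ _ oW)/(_ y) s.
have sf1 : smoothf W1 f by apply: smooth_on_sub sf => z [].
have [s1 d1] := dvX v k oW1 W1y s.
rewrite !nbE.
rewrite (dv_ext (g := fun z => f z * local_comp L 1 y psi z ^+ k) _ _ oW Wy); last first.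
  by move=> z _; rewrite /local_comp expr1 exprMn exprVn mulrA.
rewrite (dvM _ W1y sf1 s1) d1 !local_comp_center.
case: (k) => [|n] /=.
  by move: (dv _ _ _ _) (dv _ _ _ _) (pairing _ _) => p q r; ring.
by rewrite exprS; move: (dv _ _ _ _) (dv _ _ _ _) (pairing _ _) (psi y ^+ n) => *; ring.
Qed.

End Local.

Hypothesis conn_smooth_L : smooth_connection L theta.

(** The connection form of the frame of the chart at [x], at nearby points [y]. [theta] records
    connection forms only at the centres of charts, so smoothness in [y] is obtained from the
    covariant derivative of the frame, seen as a smooth section. *)
Definition cform x v y : C := nb 1 y v (fr x) / fr x y.

Lemma smooth_cform x W X : open W -> W `<=` dom A x -> smoothv W X ->
  smoothf W (fun y => cform x (X y) y).
Proof.
move=> oW Wx sX.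
have := conn_smooth_L oW sX (smooth_section_sub Wx (frame_section x)).
move=> /(smooth_sectionP _ _ oW)/(_ x); rewrite (setIidr Wx) => s.
by apply: (smooth_on_ext oW _ s) => y Wy; rewrite /local_comp expr1 nb_nabla.
Qed.

(** The section is its component times the [k]-th power of the frame; the Leibniz rule for this
    power produces [k] times the connection form. *)
Lemma nb_frame k W x y v psi : open W -> W y -> W `<=` dom A x -> ssec k W psi ->
  nb k y v psi = (dv A v (local_comp L k x psi) y
    + k%:R * cform x v y * local_comp L k x psi y) * fr x y ^+ k.
Proof.
move=> oW Wy Wx s; have n0 := frame_neq0 (Wx _ Wy).
have sf : smoothf W (local_comp L k x psi).
  by move/(smooth_sectionP _ _ oW): s => /(_ x); rewrite (setIidr Wx).
rewrite (@nb_ext k W y oW Wy _ _ (fun z => local_comp L k x psi z * fr x z ^+ k)); last first.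
  by move=> z /Wx dz; rewrite /local_comp divfK // expf_neq0 // frame_neq0.
rewrite (nb_power k oW Wy _ sf (smooth_section_sub Wx (frame_section x))) /cform.
case: (k) => [|n] /=; first by rewrite !mul0r !addr0.
rewrite exprS; move: (dv _ _ _ _) (local_comp _ _ _ _ _) (nb _ _ _ _) (fr x y ^+ n) (fr x y) n0 => *.
by field.
Qed.

Lemma smooth_nb k W X psi : open W -> smoothv W X -> ssec k W psi ->
  ssec k W (fun y => nb k y (X y) psi).
Proof.
move=> oW sX s; apply: smooth_section_local => // x Wx; pose W1 := dom A x `&` W.
have oW1 : open W1 by exact: dom_openI.
exists W1; first by split => //; split => //; exact: dom_self.
have sub : W1 `<=` dom A x by move=> y [].
have sX1 : smoothv W1 X by apply: smooth_vfield_sub sX => y [].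
have s1 : ssec k W1 psi by apply: smooth_section_sub s => y [].
have sl : smoothf W1 (local_comp L k x psi) by move/(smooth_sectionP _ _ oW): s; apply.
apply: (smooth_section_frame oW1 sub).
have sc := smooth_onM oW1 (smooth_on_cst A k%:R oW1) (smooth_cform oW1 sub sX1).
apply: (smooth_on_ext oW1 _ (smooth_onD oW1 (smooth_vd oW1 sX1 sl) (smooth_onM oW1 sc sl))).
move=> y W1y; rewrite /local_comp (nb_frame _ oW1 W1y sub s1) mulfK //.
by rewrite expf_neq0 // frame_neq0 //; exact: sub.
Qed.

End Sections.

(** * Bivector fields and their Laplacians *)

Section Bivectors.
Variables (R : realType) (m : nat) (M : topologicalType) (A : atlas 'rV[R]_m M).
Local Notation C := R[i].
Local Notation vfield := (M -> 'rV[C]_m).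
Local Notation smoothv := (smooth_vfield A).
Local Notation smoothf := (smooth_on A).
Implicit Types (W : set M) (f h : M -> C) (X Y Z : vfield) (x y : M) (v w : 'rV[C]_m).

Definition contr (B : M -> 'M[C]_m) h : vfield := fun y => diff A h y *m B y.

Lemma dv_contr B h h' y : dv A (contr B h y) h' y = form (B y) (diff A h y) (diff A h' y).
Proof. by rewrite dv_pairing. Qed.

Lemma vd_contr_coord B x i j :
  vd A (contr B (coord A x i)) (coord A x j) = bivector_comp A x B i j.
Proof. by apply/funext => y; rewrite vdE dv_contr. Qed.

Lemma diff_expand W x y h : open W -> W y -> dom A x y -> smoothf W h ->
  diff A h y = \sum_i dv A (dco A x i y) h y *: diff A (coord A x i) y.
Proof.
move=> oW Wy dx sh; apply/rowP => l; rewrite summxE diff_center.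
rewrite (dv_expand _ oW sh Wy dx); apply: eq_bigr => i _.
by rewrite mxE diff_center mulrC.
Qed.

Lemma contr_expand W B x y h : open W -> W y -> dom A x y -> smoothf W h ->
  contr B h y = \sum_i vd A (dco A x i) h y *: contr B (coord A x i) y.
Proof.
move=> oW Wy dx sh; rewrite /contr (diff_expand oW Wy dx sh) mulmx_suml.
by apply: eq_bigr => i _; rewrite scalemxAl.
Qed.

Lemma diff_coord_center y j : diff A (coord A y j) y = delta_mx 0 j.
Proof.
apply/rowP => l; rewrite diff_center dv_dcoord_coord; last exact: dom_self.
by rewrite mxE eq_sym.
Qed.

Section OneBivector.
Variable B : M -> 'M[C]_m.
Hypothesis B_smooth : forall x i j, smoothf (dom A x) (bivector_comp A x B i j).
Hypothesis B_sym : forall y, (B y)^T = B y.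

Lemma smooth_contr W h : open W -> smoothf W h -> smoothv W (contr B h).
Proof.
move=> oW sh; apply/smooth_vfieldP => x j; have o := dom_openI A x oW.
have s : smoothf (dom A x `&` W) (fun y => \sum_i vd A (dco A x i) h y * bivector_comp A x B i j y).
  apply: smooth_on_sum => // i; apply: smooth_onM => //.
    apply: smooth_vd => //; first by apply: smooth_dco => z [].
    by apply: smooth_on_sub sh => z [].
  by apply: smooth_on_sub (B_smooth x i j) => z [].
apply: (smooth_on_ext o _ s) => y [dy Wy].
rewrite [RHS]vdE (contr_expand _ oW Wy dy sh) dv_suml; apply: eq_bigr => i _.
by rewrite dvZl -(vd_contr_coord B).
Qed.

Lemma dv_contrC h h' y : dv A (contr B h y) h' y = dv A (contr B h' y) h y.
Proof. by rewrite !dv_contr -form_tr B_sym. Qed.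

Variables (D : vfield -> vfield -> vfield) (hD : is_connection A D).
Variables (L : hermitian_line_bundle A) (theta : M -> 'rV[R]_m) (k : nat).
Hypothesis conn_smooth_L : smooth_connection L theta.
Local Notation ssec := (smooth_section L).
Local Notation nb := (nb L theta).
Local Notation lap := (laplace L theta k D B).
Implicit Types (psi : M -> C).

(** The divergence form of the Laplacian: each nabla_j psi is differentiated along B . dx^j and
    multiplied by the divergence of B . dx^j. The connection [D] enters only through divergences, so
    that no Christoffel symbol has to be transformed between charts. *)
Definition chart_laplace x psi y := \sum_j (nb k y (contr B (coord A x j) y)
    (fun z => nb k z (dco A x j z) psi)
  + divv A D (contr B (coord A x j)) y * nb k y (dco A x j y) psi).

Lemma nb_row y v psi : nb k y v psi = \sum_n v 0 n * nb k y (dco A y n y) psi.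
Proof.
rewrite {1}(row_sum_delta v) nb_suml; apply: eq_bigr => n _.
by rewrite nbZl dcoord_center.
Qed.

(** The Christoffel term of [nabla2] cancels the term of [div_bivector] in which the free index sits
    on the Christoffel symbol. By symmetry of [B], the rest of [div_bivector] has the divergences of
    the fields B . dx^n as components. *)
Lemma laplace_center y psi : lap psi y = chart_laplace y psi y.
Proof.
have oD := @dom_open _ _ _ A y; have dy := dom_self A y.
pose t n := nb k y (dco A y n y) psi.
have Bc i j : bivector_comp A y B i j y = B y i j.
  by rewrite /bivector_comp !diff_coord_center form_delta.
have Bs i j : bivector_comp A y B i j = bivector_comp A y B j i.
  by apply/funext => z; rewrite /bivector_comp -form_tr B_sym.
pose G l q n := christoffel A D y l q n.
have divE j : divv A D (contr B (coord A y j)) y =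
    \sum_l (diff A (bivector_comp A y B l j) y 0 l + \sum_q G l q l * B y q j).
  have sZ := smooth_contr oD (coord_smooth A y j).
  rewrite (divv_coord hD oD dy dy sZ) !big_split /=; congr (_ + _).
    by apply: eq_bigr => l _; rewrite diff_center vd_contr_coord Bs vdE.
  rewrite [RHS]exchange_big; apply: eq_bigr => q _.
  rewrite vd_contr_coord Bc divvE -mulr_suml mulrC -[B y q j]Bc Bs Bc; congr (_ * _).
  by apply: eq_bigr => l _; rewrite /G /christoffel dcoE.
have ZE j : contr B (coord A y j) y = row j (B y).
  by rewrite /contr diff_coord_center rowE.
rewrite /laplace /nabla2 /chart_laplace [in RHS]big_split /=.
rewrite [X in _ = X + _](_ : _ = \sum_i \sum_j B y i j * nb k y (dco A y i y)
    (fun z => nb k z (dco A y j z) psi)); last first.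
  rewrite exchange_big; apply: eq_bigr => j _; rewrite ZE nb_row; apply: eq_bigr => i _.
  by rewrite mxE -Bc Bs Bc.
have -> : \sum_i \sum_j B y i j *
   (nabla L theta k (dcoord A y i) (nabla L theta k (dcoord A y j) psi) y -
    nabla L theta k (D (dcoord A y i) (dcoord A y j)) psi y) =
  \sum_i \sum_j B y i j * nb k y (dco A y i y) (fun z => nb k z (dco A y j z) psi)
  - \sum_n (\sum_i \sum_j G i j n * B y i j) * t n.
  have -> : \sum_n (\sum_i \sum_j G i j n * B y i j) * t n =
     \sum_i \sum_j B y i j * (\sum_n G i j n * t n).
    under eq_bigr do rewrite big_distrl /=.
    rewrite exchange_big; apply: eq_bigr => i _ /=.
    under eq_bigr do rewrite big_distrl /=.
    rewrite exchange_big; apply: eq_bigr => j _ /=.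
    by rewrite big_distrr /=; apply: eq_bigr => n _; rewrite mulrAC mulrC mulrA.
  rewrite -sumrB; apply: eq_bigr => i _; rewrite -sumrB; apply: eq_bigr => j _.
  rewrite mulrBr -dcoE nb_nabla; congr (_ * _ - _ * _).
    have -> // : nabla L theta k (dco A y j) psi = fun z => nb k z (dco A y j z) psi.
    by apply/funext => z; rewrite nb_nabla.
  by rewrite nb_nabla nb_row; apply: eq_bigr => n _; rewrite /G /christoffel -dcoE.
rewrite nb_nabla [X in _ + X = _](_ : _ = \sum_n divv A D (contr B (coord A y n)) y * t n
  + \sum_n (\sum_i \sum_j G i j n * B y i j) * t n); first by rewrite addrACA addNr addr0.
rewrite nb_row -big_split; apply: eq_bigr => n _ /=; rewrite -mulrDl; congr (_ * _).
rewrite mxE divE -big_split; apply: eq_bigr => l _ /=; rewrite -addrA; congr (_ + _).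
by rewrite -big_split.
Qed.

(** [laplace] at [y] is computed in the chart at [y]; its smoothness in [y] requires a fixed chart.
    With [N] the derivatives of one set of coordinates along the other frame, the derivatives of [N]
    coming from nabla_Z (N nabla psi) match those in div (N Z) = Z[N] + N div Z. *)
Lemma laplace_chart W x y psi : open W -> W y -> dom A x y -> ssec k W psi ->
  lap psi y = chart_laplace x psi y.
Proof.
move=> oW0 W0y dx s0; rewrite laplace_center.
pose W1 := dom A x `&` (dom A y `&` W).
have oW : open W1 by do 2![apply: dom_openI].
have Wy : W1 y by do 2![split => //]; exact: dom_self.
have s : ssec k W1 psi by apply: smooth_section_sub s0 => z [_ []].
have sx a : smoothv W1 (dco A x a) by apply: smooth_dco => z [].
have sy i : smoothv W1 (dco A y i) by apply: smooth_dco => z [_ []].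
have scx a : smoothf W1 (coord A x a) by apply: smooth_on_sub (coord_smooth A x a) => z [].
have scy i : smoothf W1 (coord A y i) by apply: smooth_on_sub (coord_smooth A y i) => z [_ []].
have sZ i := smooth_contr oW (scy i).
pose N a i := vd A (dco A y i) (coord A x a).
have sN a i : smoothf W1 (N a i) by exact: smooth_vd.
have snx a := smooth_nb conn_smooth_L oW (sx a) s.
have e1 i z : W1 z -> dco A y i z = \sum_a N a i z *: dco A x a z.
  by move=> [dz _]; exact: vec_expand.
have e2 a z : W1 z -> contr B (coord A x a) z = \sum_i N a i z *: contr B (coord A y i) z.
  by move=> Wz; case: (Wz) => _ [dz _]; exact: contr_expand oW Wz dz (scx a).
have nbi i z : W1 z -> nb k z (dco A y i z) psi = \sum_a N a i z * nb k z (dco A x a z) psi.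
  by move=> Wz; rewrite (e1 _ _ Wz) nb_suml; apply: eq_bigr => a _; rewrite nbZl.
have sNn a i : ssec k W1 (fun z => N a i z * nb k z (dco A x a z) psi) by apply: ssecM.
rewrite /chart_laplace.
have -> : \sum_j (nb k y (contr B (coord A x j) y) (fun z => nb k z (dco A x j z) psi)
   + divv A D (contr B (coord A x j)) y * nb k y (dco A x j y) psi) =
  \sum_a \sum_i (N a i y * nb k y (contr B (coord A y i) y) (fun z => nb k z (dco A x a z) psi)
   + (dv A (contr B (coord A y i) y) (N a i) y + N a i y * divv A D (contr B (coord A y i)) y)
     * nb k y (dco A x a y) psi).
  apply: eq_bigr => a _; rewrite big_split /=; congr (_ + _).
    by rewrite (e2 _ _ Wy) nb_suml; apply: eq_bigr => i _; rewrite nbZl.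
  rewrite -mulr_suml -(divv_sum hD _ oW Wy (sN a) sZ); congr (_ * _).
  by apply: (divv_ext hD oW Wy (smooth_contr oW (scx a))) => z; exact: e2.
rewrite exchange_big; apply: eq_bigr => i _ /=.
rewrite (nb_ext L theta k oW Wy _ (nbi i)) (nb_sum theta oW Wy _ _ (sNn ^~ i)) (nbi _ _ Wy).
rewrite big_distrr -big_split; apply: eq_bigr => a _ /=.
rewrite (nbM _ oW Wy _ (sN a i) (snx a)).
by move: (nb _ _ _ _) (nb _ _ _ _) (dv _ _ _ _) (divv _ _ _ _) (N a i y) => *; ring.
Qed.

Lemma smooth_laplace W psi : open W -> ssec k W psi -> ssec k W (lap psi).
Proof.
move=> oW s; apply: smooth_section_local => // x Wx; pose W1 := dom A x `&` W.
have oW1 : open W1 by exact: dom_openI.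
exists W1; first by split => //; split => //; exact: dom_self.
have s1 : ssec k W1 psi by apply: smooth_section_sub s => y [].
have sx a : smoothv W1 (dco A x a) by apply: smooth_dco => z [].
have scx a : smoothf W1 (coord A x a) by apply: smooth_on_sub (coord_smooth A x a) => z [].
have sZ a := smooth_contr oW1 (scx a).
have snx a := smooth_nb conn_smooth_L oW1 (sx a) s1.
have H : ssec k W1 (chart_laplace x psi).
  apply: ssec_sum => // a; apply: ssecD => //; first exact: smooth_nb.
  by apply: ssecM => //; exact: smooth_divv.
by apply: (ssec_ext oW1 _ H) => y [dy Wy]; rewrite (laplace_chart oW Wy dy s).
Qed.

(** The derivative along B . df occurs twice: once when the outer derivative along B . dx^i acts on
    [psi] and the inner one on [f], once with the roles exchanged. [E1] and [E2] are the two
    corresponding expansions of B . df, and the second rests on the symmetry of [B]. The second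
    derivatives of [f] make up its divergence. *)
Lemma laplace_comm W f psi y : open W -> W y -> smoothf W f -> ssec k W psi ->
  lap (fun z => f z * psi z) y = f y * lap psi y
  + (2 * nb k y (contr B f y) psi + divv A D (contr B f) y * psi y).
Proof.
move=> oW0 W0y sf0 s0; rewrite !laplace_center.
pose W1 := dom A y `&` W; have dy := dom_self A y.
have oW : open W1 by exact: dom_openI.
have Wy : W1 y by split => //; exact: dom_self.
have s : ssec k W1 psi by apply: smooth_section_sub s0 => z [].
have sf : smoothf W1 f by apply: smooth_on_sub sf0 => z [].
have sy i : smoothv W1 (dco A y i) by apply: smooth_dco => z [].
have scy i : smoothf W1 (coord A y i) by apply: smooth_on_sub (coord_smooth A y i) => z [].
have sZ i := smooth_contr oW (scy i).
have sn i := smooth_nb conn_smooth_L oW (sy i) s.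
have sdf i : smoothf W1 (vd A (dco A y i) f) by exact: smooth_vd.
have E1 : contr B f y = \sum_i vd A (dco A y i) f y *: contr B (coord A y i) y.
  exact: contr_expand oW Wy dy sf.
have E2 : contr B f y = \sum_i dv A (contr B (coord A y i) y) f y *: dco A y i y.
  rewrite [LHS](vec_expand _ dy); apply: eq_bigr => i _; by rewrite dv_contrC.
have E3 : divv A D (contr B f) y = \sum_i (dv A (contr B (coord A y i) y) (vd A (dco A y i) f) y
    + vd A (dco A y i) f y * divv A D (contr B (coord A y i)) y).
  rewrite -(divv_sum hD _ oW Wy sdf sZ).
  apply: (divv_ext hD oW Wy (smooth_contr oW sf)) => z Wz; case: (Wz) => dz _.
  exact: contr_expand oW Wz dz sf.
have E4 : 2 * nb k y (contr B f y) psi =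
    \sum_i (vd A (dco A y i) f y * nb k y (contr B (coord A y i) y) psi
     + dv A (contr B (coord A y i) y) f y * nb k y (dco A y i y) psi).
  rewrite mulrDl mul1r {1}E1 E2 !nb_suml -big_split; apply: eq_bigr => i _.
  by rewrite !nbZl.
rewrite E3 E4 mulr_suml /chart_laplace big_distrr -!big_split; apply: eq_bigr => i _ /=.
have E5 z : W1 z -> nb k z (dco A y i z) (fun z => f z * psi z) =
    vd A (dco A y i) f z * psi z + f z * nb k z (dco A y i z) psi.
  by move=> Wz; rewrite (nbM theta oW Wz _ sf s).
rewrite (nb_ext L theta k oW Wy _ E5) (E5 _ Wy).
rewrite (nbD theta oW Wy _ (ssecM oW (sdf i) s) (ssecM oW sf (sn i))).
rewrite (nbM theta oW Wy _ (sdf i) s) (nbM theta oW Wy _ sf (sn i)) !vdE.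
move: (nb _ _ _ _) (nb _ _ _ _) (nb _ _ _ _)
  (dv _ _ _ _) (dv _ _ _ _) (dv _ _ _ _) (divv _ _ _ _) (f y) (psi y).
by move=> *; ring.
Qed.

End OneBivector.
End Bivectors.

(** * The algebra of differential operators *)

Section DifferentialOperators.
Variables (R : realType) (m : nat) (M : topologicalType) (A : atlas 'rV[R]_m M).
Variables (L : hermitian_line_bundle A) (k : nat).
Local Notation C := R[i].
Local Notation smoothf := (smooth_on A).
Local Notation ssec := (smooth_section L).
Local Notation operator := ((M -> C) -> (M -> C)).
Implicit Types (f h : M -> C) (P Q : operator) (r : nat).

Definition linear_op P :=
  (forall psi, ssec k setT psi -> ssec k setT (P psi)) /\
  forall c psi psi', ssec k setT psi -> ssec k setT psi' ->
    forall x, P (fun y => c * psi y + psi' y) x = c * P psi x + P psi' x.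

Lemma linear_op0 P x : linear_op P -> P (fun=> 0) x = 0.
Proof.
move=> lP; have s0 := ssec0 L k (@openT M).
have E : P (fun=> 0) x = -1 * P (fun=> 0) x + P (fun=> 0) x.
  by rewrite -(lP.2 (-1) _ _ s0 s0 x); congr (P _ x); apply/funext => y; rewrite mulr0 addr0.
by rewrite E mulN1r addNr.
Qed.

Lemma linear_opB P psi psi' x : linear_op P -> ssec k setT psi -> ssec k setT psi' ->
  P (fun y => psi y - psi' y) x = P psi x - P psi' x.
Proof.
move=> lP s s'; have := lP.2 (-1) _ _ s' s x; rewrite mulN1r addrC => <-.
by congr (P _ x); apply/funext => y; rewrite mulN1r addrC.
Qed.

Lemma linear_op_comp P Q : linear_op P -> linear_op Q -> linear_op (fun psi => P (Q psi)).
Proof.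
move=> lP lQ; split=> [psi s|c psi psi' s s' x]; first exact/lP.1/lQ.1.
rewrite -(lP.2 c _ _ (lQ.1 _ s) (lQ.1 _ s')); congr (P _ x).
by apply/funext => y; rewrite lQ.2.
Qed.

Lemma linear_opA P Q : linear_op P -> linear_op Q ->
  linear_op (fun psi x => P psi x + Q psi x).
Proof.
move=> lP lQ; split=> [psi s|c psi psi' s s' x].
  by apply: ssecD => //; [exact: openT|exact: lP.1|exact: lQ.1].
rewrite lP.2 // lQ.2 //; move: (P _ _) (P _ _) (Q _ _) (Q _ _) => *; ring.
Qed.

Lemma linear_opZ f P : smoothf setT f -> linear_op P -> linear_op (fun psi x => f x * P psi x).
Proof.
move=> sf lP; split=> [psi s|c psi psi' s s' x].
  by apply: ssecM => //; [exact: openT|exact: lP.1].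
rewrite lP.2 //; move: (P _ _) (P _ _) (f x) => *; ring.
Qed.

Lemma linear_op_mulop f : smoothf setT f -> linear_op (mulop f).
Proof.
move=> sf; split=> [psi s|c psi psi' s s' x]; first by apply: ssecM => //; exact: openT.
by rewrite /mulop; ring.
Qed.

Lemma linear_op_comm P f : linear_op P -> smoothf setT f -> linear_op (commop P (mulop f)).
Proof.
move=> lP sf; have lf := linear_op_mulop sf.
have [s1 l1] := linear_opA (linear_op_comp lP lf)
  (linear_opZ (smooth_on_cst A (-1) openT) (linear_op_comp lf lP)).
split=> [psi s|c psi psi' s s' x].
  by apply: (ssec_ext openT _ (s1 psi s)) => y _; rewrite /commop mulN1r.
by have := l1 c psi psi' s s' x; rewrite /commop !mulN1r.
Qed.

Lemma order_lt_ext r P Q : eq_op_on L k P Q -> order_lt L k r P -> order_lt L k r Q.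
Proof.
elim: r P Q => [|r IH] P Q E /= oP; first by move=> psi s x; rewrite -E // oP.
move=> f sf; apply: IH (oP f sf) => psi s x; rewrite /commop /mulop (E psi s).
by rewrite (E _ (ssecM openT sf s)).
Qed.

Lemma order_lt_comm0 P f : linear_op P -> smoothf setT f -> order_lt L k 0 P ->
  order_lt L k 0 (commop P (mulop f)).
Proof.
move=> lP sf oP psi s x; rewrite /commop /mulop !oP // ?mulr0 ?subrr //.
by apply: ssecM => //; exact: openT.
Qed.

Lemma order_ltS r P : linear_op P -> order_lt L k r P -> order_lt L k r.+1 P.
Proof.
elim: r P => [|r IH] P lP oP f sf; first exact: order_lt_comm0.
by apply: IH; [exact: linear_op_comm|exact: oP].
Qed.

Lemma order_lt_le r r' P : linear_op P -> (r <= r')%N -> order_lt L k r P -> order_lt L k r' P.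
Proof.
move=> lP; elim: r' => [|r' IH]; first by rewrite leqn0 => /eqP ->.
rewrite leq_eqVlt => /orP[/eqP -> //|]; rewrite ltnS => /IH H /H; exact: order_ltS.
Qed.

Lemma order_lt0_all r P : linear_op P -> order_lt L k 0 P -> order_lt L k r P.
Proof. by move=> lP; apply: order_lt_le. Qed.

Lemma order_ltD r P Q : order_lt L k r P -> order_lt L k r Q ->
  order_lt L k r (fun psi x => P psi x + Q psi x).
Proof.
elim: r P Q => [|r IH] P Q oP oQ; first by move=> psi s x; rewrite oP // oQ // addr0.
move=> f sf; apply: order_lt_ext (IH _ _ (oP f sf) (oQ f sf)) => psi s x.
by rewrite /commop /mulop; move: (P _ _) (P _ _) (Q _ _) (Q _ _) => *; ring.
Qed.

Lemma order_ltZ r h P : order_lt L k r P -> order_lt L k r (fun psi x => h x * P psi x).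
Proof.
elim: r P => [|r IH] P oP; first by move=> psi s x; rewrite oP // mulr0.
move=> f sf; apply: order_lt_ext (IH _ (oP f sf)) => psi s x.
by rewrite /commop /mulop; move: (P _ _) (P _ _) => *; ring.
Qed.

(** Since [P Q, f] = P [Q, f] + [P, f] Q, a commutator lowers one of the two orders by one. A bound
    [n] on [r + r'] lets a single induction serve both summands; if [r] or [r'] is 0, the composite
    is zero. *)
Lemma order_lt_comp n r r' P Q : (r + r' <= n)%N -> linear_op P -> linear_op Q ->
  order_lt L k r P -> order_lt L k r' Q -> order_lt L k n (fun psi => P (Q psi)).
Proof.
elim: n r r' P Q => [|n IH] r r' P Q rn lP lQ oP oQ.
  move: rn; rewrite leqn0 addn_eq0 => /andP[/eqP r0 _]; rewrite r0 in oP.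
  by move=> psi s x; rewrite oP //; exact: lQ.1.
case: r rn oP => [|r] rn oP.
  apply: order_lt0_all; first exact: linear_op_comp.
  by move=> psi s x; rewrite oP //; exact: lQ.1.
case: r' rn oQ => [|r'] rn oQ.
  apply: order_lt0_all; first exact: linear_op_comp.
  move=> psi s x; rewrite -(linear_op0 x lP); congr (P _ x).
  by apply/funext => y; rewrite oQ.
move=> f sf; have lPf := linear_op_comm lP sf; have lQf := linear_op_comm lQ sf.
have o1 : order_lt L k n (fun psi => P (commop Q (mulop f) psi)).
  apply: (IH r.+1 r') => //; last exact: oQ.
  by move: rn; rewrite addnS ltnS.
have o2 : order_lt L k n (fun psi => commop P (mulop f) (Q psi)).
  by apply: (IH r r'.+1) => //; exact: oP.
apply: order_lt_ext (order_ltD o1 o2) => psi s x.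
have sQ := lQ.1 _ s; have sfp : ssec k setT (mulop f psi) by apply: (linear_op_mulop sf).1.
have sfQ : ssec k setT (mulop f (Q psi)) by apply: (linear_op_mulop sf).1.
rewrite /commop.
rewrite -[P (fun y => Q (mulop f psi) y - mulop f (Q psi) y) x]/(P (fun y => Q (mulop f psi) y - mulop f (Q psi) y) x).
by rewrite (linear_opB x lP (lQ.1 _ sfp) sfQ) addrA subrK.
Qed.

Lemma diffopP P : diffop L k P <-> linear_op P /\ exists r, order_lt L k r P.
Proof.
split=> [[h1 h2 h3]|[[h1 h2] h3]]; first by split => //; split.
by split.
Qed.

Lemma diffop_linear P : diffop L k P -> linear_op P.
Proof. by move/diffopP => []. Qed.

Lemma diffop_comp P Q : diffop L k P -> diffop L k Q -> diffop L k (fun psi => P (Q psi)).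
Proof.
move=> /diffopP[lP [r oP]] /diffopP[lQ [r' oQ]]; apply/diffopP; split.
  exact: linear_op_comp.
by exists (r + r')%N; apply: order_lt_comp oP oQ.
Qed.

Lemma diffopD P Q : diffop L k P -> diffop L k Q -> diffop L k (fun psi x => P psi x + Q psi x).
Proof.
move=> /diffopP[lP [r oP]] /diffopP[lQ [r' oQ]]; apply/diffopP; split.
  exact: linear_opA.
by exists (r + r')%N; apply: order_ltD; [apply: order_lt_le oP|apply: order_lt_le oQ];
   rewrite ?leq_addr ?leq_addl.
Qed.

Lemma diffopZ h P : smoothf setT h -> diffop L k P -> diffop L k (fun psi x => h x * P psi x).
Proof.
move=> sh /diffopP[lP [r oP]]; apply/diffopP; split; first exact: linear_opZ.
by exists r; apply: order_ltZ.
Qed.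

Lemma diffop_ext P Q : eq_op_on L k P Q -> diffop L k P -> diffop L k Q.
Proof.
move=> E /diffopP[lP [r oP]]; apply/diffopP; split; last by exists r; apply: order_lt_ext oP.
split=> [psi s|c psi psi' s s' x].
  by apply: (ssec_ext openT _ (lP.1 psi s)) => y _; exact: E.
rewrite -!E //; first exact: lP.2.
by apply: ssecD => //; [exact: openT|apply: ssecM => //; [exact: openT|exact: (smooth_on_cst A c openT)]].
Qed.

Lemma diffop_mulop h : smoothf setT h -> diffop L k (mulop h).
Proof.
move=> sh; apply/diffopP; split; first exact: linear_op_mulop.
by exists 1%N => f sf psi s x; rewrite /commop /mulop; ring.
Qed.

Lemma diffop_comm P Q : diffop L k P -> diffop L k Q -> diffop L k (commop P Q).
Proof.
move=> dP dQ.
have := diffopD (diffop_comp dP dQ) (diffopZ (smooth_on_cst A (-1) openT) (diffop_comp dQ dP)).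
by apply: diffop_ext => psi s x; rewrite /commop mulN1r.
Qed.

Variable theta : M -> 'rV[R]_m.
Hypothesis conn_smooth_L : smooth_connection L theta.

Lemma diffop_nabla X : smooth_vfield A setT X ->
  diffop L k (fun psi x => nb L theta k x (X x) psi).
Proof.
move=> sX; apply/diffopP; split.
  split=> [psi s|c psi psi' s s' x]; first exact: (smooth_nb conn_smooth_L openT sX s).
  have sc := smooth_on_cst A c (@openT M).
  rewrite (nbD theta openT I _ (ssecM openT sc s) s') (nbM theta openT I _ sc s).
  by rewrite dv_cst mul0r add0r.
(* The bound is strict, so 2 stands for order at most one; the commutator with a function is
   multiplication by its derivative along [X]. *)
exists 2%N => f sf; have dh := diffop_mulop (smooth_vd openT sX sf).
apply: (@order_lt_ext 1 (mulop (vd A X f))); last first.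
  by move=> g sg psi s x; rewrite /commop /mulop; ring.
move=> psi s x; rewrite /commop /mulop (nbM theta openT I _ sf s) vdE.
by rewrite addrK.
Qed.

Lemma diffop_laplace B D : (forall x i j, smoothf (dom A x) (bivector_comp A x B i j)) ->
  (forall y, (B y)^T = B y) -> is_connection A D -> diffop L k (laplace L theta k D B).
Proof.
move=> sB symB hD; have lapD := laplace_comm sB symB hD conn_smooth_L.
apply/diffopP; split.
  split=> [psi s|c psi psi' s s' x]; first exact: (smooth_laplace sB symB hD conn_smooth_L openT s).
  have oD := @dom_open _ _ _ A x; have dx := dom_self A x.
  have sc := smooth_on_cst A c (@openT M).
  rewrite !(laplace_center sB symB hD) /chart_laplace big_distrr -big_split /=.
  apply: eq_bigr => j _.
  have sj := smooth_dcoord A x j.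
  have ss := smooth_section_sub (fun z (_ : dom A x z) => I) s.
  have ss' := smooth_section_sub (fun z (_ : dom A x z) => I) s'.
  have scx := smooth_on_cst A c oD.
  have E z : dom A x z -> nb L theta k z (dco A x j z) (fun y => c * psi y + psi' y) =
    c * nb L theta k z (dco A x j z) psi + nb L theta k z (dco A x j z) psi'.
    move=> dz; rewrite (nbD theta oD dz _ (ssecM oD scx ss) ss').
    by rewrite (nbM theta oD dz _ scx ss) dv_cst mul0r add0r.
  have sn := smooth_nb conn_smooth_L oD sj ss.
  have sn' := smooth_nb conn_smooth_L oD sj ss'.
  rewrite (nb_ext L theta k oD dx _ E) (E _ dx).
  rewrite (nbD theta oD dx _ (ssecM oD scx sn) sn') (nbM theta oD dx _ scx sn) dv_cst mul0r add0r.
  by move: (nb _ _ _ _ _ _) (nb _ _ _ _ _ _) (nb _ _ _ _ _ _) (nb _ _ _ _ _ _) => *; ring.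
(* Order at most two: by [laplace_comm] the commutator with a function is of first order. *)
exists 3%N => f sf.
have sZ := smooth_contr sB openT sf.


apply: (@order_lt_ext 2 (fun psi x =>
  2 * nb L theta k x (contr A B f x) psi + divv A D (contr A B f) x * psi x)).
  by move=> psi s x; rewrite /commop /mulop (lapD k setT f psi x openT I sf s) addrAC subrr add0r.
move=> g sg; apply: (@order_lt_ext 1 (mulop (fun x => 2 * vd A (contr A B f) g x))).
  move=> psi s x; rewrite /commop /mulop (nbM theta openT I _ sg s) vdE.
  by move: (nb _ _ _ _ _ _) (divv _ _ _ _) (dv _ _ _ _) => *; ring.
by move=> g' sg' psi s x; rewrite /commop /mulop; ring.
Qed.

End DifferentialOperators.

(** * Differentiability of sums and products of complex functions *)

Section ComplexDifferentiability.
Variables (R : realType) (V : normedModType R).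
Local Notation C := R[i].
Implicit Types (F G : V -> C) (x : V).

Lemma cdifferentiable_cst (a : C) x : cdifferentiable (fun _ : V => a) x.
Proof.
by split; [exact: (differentiable_cst (complex.Re a : R^o) x)
          |exact: (differentiable_cst (complex.Im a : R^o) x)].
Qed.

Lemma cdifferentiableD F G x : cdifferentiable F x -> cdifferentiable G x ->
  cdifferentiable (fun t => F t + G t) x.
Proof.
move=> [f1 f2] [g1 g2]; split.
  rewrite (_ : (fun t => _) = fun t => complex.Re (F t) + complex.Re (G t) : R^o).
    exact: differentiableD.
  by apply/funext => t; rewrite ReD.
rewrite (_ : (fun t => _) = fun t => complex.Im (F t) + complex.Im (G t) : R^o).
  exact: differentiableD.
by apply/funext => t; rewrite ImD.
Qed.

Lemma cdifferentiableM F G x : cdifferentiable F x -> cdifferentiable G x ->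
  cdifferentiable (fun t => F t * G t) x.
Proof.
have dM (p q : V -> R^o) : differentiable p x -> differentiable q x ->
  differentiable (fun y => p y * q y : R^o) x by move=> ? ?; exact: differentiableM.
move=> [f1 f2] [g1 g2]; split.
  rewrite (_ : (fun t => _) = fun t => complex.Re (F t) * complex.Re (G t)
     - complex.Im (F t) * complex.Im (G t) : R^o).
    by apply: differentiableB; exact: dM.
  by apply/funext => t; rewrite ReM.
rewrite (_ : (fun t => _) = fun t => complex.Re (F t) * complex.Im (G t)
     + complex.Im (F t) * complex.Re (G t) : R^o).
  by apply: differentiableD; exact: dM.
by apply/funext => t; rewrite ImM.
Qed.

Lemma cderive_sum (I : Type) (r : seq I) (a : I -> C) (F : I -> V -> C) x v :
  (forall i, cdifferentiable (F i) x) ->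
  cdifferentiable (fun t => \sum_(i <- r) a i * F i t) x /\
  cderive (fun t => \sum_(i <- r) a i * F i t) x v = \sum_(i <- r) a i * cderive (F i) x v.
Proof.
move=> dF; elim: r => [|i r [IH1 IH2]].
  have -> : (fun t => \sum_(i <- [::]) a i * F i t) = fun=> 0.
    by apply/funext => t; rewrite big_nil.
  by rewrite big_nil cderive_cst; split => //; exact: cdifferentiable_cst.
have -> : (fun t => \sum_(j <- i :: r) a j * F j t) =
           fun t => a i * F i t + \sum_(j <- r) a j * F j t.
  by apply/funext => t; rewrite big_cons.
have dc := cdifferentiable_cst (a i) x.
have da := cdifferentiableM dc (dF i).
rewrite big_cons; split; first exact: cdifferentiableD.
by rewrite (cderiveD _ da IH1) IH2 (cderiveM _ dc (dF i)) cderive_cst mul0r add0r.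
Qed.

End ComplexDifferentiability.

(** * Joint smoothness on the product with the parameter space, and derivatives along the latter *)

Section JointCalculus.
Variables (R : realType) (m : nat) (M : topologicalType) (A : atlas 'rV[R]_m M).
Variables (E : normedModType R) (T : topologicalType) (AT : atlas E T).
Hypothesis finE : finite_dim E.
Local Notation C := R[i].
Local Notation vfield := (M -> 'rV[C]_m).
Local Notation smoothv := (smooth_vfield A).
Local Notation smoothf := (smooth_on A).
Local Notation jsmooth := (smooth_prod AT A).
Local Notation jset tau x W := ((chart AT tau @` dom AT tau) `*` (chart A x @` (dom A x `&` W))).
Implicit Types (W : set M) (f h : M -> C) (X : vfield) (x y : M) (sigma tau : T) (u : T -> M -> C).

Definition joint tau x u (z : (E * 'rV[R]_m)%type) : C := u (param AT tau z.1) (param A x z.2).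

Lemma open_setX (V1 V2 : normedModType R) (U1 : set V1) (U2 : set V2) :
  open U1 -> open U2 -> open (U1 `*` U2).
Proof.
move=> o1 o2; have -> : U1 `*` U2 = (fst @^-1` U1) `&` (snd @^-1` U2) by [].
apply: openI; apply: open_comp => // z _; [exact: cvg_fst|exact: cvg_snd].
Qed.

Lemma jset_open tau x W : open W -> open (jset tau x W).
Proof. by move=> oW; apply: open_setX; [exact: chart_open|exact: chart_image_open]. Qed.

Lemma jsmooth_ext W u u' : open W -> (forall tau y, W y -> u tau y = u' tau y) ->
  jsmooth W u -> jsmooth W u'.
Proof.
move=> oW H s tau x; apply: csmooth_ext (s tau x); first exact: jset_open.
by move=> z [_ /chart_imageP[_ Wz _]]; exact: H.
Qed.

Lemma jsmooth_sub W W' u : W' `<=` W -> jsmooth W u -> jsmooth W' u.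
Proof.
move=> WW s tau x; apply: csmooth_sub (s tau x) => z [z1 [y [dy Wy] yz]].
by split => //; exists y => //; split => //; exact: WW.
Qed.

Lemma jsmoothD W u u' : open W -> jsmooth W u -> jsmooth W u' ->
  jsmooth W (fun tau y => u tau y + u' tau y).
Proof.
by move=> oW s s' tau x; have := csmoothD (jset_open (tau:=tau) (x:=x) oW) (s tau x) (s' tau x).
Qed.

Lemma jsmoothM W u u' : open W -> jsmooth W u -> jsmooth W u' ->
  jsmooth W (fun tau y => u tau y * u' tau y).
Proof.
by move=> oW s s' tau x; have := csmoothM (jset_open (tau:=tau) (x:=x) oW) (s tau x) (s' tau x).
Qed.

Lemma jsmooth_sum W (I : Type) (r : seq I) (u : I -> T -> M -> C) : open W ->
  (forall i, jsmooth W (u i)) -> jsmooth W (fun tau y => \sum_(i <- r) u i tau y).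
Proof.
by move=> oW s tau x; apply: (csmooth_sum _ (jset_open (tau:=tau) (x:=x) oW)) => i; exact: s.
Qed.

Lemma jsmooth_const W f : open W -> smoothf W f -> jsmooth W (fun=> f).
Proof.
move=> oW sf tau x; have o := jset_open (tau:=tau) (x:=x) oW.
apply: (csmooth_comp (finite_dim_rV R m) o (chart_image_open (x:=x) oW) _ (sf x)).
  by move=> z [_ ?].
by move=> n; apply: is_diff_lin => // v; exact: is_diff_snd.
Qed.

Lemma jsmoothN W u : open W -> jsmooth W u -> jsmooth W (fun tau y => - u tau y).
Proof.
move=> oW s; apply: (jsmooth_ext oW _ (jsmoothM oW (jsmooth_const oW (smooth_on_cst A (-1) oW)) s)).
by move=> tau y _; rewrite mulN1r.
Qed.

Lemma is_diff_inr (c : E) (z : 'rV[R]_m) : is_diff z (fun w : 'rV[R]_m => (c, w)) (fun w => (0, w)).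
Proof. exact: (is_diff_pair (is_diff_cst c z) (is_diff_id z)). Qed.

Lemma is_diff_inl (c : 'rV[R]_m) (z : E) : is_diff z (fun w : E => (w, c)) (fun w => (w, 0)).
Proof. exact: (is_diff_pair (is_diff_id z) (is_diff_cst c z)). Qed.

Lemma smooth_inr (c : E) (U : set 'rV[R]_m) : open U -> smooth U (fun w : 'rV[R]_m => (c, w)).
Proof.
move=> oU n.
have s : Ck n U (fun w : 'rV[R]_m => (0 : E, w)).
  by apply: is_diff_lin => // v; exact: is_diff_inr.
apply: (Ck_ext oU _ (CkD oU (Ck_cst n (c, 0 : 'rV[R]_m) oU) s)) => w _.
by apply/pair_equal_spec; rewrite /= addr0 add0r.
Qed.

Lemma csmooth_slice (U : set (E * 'rV[R]_m)) (c : E) (V : set 'rV[R]_m) (F : E * 'rV[R]_m -> C) :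
  open U -> open V -> (forall w, V w -> U (c, w)) -> csmooth U F ->
  csmooth V (fun w => F (c, w)).
Proof.
move=> oU oV UV sF.
exact: (csmooth_comp (finite_dim_prod finE (finite_dim_rV R m)) oV oU UV sF (smooth_inr c oV)).
Qed.

Lemma jsmooth_slice W u sigma : open W -> jsmooth W u -> smoothf W (u sigma).
Proof.
move=> oW s x; have oV := chart_image_open (A:=A) (x:=x) oW.
have c1 : (chart AT sigma @` dom AT sigma) (chart AT sigma sigma).
  by exists sigma => //; exact: dom_self.
have H := csmooth_slice (c := chart AT sigma sigma) (jset_open (tau:=sigma) (x:=x) oW) oV _ (s sigma x).
have Hj w : (chart A x @` (dom A x `&` W)) w -> jset sigma x W (chart AT sigma sigma, w).
  by split.
apply: csmooth_ext (H Hj) => // z _ /=.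
by rewrite chartK //; exact: dom_self.
Qed.

Lemma cderive_inr (F : E * 'rV[R]_m -> C) c z w : cdifferentiable F (c, z) ->
  cderive (fun w => F (c, w)) z w = cderive F (c, z) (0, w).
Proof.
move=> dF; have d := is_diff_inr c z.
rewrite (cderive_chain (g := fun w : 'rV[R]_m => (c, w)) _ (is_diffW d) dF).
by rewrite deriveE ?diff_val //; exact: is_diffW d.
Qed.

Lemma cderive_inl (F : E * 'rV[R]_m -> C) c z w : cdifferentiable F (z, c) ->
  cderive (fun w => F (w, c)) z w = cderive F (z, c) (w, 0).
Proof.
move=> dF; have d := is_diff_inl c z.
rewrite (cderive_chain (g := fun w : E => (w, c)) _ (is_diffW d) dF).
by rewrite deriveE ?diff_val //; exact: is_diffW d.
Qed.

Lemma jdiff tau x W u s y : jsmooth W u -> W y -> dom A x y -> dom AT tau s ->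
  cdifferentiable (joint tau x u) (chart AT tau s, chart A x y).
Proof.
move=> su Wy dy ds; apply: (csmooth_cdifferentiable (su tau x)).
by split; [exists s|exists y].
Qed.

Lemma vd_joint tau x W u s X y : open W -> jsmooth W u -> W y -> dom A x y -> dom AT tau s ->
  vd A X (u s) y = \sum_j vd A X (coord A x j) y *
    cderive (joint tau x u) (chart AT tau s, chart A x y) (0, delta_mx 0 j).
Proof.
move=> oW su Wy dy ds; rewrite vdE (dv_chart _ oW (jsmooth_slice s oW su) Wy dy).
apply: eq_bigr => j _; rewrite vdE -(cderive_inr _ (jdiff su Wy dy ds)); congr (_ * _).
by apply: cderive_near; near=> z; rewrite /joint /= chartK.
Unshelve. all: by end_near. Qed.

Lemma jsmooth_vd W u X : open W -> smoothv W X -> jsmooth W u ->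
  jsmooth W (fun tau => vd A X (u tau)).
Proof.
move=> oW sX su tau x; have o := jset_open (tau:=tau) (x:=x) oW.
have sc j : jsmooth (dom A x `&` W) (fun=> vd A X (coord A x j)).
  apply: jsmooth_const; first exact: dom_openI.
  by move/smooth_vfieldP: sX; apply.
have H : csmooth (jset tau x W) (fun z => \sum_j joint tau x (fun=> vd A X (coord A x j)) z *
    cderive (joint tau x u) z (0, delta_mx 0 j)).
  apply: csmooth_sum => // j; apply: csmoothM => //.
    apply: csmooth_sub (sc j tau x) => z [z1 [y [dy Wy] e]]; split => //.
    by exists y.
  exact: csmooth_derive (su tau x).
apply: csmooth_ext H => // z [[s ds e] /chart_imageP[d w e']].
rewrite -e chartK // (vd_joint X oW su w d ds) e e'.
by apply: eq_bigr => j _; rewrite /joint; case: (z).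
Qed.

Lemma dT_joint W u sigma V x y : jsmooth W u -> W y -> dom A x y ->
  dT AT sigma V (u^~ y) = cderive (joint sigma x u) (chart AT sigma sigma, chart A x y) (V, 0).
Proof.
move=> su Wy dy; rewrite -(cderive_inl _ (jdiff su Wy dy (dom_self AT sigma))) /dT.
by apply: cderive_near; near=> z; rewrite /joint /= chartK.
Unshelve. all: by end_near. Qed.

Lemma smooth_dT W u sigma V : open W -> jsmooth W u -> smoothf W (fun y => dT AT sigma V (u^~ y)).
Proof.
move=> oW su x; have oV := chart_image_open (A:=A) (x:=x) oW.
have c1 : (chart AT sigma @` dom AT sigma) (chart AT sigma sigma).
  by exists sigma => //; exact: dom_self.
have H := csmooth_slice (c := chart AT sigma sigma) (jset_open (tau:=sigma) (x:=x) oW) oV _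
  (csmooth_derive (V, 0) (su sigma x)).
have Hj w : (chart A x @` (dom A x `&` W)) w -> jset sigma x W (chart AT sigma sigma, w).
  by split.
apply: csmooth_ext (H Hj) => // z /chart_imageP[d w e].
by rewrite /= (dT_joint _ _ su w d) e.
Qed.

(** In a product chart these are derivatives of one function in the directions (V, 0) and (0,
    delta_j), which commute by Schwarz's theorem; the coefficients of [X] do not depend on the
    parameter. *)
Lemma dT_vd W u sigma V X y : open W -> W y -> smoothv W X -> jsmooth W u ->
  dT AT sigma V (fun tau => vd A X (u tau) y) = vd A X (fun y => dT AT sigma V (u^~ y)) y.
Proof.
move=> oW Wy sX su; have dy := dom_self A y; have ds := dom_self AT sigma.
set c := chart AT sigma sigma; set c' := chart A y y.
have o := jset_open (tau:=sigma) (x:=y) oW; have s := su sigma y.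
have pz : jset sigma y W (c, c') by split; [exists sigma|exists y].
have sj j := csmooth_derive (0 : E, delta_mx 0 j : 'rV[R]_m) s.
have sv := csmooth_derive (V, 0 : 'rV[R]_m) s.
have -> : dT AT sigma V (fun tau => vd A X (u tau) y) = \sum_j vd A X (coord A y j) y *
    cderive (fun z => cderive (joint sigma y u) z (0, delta_mx 0 j)) (c, c') (V, 0).
  have dF j : cdifferentiable (fun t : E => cderive (joint sigma y u) (t, c') (0, delta_mx 0 j)) c.
    have [d1 d2] := csmooth_cdifferentiable (sj j) pz; have d := is_diffW (is_diff_inl c' c).
    by split; [exact: (differentiable_comp d d1)|exact: (differentiable_comp d d2)].
  rewrite /dT (@cderive_near _ _ _ (fun t => \sum_j vd A X (coord A y j) y *
      cderive (joint sigma y u) (t, c') (0, delta_mx 0 j))).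
    apply: etrans (cderive_sum _ _ _ dF).2 _; apply: eq_bigr => j _; apply: congr1.
    exact: (cderive_inl (F := fun z => cderive (joint sigma y u) z (0, delta_mx 0 j))
      _ (csmooth_cdifferentiable (sj j) pz)).
  have Ic : (chart AT sigma @` dom AT sigma) c by exists sigma.
  apply: filterS (open_nbhs_nbhs (conj (chart_open AT sigma) Ic)) => t [t0 d0 <-] /=.
  by rewrite chartK // (vd_joint X oW su Wy dy d0).
rewrite vdE (dv_chart _ oW (smooth_dT sigma V oW su) Wy dy); apply: eq_bigr => j _.
rewrite vdE; apply: congr1; apply: etrans (cderive_swap _ _ o pz s) _.
rewrite -(cderive_inr (F := fun z => cderive (joint sigma y u) z (V, 0)) _ (csmooth_cdifferentiable sv pz)).
apply: cderive_near; apply: filterS (near_chart oW Wy dy) => z [d w e] /=.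
by rewrite (dT_joint _ _ su w d) e.
Qed.

Lemma dT_ext sigma V (a b : T -> C) : (forall tau, a tau = b tau) ->
  dT AT sigma V a = dT AT sigma V b.
Proof. by move=> ab; have -> : a = b by apply/funext. Qed.

Lemma dTD W u u' sigma V y : open W -> W y -> jsmooth W u -> jsmooth W u' ->
  dT AT sigma V (fun tau => u tau y + u' tau y) = dT AT sigma V (u^~ y) + dT AT sigma V (u'^~ y).
Proof.
move=> oW Wy su su'; have dy := dom_self A y; have ds := dom_self AT sigma.
rewrite (dT_joint _ _ su Wy dy) (dT_joint _ _ su' Wy dy).
rewrite (@dT_joint W (fun tau y => u tau y + u' tau y) sigma V y y (jsmoothD oW su su') Wy dy).
exact: (cderiveD _ (jdiff su Wy dy ds) (jdiff su' Wy dy ds)).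
Qed.

Lemma dTM W u u' sigma V y : open W -> W y -> jsmooth W u -> jsmooth W u' ->
  dT AT sigma V (fun tau => u tau y * u' tau y) =
  dT AT sigma V (u^~ y) * u' sigma y + u sigma y * dT AT sigma V (u'^~ y).
Proof.
move=> oW Wy su su'; have dy := dom_self A y; have ds := dom_self AT sigma.
rewrite (dT_joint _ _ su Wy dy) (dT_joint _ _ su' Wy dy).
rewrite (@dT_joint W (fun tau y => u tau y * u' tau y) sigma V y y (jsmoothM oW su su') Wy dy).
have := cderiveM (V, 0 : 'rV[R]_m) (jdiff su Wy dy ds) (jdiff su' Wy dy ds).
by rewrite /joint /= !chartK.
Qed.

Lemma dT_cst sigma V (c : C) : dT AT sigma V (fun=> c) = 0.
Proof. exact: cderive_cst. Qed.

Lemma dTZ W u c sigma V y : open W -> W y -> jsmooth W u ->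
  dT AT sigma V (fun tau => c * u tau y) = c * dT AT sigma V (u^~ y).
Proof.
move=> oW Wy su; have sc := jsmooth_const oW (smooth_on_cst A c oW).
by rewrite (dTM (u := fun _ _ => c) sigma V oW Wy sc su) dT_cst mul0r add0r.
Qed.

Lemma dT_sum W (I : Type) (r : seq I) (u : I -> T -> M -> C) sigma V y : open W -> W y ->
  (forall i, jsmooth W (u i)) ->
  dT AT sigma V (fun tau => \sum_(i <- r) u i tau y) = \sum_(i <- r) dT AT sigma V ((u i)^~ y).
Proof.
move=> oW Wy su; elim: r => [|i r IH].
  rewrite big_nil; apply: etrans (dT_cst sigma V 0).
  by apply: dT_ext => t; rewrite big_nil.
rewrite big_cons -IH -(dTD sigma V oW Wy (su i) (jsmooth_sum r oW su)).
by apply: dT_ext => t; rewrite big_cons.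
Qed.

End JointCalculus.

(** * Smoothness of inverse matrices *)

Section SmoothInverse.
Variables (R : realType) (m : nat) (M : topologicalType) (A : atlas 'rV[R]_m M).
Local Notation C := R[i].
Local Notation smoothf := (smooth_on A).
Implicit Types (W : set M).

Lemma smooth_on_prod W (I : Type) (r : seq I) (f : I -> M -> C) : open W ->
  (forall i, smoothf W (f i)) -> smoothf W (fun x => \prod_(i <- r) f i x).
Proof.
move=> oW sf; elim: r => [|i r IH].
  by apply: (smooth_on_ext oW _ (smooth_on_cst A 1 oW)) => x _; rewrite big_nil.
by apply: (smooth_on_ext oW _ (smooth_onM oW (sf i) IH)) => x _; rewrite big_cons.
Qed.

Lemma smooth_det W n (F : M -> 'M[C]_n) : open W ->
  (forall i j, smoothf W (fun y => F y i j)) -> smoothf W (fun y => \det (F y)).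
Proof.
move=> oW sF; apply: smooth_on_sum => // s; apply: smooth_onM => //.
  exact: smooth_on_cst.
exact: smooth_on_prod.
Qed.

(** Cramer's rule: the entries are cofactors divided by the determinant, which has no zero on
    [W]. *)
Lemma smooth_invmx W n (F : M -> 'M[C]_n) : open W -> (forall y, W y -> F y \in unitmx) ->
  (forall i j, smoothf W (fun y => F y i j)) ->
  forall i j, smoothf W (fun y => invmx (F y) i j).
Proof.
move=> oW uF sF i j.
have dn y : W y -> \det (F y) != 0 by move=> /uF; rewrite unitmxE unitfE.
have sd := smooth_onV oW dn (smooth_det oW sF).
have sc : smoothf W (fun y => cofactor (F y) j i).
  apply: smooth_onM => //; first exact: smooth_on_cst.
  apply: smooth_det => // a c.
  have -> : (fun y => row' j (col' i (F y)) a c) = (fun y => F y (fintype.lift j a) (fintype.lift i c)).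
    by apply/funext => y; rewrite !mxE.
  exact: sF.
by apply: (smooth_on_ext oW _ (smooth_onM oW sd sc)) => y Wy; rewrite /invmx uF // !mxE.
Qed.

End SmoothInverse.

(** * Tensor components as matrix products *)

Section FrameMatrices.
Variables (R : realType) (m : nat) (M : topologicalType) (A : atlas 'rV[R]_m M).
Local Notation C := R[i].
Local Notation cx := (map_mx (real_complex R)).
Implicit Types (x y : M) (B : M -> 'M[C]_m).

Definition frame_mx x y : 'M[C]_m := \matrix_i dco A x i y.
Definition coframe_mx x y : 'M[C]_m := \matrix_i diff A (coord A x i) y.

Lemma frame_coframe x y : dom A x y -> frame_mx x y *m (coframe_mx x y)^T = 1%:M.
Proof.
move=> dx; apply/matrixP => i j; rewrite [RHS]mxE -(dv_dcoord_coord i j dx) dv_pairing pairingE.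
by rewrite mxE; apply: eq_bigr => l _; rewrite !mxE.
Qed.

Lemma frameT_coframe x y : dom A x y -> (frame_mx x y)^T *m coframe_mx x y = 1%:M.
Proof. by move=> /frame_coframe/mulmx1C E; rewrite -[LHS]trmxK trmx_mul trmxK E trmx1. Qed.

Lemma form_mul (B U V : 'M[C]_m) i j :
  form B (row i U) (row j V) = (U *m B *m V^T) i j.
Proof. by rewrite /form -row_mul tr_row !mxE; apply: eq_bigr => l _; rewrite !mxE. Qed.

Lemma bivector_comp_mx B x y :
  \matrix_(i, j) bivector_comp A x B i j y = coframe_mx x y *m B y *m (coframe_mx x y)^T.
Proof. by apply/matrixP => i j; rewrite mxE -form_mul !rowK. Qed.

Lemma form_comp_mx B x y :
  \matrix_(i, j) form_comp A x B i j y = frame_mx x y *m B y *m (frame_mx x y)^T.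
Proof. by apply/matrixP => i j; rewrite mxE -form_mul !rowK form_compE. Qed.

Lemma endo_comp_mx B x y :
  \matrix_(i, j) endo_comp A x B i j y = frame_mx x y *m B y *m (coframe_mx x y)^T.
Proof. by apply/matrixP => i j; rewrite mxE -form_mul !rowK endo_compE dv_pairing. Qed.

Lemma invmx_eq (F : fieldType) n (U V : 'M[F]_n) : U *m V = 1%:M -> invmx U = V.
Proof. by move=> E; have [uU _] := mulmx1_unit E; rewrite -[RHS](mulKmx uU) E mulmx1. Qed.

Lemma bivector_invmx (omega : M -> 'M[R]_m) x y : omega y \in unitmx -> dom A x y ->
  coframe_mx x y *m cx (invmx (omega y)) *m (coframe_mx x y)^T =
  invmx (frame_mx x y *m cx (omega y) *m (frame_mx x y)^T).
Proof.
move=> u dx; symmetry; apply: invmx_eq.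
rewrite -!mulmxA (mulmxA (frame_mx x y)^T) frameT_coframe // mul1mx (mulmxA (cx _)) -map_mxM mulmxV //.
by rewrite map_mx1 mul1mx frame_coframe.
Qed.

Lemma frame_change_contr (F : comNzRingType) n (P Q J B : 'M[F]_n) : P^T *m Q = 1%:M ->
  Q *m - (J^T *m B) *m Q^T = - ((P *m J *m Q^T)^T *m (Q *m B *m Q^T)).
Proof.
move=> PQ; rewrite mulmxN mulNmx !trmx_mul trmxK !mulmxA; congr (- (_ *m _ *m _)).
by rewrite -(mulmxA (Q *m _)) PQ mulmx1.
Qed.

(** From J^2 = -1 the inverse of omega J^T is - J^T omega^-1. Thus the components of the inverse
    metric are linear in those of [J], with coefficients that do not depend on sigma; joint
    smoothness passes from [J] to the inverse metric without inverting a matrix that varies with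
    sigma. *)
Lemma bivector_metric (omega J : M -> 'M[R]_m) x y :
  J y *m J y = - 1%:M -> omega y \in unitmx -> dom A x y ->
  coframe_mx x y *m cx (invmx (metric J omega y)) *m (coframe_mx x y)^T =
  - ((frame_mx x y *m cx (J y) *m (coframe_mx x y)^T)^T *m invmx (frame_mx x y *m cx (omega y) *m (frame_mx x y)^T)).
Proof.
move=> J_squared u dx; rewrite -(bivector_invmx u dx).
have -> : invmx (metric J omega y) = - ((J y)^T *m invmx (omega y)).
  apply: invmx_eq; rewrite /metric mulmxN -mulmxA (mulmxA (J y)^T) -trmx_mul J_squared.
  by rewrite linearN /= trmx1 mulNmx mul1mx mulmxN opprK mulmxV.
rewrite map_mxN map_mxM -matrix.map_trmx; exact/frame_change_contr/frameT_coframe.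
Qed.

End FrameMatrices.

(** With J^T B J = - B, the two products expand to h^2 (2 B + terms in e) with opposite signs of
    [e], so they add up to 4 h^2 B, where h = 1/2. *)
Lemma type_sum (F : comNzRingType) n (e h : F) (J B : 'M[F]_n) :
  e * e = -1 -> h + h = 1 -> J^T *m B *m J = - B ->
  (h *: (1%:M - e *: J))^T *m B *m (h *: (1%:M - e *: J)) +
  (h *: (1%:M + e *: J))^T *m B *m (h *: (1%:M + e *: J)) = B.
Proof.
move=> ee hh E.
have h4 : (h * h) *+ 4 = 1.
  by have : (h + h) * (h + h) = 1 by [rewrite hh mulr1]; move=> <-; ring.
have X s : s * s = -1 -> (h *: (1%:M + s *: J))^T *m B *m (h *: (1%:M + s *: J)) =
    (h * h) *: (B *+ 2 + s *: (J^T *m B + B *m J)).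
  have Z a (N : 'M[F]_n) : (a *: N)^T = a *: N^T by apply/matrixP => i j; rewrite !mxE.
  move=> ss; rewrite Z -!scalemxAl -scalemxAr scalerA; congr (_ *: _).
  have TD (N N' : 'M[F]_n) : (N + N')^T = N^T + N'^T by apply/matrixP => i j; rewrite !mxE.
  rewrite TD Z trmx1 !mulmxDl mul1mx !mulmxDr !mulmx1 -!scalemxAl -!scalemxAr.
  rewrite E scalerA ss scaleN1r opprK scalerDr mulr2n [s *: (J^T *m B) + B]addrC addrACA.
  by rewrite [s *: (B *m J) + _]addrC.
rewrite -scaleNr !X ?mulrNN // -scalerDr addrACA -scalerDl addNr scale0r addr0 -mulrnDr.
by rewrite -scaler_nat scalerA mulr_natr h4 scale1r.
Qed.

(** For [g] the inverse metric and [o] the symplectic form, [o *m g] is the complex structure and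
    [g *m (- o)] its transpose. The second hypothesis moves [g *m o] across [B], after which the
    square of [o *m g] gives the sign. *)
Lemma swap_sign (F : comNzRingType) n (g o B : 'M[F]_n) : o *m g *m (o *m g) = - 1%:M ->
  B *m o *m g + g *m o *m B = 0 -> g *m (- o) *m B *m (o *m g) = - B.
Proof.
move=> og /eqP; rewrite addrC addr_eq0 => /eqP E.
rewrite mulmxN !mulNmx E mulNmx opprK -(mulmxA _ o) -!mulmxA.
by move: og; rewrite -!mulmxA => ->; rewrite mulmxN mulmx1.
Qed.

(** * The family of Kaehler structures and the tensors G and Gbar *)

Section KahlerFamily.
Variables (R : realType) (m p : nat) (S : hw_setting R m p).
Local Notation C := R[i].
Local Notation A := (mfd_atlas S).
Local Notation AT := (real_atlas (tei_atlas S)).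
Local Notation cx := (map_mx (real_complex R)).
Local Notation J := (Jfam S).
Local Notation om := (omega S).
Local Notation smoothf := (smooth_on A).
Implicit Types (sigma tau : tei S) (V : cspace R p) (x y : mfd S).

Lemma finite_dim_cspace : finite_dim (cspace R p).
Proof. by apply: finite_dim_prod; apply: finite_dim_rV. Qed.
Local Notation finE := finite_dim_cspace.

Lemma J_squared sigma y : J sigma y *m J sigma y = - 1%:M.
Proof. by case: (Jfam_kahler _ _ _ S sigma) => /(_ y). Qed.

Lemma omega_unit y : om y \in unitmx.
Proof. by case: (omega_symplectic _ _ _ S). Qed.

Lemma omega_tr y : (om y)^T = - om y.
Proof. by case: (omega_symplectic _ _ _ S). Qed.

Lemma J_unit sigma y : J sigma y \in unitmx.
Proof. by have /mulmx1_unit[] : J sigma y *m (- J sigma y) = 1%:M by rewrite mulmxN J_squared opprK. Qed.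

Lemma metric_sym sigma y : (metric (J sigma) om y)^T = metric (J sigma) om y.
Proof. by case: (Jfam_kahler _ _ _ S sigma). Qed.

Lemma metric_unit sigma y : metric (J sigma) om y \in unitmx.
Proof. by rewrite unitmx_mul omega_unit unitmx_tr J_unit. Qed.

Lemma gtilde_sym sigma y : (gtilde S sigma y)^T = gtilde S sigma y.
Proof. by rewrite /gtilde trmx_inv metric_sym. Qed.

(** Symmetry of the metric reads omega J^T = - J omega, hence J omega gtilde = -1, and
    multiplication by [J] concludes. *)
Lemma J_gtilde sigma y : om y *m gtilde S sigma y = J sigma y.
Proof.
have E : om y *m (J sigma y)^T *m gtilde S sigma y = 1%:M by exact: mulmxV (metric_unit sigma y).
have K := metric_sym sigma y; rewrite /metric trmx_mul trmxK omega_tr mulmxN in K.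
have : J sigma y *m (J sigma y *m om y *m gtilde S sigma y) = - J sigma y.
  by rewrite -[J sigma y *m om y]opprK K mulNmx E mulmxN mulmx1.
by rewrite -!mulmxA mulmxA J_squared mulNmx mul1mx => /oppr_inj.
Qed.

(** The point is that the right-hand side does not depend on sigma, so that differentiation gives a
    linear constraint on Gtilde. *)
Lemma gtilde_omega sigma y : gtilde S sigma y *m om y *m gtilde S sigma y = - invmx (om y).
Proof.
rewrite -mulmxA J_gtilde -{1}[gtilde S sigma y]mul1mx -(mulVmx (omega_unit y)) -!mulmxA.
by rewrite (mulmxA (om y)) J_gtilde J_squared mulmxN mulmx1.
Qed.

Lemma smooth_J sigma x i j : smoothf (dom A x) (endo_comp A x (cx \o J sigma) i j).
Proof. exact: (jsmooth_slice finE sigma (dom_open A x) (Jfam_smooth _ _ _ S x i j)). Qed.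

Lemma smooth_omega x i j : smoothf (dom A x) (form_comp A x (cx \o om) i j).
Proof. by case: (omega_symplectic _ _ _ S). Qed.

Lemma jsmooth_gtilde x i j :
  smooth_prod AT A (dom A x) (fun tau => bivector_comp A x (cx \o gtilde S tau) i j).
Proof.
have oD := @dom_open _ _ _ A x.
pose B y := \matrix_(a, c) form_comp A x (cx \o om) a c y.
have uB y : dom A x y -> B y \in unitmx.
  move=> dx; rewrite /B form_comp_mx; have E := bivector_invmx (omega_unit y) dx.
  rewrite unitmx_mul unitmx_mul unitmx_tr andbAC; have /mulmx1_unit[-> _] := frame_coframe dx.
  by rewrite /= map_unitmx omega_unit.
have sB a c : smoothf (dom A x) (fun y => B y a c).
  apply: (smooth_on_ext oD _ (smooth_omega x a c)) => y _.
  by rewrite mxE.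
have sI := smooth_invmx oD uB sB.
have sJ l : smooth_prod AT A (dom A x) (fun tau y =>
    endo_comp A x (cx \o J tau) l i y * invmx (B y) l j).
  by apply: jsmoothM (jsmooth_const _ oD (sI l j)) => //; apply: (Jfam_smooth _ _ _ S).
have sS := jsmoothN oD (jsmooth_sum (index_enum _) oD sJ).
apply: (jsmooth_ext oD _ sS) => tau y dx.
have : (\matrix_(a, c) bivector_comp A x (cx \o gtilde S tau) a c y) i j =
   (- ((\matrix_(a, c) endo_comp A x (cx \o J tau) a c y)^T *m invmx (B y))) i j.
  rewrite bivector_comp_mx endo_comp_mx /B form_comp_mx; congr (fun_of_matrix _ i j).
  exact: (bivector_metric (J_squared tau y) (omega_unit y) dx).
rewrite mxE => ->; rewrite 2!mxE; congr (- _); apply: eq_bigr => l _.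
by rewrite !mxE.
Qed.

Lemma smooth_gtilde sigma x i j :
  smoothf (dom A x) (bivector_comp A x (cx \o gtilde S sigma) i j).
Proof. exact: (jsmooth_slice finE sigma (dom_open A x) (jsmooth_gtilde x i j)). Qed.

Lemma bivector_comp_center (B : mfd S -> 'M[C]_m) y i j : bivector_comp A y B i j y = B y i j.
Proof. by rewrite /bivector_comp !diff_coord_center form_delta. Qed.

Lemma dT_form sigma V y (u v : 'rV[C]_m) :
  dT AT sigma V (fun tau => form (cx (gtilde S tau y)) u v) = - form (Gtilde S sigma V y) u v.
Proof.
have oD := @dom_open _ _ _ A y; have dy := dom_self A y.
pose s i j := jsmooth_gtilde y i j.
pose w tau z := \sum_i \sum_j (u 0 i * v 0 j) * bivector_comp A y (cx \o gtilde S tau) i j z.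
rewrite (@dT_ext _ _ _ _ _ _ _ (fun tau => w tau y)); last first.
  move=> tau; rewrite form_sum; apply: eq_bigr => i _; apply: eq_bigr => j _.
  by rewrite bivector_comp_center mulrAC.
have sc i j : smooth_prod AT A (dom A y) (fun tau z =>
    (u 0 i * v 0 j) * bivector_comp A y (cx \o gtilde S tau) i j z).
  by apply: jsmoothM => //; apply: jsmooth_const => //; apply: smooth_on_cst.
have -> := dT_sum (index_enum _) sigma V oD dy (fun i => jsmooth_sum (index_enum _) oD (sc i)).
rewrite form_sum -sumrN; apply: eq_bigr => i _.
have -> := dT_sum (index_enum _) sigma V oD dy (sc i).
rewrite -sumrN; apply: eq_bigr => j _.
have -> := dTZ (u 0 i * v 0 j) sigma V oD dy (s i j).
rewrite /Gtilde !mxE mulrN mulNr opprK mulrAC; congr (_ * _ * _).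
by apply: dT_ext => tau; rewrite bivector_comp_center mxE.
Qed.

Lemma Gtilde_sym sigma V y : (Gtilde S sigma V y)^T = Gtilde S sigma V y.
Proof.
apply/matrixP => i j; rewrite !mxE; congr (- _); apply: dT_ext => tau.
by rewrite -{1}gtilde_sym mxE.
Qed.

(** The derivative along [V] of the identity [gtilde_omega], entry by entry. *)
Lemma dT_mx_quad sigma V y :
  Gtilde S sigma V y *m cx (om y) *m cx (gtilde S sigma y) +
  cx (gtilde S sigma y) *m cx (om y) *m Gtilde S sigma V y = 0.
Proof.
have oD := @dom_open _ _ _ A y; have dy := dom_self A y.
apply/matrixP => i j.
pose c a l tau z := bivector_comp A y (cx \o gtilde S tau) a l z.
have sc a l : smooth_prod AT A (dom A y) (c a l) by apply: jsmooth_gtilde.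
pose q tau z := \sum_l \sum_r c i r tau z * (cx (om y) r l * c l j tau z).
have so l r : smooth_prod AT A (dom A y) (fun tau z => cx (om y) r l * c l j tau z).
  by apply: jsmoothM => //; apply: jsmooth_const => //; apply: smooth_on_cst.
have st l r : smooth_prod AT A (dom A y) (fun tau z => c i r tau z * (cx (om y) r l * c l j tau z)).
  exact: jsmoothM.
have sq l : smooth_prod AT A (dom A y) (fun tau z => \sum_r c i r tau z * (cx (om y) r l * c l j tau z)).
  exact: jsmooth_sum.
have E0 : dT AT sigma V (fun tau => q tau y) = 0.
  rewrite (@dT_ext _ _ _ _ _ _ _ (fun=> - cx (invmx (om y)) i j)) ?dT_cst // => tau.
  transitivity ((- cx (invmx (om y))) i j); last by rewrite [LHS]mxE.
  rewrite -map_mxN -(gtilde_omega tau y) !map_mxM mxE; apply: eq_bigr => l _.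
  rewrite mxE big_distrl; apply: eq_bigr => r _.
  by rewrite /c !bivector_comp_center mulrA.
have dc a l : dT AT sigma V (c a l ^~ y) = - Gtilde S sigma V y a l.
  rewrite /Gtilde !mxE opprK; apply: dT_ext => tau.
  by rewrite /c bivector_comp_center mxE.
have : - dT AT sigma V (fun tau => q tau y) = 0 by rewrite E0 oppr0.
have -> := dT_sum (index_enum _) sigma V oD dy sq; rewrite -sumrN => E.
have mxM (P Q : 'M[C]_m) a l : (P *m Q) a l = \sum_r P a r * Q r l by rewrite mxE.
move: (Gtilde S sigma V y) dc => B dc.
transitivity ((B *m cx (om y) *m cx (gtilde S sigma y)) i j +
  (cx (gtilde S sigma y) *m cx (om y) *m B) i j); first by rewrite mxE.
rewrite [RHS]mxE -[RHS]E !mxM -big_split; apply: eq_bigr => l _.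
have -> := dT_sum (index_enum _) sigma V oD dy (st l).
rewrite -sumrN !mxM !big_distrl -big_split; apply: eq_bigr => r _.
have -> := dTM sigma V oD dy (sc i r) (so l r).
have -> := dTZ (cx (om y) r l) sigma V oD dy (sc l j).
rewrite !dc /c !bivector_comp_center /=.
move: (B i r) (B l j) (cx (om y) r l) (cx _ _ _) (cx _ _ _).
by move=> *; ring.
Qed.

(** [swap_sign] applied to [dT_mx_quad], with omega gtilde = J. It says that Gtilde has no part of
    type (1,1). *)
Lemma Gtilde_type sigma V y :
  (cx (J sigma y))^T *m Gtilde S sigma V y *m cx (J sigma y) = - Gtilde S sigma V y.
Proof.
have E := dT_mx_quad sigma V y.
rewrite -J_gtilde map_mxM trmx_mul matrix.map_trmx matrix.map_trmx gtilde_sym omega_tr map_mxN.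
by apply: swap_sign E; rewrite -!map_mxM !J_gtilde J_squared map_mxN map_mx1.
Qed.

Lemma Gtilde_split sigma V y : Gtilde S sigma V y = G S sigma V y + Gbar S sigma V y.
Proof.
rewrite /G /Gbar /P10 /P01; symmetry; apply: type_sum (Gtilde_type sigma V y).
  exact: imag_sqr.
by have := splitr (1 : C); rewrite mul1r => <-.
Qed.

Lemma G_sym sigma V y : (G S sigma V y)^T = G S sigma V y.
Proof. by rewrite /G !trmx_mul trmxK Gtilde_sym mulmxA. Qed.

Lemma Gbar_sym sigma V y : (Gbar S sigma V y)^T = Gbar S sigma V y.
Proof. by rewrite /Gbar !trmx_mul trmxK Gtilde_sym mulmxA. Qed.

Lemma dT_contr_gtilde sigma V y h h' :
  dT AT sigma V (fun tau => dv A (contr A (cx \o gtilde S tau) h y) h' y) =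
  - dv A (contr A (Gtilde S sigma V) h y) h' y.
Proof.
rewrite dv_contr -dT_form; apply: dT_ext => tau.
by rewrite dv_contr.
Qed.

Lemma smooth_Gtilde sigma V x i j :
  smoothf (dom A x) (bivector_comp A x (Gtilde S sigma V) i j).
Proof.
have oD := @dom_open _ _ _ A x.
have s := smooth_onN oD (smooth_dT finE sigma V oD (jsmooth_gtilde x i j)).
apply: (smooth_on_ext oD _ s) => y _; rewrite -[RHS]opprK; congr (- _).
exact: dT_form.
Qed.

Lemma smooth_type_part (P : mfd S -> 'M[C]_m) (B : mfd S -> 'M[C]_m) :
  (forall x i j, smoothf (dom A x) (endo_comp A x P i j)) ->
  (forall x i j, smoothf (dom A x) (bivector_comp A x B i j)) ->
  forall x i j, smoothf (dom A x) (bivector_comp A x (fun y => (P y)^T *m B y *m P y) i j).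
Proof.
move=> sP sB x i j; have oD := @dom_open _ _ _ A x.
pose MP y := \matrix_(a, c) endo_comp A x P a c y.
pose MB y := \matrix_(a, c) bivector_comp A x B a c y.
have smP : smooth_mx A (dom A x) MP.
  by move=> a c; apply: (smooth_on_ext oD _ (sP x a c)) => y _; rewrite mxE.
have smB : smooth_mx A (dom A x) MB.
  by move=> a c; apply: (smooth_on_ext oD _ (sB x a c)) => y _; rewrite mxE.
have s := smooth_mxM oD (smooth_mxM oD (smooth_mx_tr smP) smB) smP.
apply: (smooth_on_ext oD _ (s i j)) => y dx.
transitivity ((\matrix_(a, c) bivector_comp A x (fun y => (P y)^T *m B y *m P y) a c y) i j);
  last by rewrite mxE.
rewrite bivector_comp_mx; congr (fun_of_matrix _ i j); rewrite /MP /MB endo_comp_mx bivector_comp_mx.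
have QP : (coframe_mx A x y)^T *m frame_mx A x y = 1%:M.
  by rewrite -[LHS]trmxK trmx_mul trmxK frameT_coframe // trmx1.
move: (frame_mx A x y) (coframe_mx A x y) (P y) (B y) (frameT_coframe dx) QP => U U' P1 B1 E1 E2.
rewrite !trmx_mul trmxK !mulmxA -(mulmxA _ U^T) E1 mulmx1.
by rewrite -(mulmxA _ U'^T U) E2 mulmx1.
Qed.

(** The values - i and i of [e] give the projections [P10] and [P01]. *)
Lemma smooth_type_projection sigma (e : C) x i j :
  smoothf (dom A x) (endo_comp A x (fun y => 2^-1 *: (1%:M + e *: cx (J sigma y))) i j).
Proof.
have oD := @dom_open _ _ _ A x.
have s := smooth_onM oD (smooth_on_cst A 2^-1 oD)
  (smooth_onD oD (smooth_on_cst A (i == j)%:R oD)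
     (smooth_onM oD (smooth_on_cst A e oD) (smooth_J sigma x i j))).
apply: (smooth_on_ext oD _ s) => y dx; rewrite /endo_comp.
have := dv_dcoord_coord i j dx; rewrite dv_pairing -dcoE => <-.
by rewrite -scalemxAr mulmxDr mulmx1 -scalemxAr /pairing -scalemxAl mulmxDl -scalemxAl !mxE.
Qed.

Lemma smooth_G sigma V x i j : smoothf (dom A x) (bivector_comp A x (G S sigma V) i j).
Proof.
apply: smooth_type_part (smooth_Gtilde sigma V) x i j => x i j.
by have := smooth_type_projection sigma (- 'i%C) x i j; under eq_fun do rewrite scaleNr.
Qed.

Lemma smooth_Gbar sigma V x i j : smoothf (dom A x) (bivector_comp A x (Gbar S sigma V) i j).
Proof.
apply: smooth_type_part (smooth_Gtilde sigma V) x i j => x i j.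
exact: smooth_type_projection.
Qed.

Lemma jsmooth_FC : smooth_prod AT A setT (FC S).
Proof. exact: Fpot_smooth. Qed.

Lemma smooth_FC sigma : smoothf setT (FC S sigma).
Proof. exact: (jsmooth_slice finE sigma openT jsmooth_FC). Qed.

Lemma smooth_dF sigma V : smoothf setT (dF S sigma V).
Proof. exact: (smooth_dT finE sigma V openT jsmooth_FC). Qed.

Lemma smooth_dF10 sigma V : smoothf setT (dF10 S sigma V).
Proof.
have c a := smooth_on_cst A (a : C) openT.
apply: smooth_onM (openT) (c _) (smooth_onB openT (smooth_dF _ _) _).
exact: smooth_onM openT (c _) (smooth_dF _ _).
Qed.

Lemma smooth_dF01 sigma V : smoothf setT (dF01 S sigma V).
Proof.
have c a := smooth_on_cst A (a : C) openT.
apply: smooth_onM (openT) (c _) (smooth_onD openT (smooth_dF _ _) _).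
exact: smooth_onM openT (c _) (smooth_dF _ _).
Qed.

End KahlerFamily.

(** Here [e] is i and [q] the value of the section. The letters [n], [d], [v] stand for the
    covariant derivative of the section, the derivative of the potential and the divergence, taken
    for G . df (index 1) and Gbar . df (index 2); [d3] is X[V[F]]. *)
Lemma recursion_identity (F : numFieldType) (e n1 n2 d1 d2 d3 v1 v2 q : F) :
  e * (n1 + n2) + (e * (d1 + d2) - e * d3 + e / 2 * (v1 + v2)) * q + e * d3 * q =
  e / 2 * (2 * n1 + (v1 + 2 * d1) * q + (2 * n2 + (v2 + 2 * d2) * q)).
Proof. by field. Qed.

(** * The solution of the first step of the recursion *)

Section FirstOrderTerm.
Variables (R : realType) (m p k : nat) (S : hw_setting R m p).
Local Notation C := R[i].
Local Notation A := (mfd_atlas S).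
Local Notation AT := (real_atlas (tei_atlas S)).
Local Notation cx := (map_mx (real_complex R)).
Local Notation L := (lbundle S).
Local Notation th := (theta S).
Local Notation smoothf := (smooth_on A).
Local Notation ssec := (smooth_section L k).
Local Notation nb := (nb L th k).
Local Notation finE := (finite_dim_cspace R p).
Local Notation FF := (FC S).
Implicit Types (sigma tau : tei S) (V : cspace R p) (x y : mfd S) (f psi : mfd S -> C).

Definition gradient tau f := contr A (cx \o gtilde S tau) f.

Definition first_order f tau psi y : C :=
  - 'i%C * nb y (gradient tau f y) psi + - 'i%C * dv A (gradient tau f y) (FF tau) y * psi y
  + - 'i%C / 2 * divv A (levi S tau) (gradient tau f) y * psi y.

Lemma levi_connection tau : is_connection A (levi S tau).
Proof. by case: (levi_spec _ _ _ S tau). Qed.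

Lemma lbundle_smooth_connection : smooth_connection L th.
Proof. by case: (lbundle_prequantum _ _ _ S). Qed.
Local Notation hL := lbundle_smooth_connection.

Section Fields.
Variables (f : mfd S -> C) (sf : smoothf setT f).
Local Notation X := (fun tau => gradient tau f).

Lemma smooth_gradient tau : smooth_vfield A setT (X tau).
Proof. exact: (smooth_contr (smooth_gtilde tau) openT sf). Qed.

Lemma jsmooth_gradient_coord x j :
  smooth_prod AT A (dom A x) (fun tau => vd A (X tau) (coord A x j)).
Proof.
have oD := @dom_open _ _ _ A x; have sD := smooth_on_sub (@subsetT _ (dom A x)) sf.
have s i : smooth_prod AT A (dom A x) (fun tau y =>
    vd A (dco A x i) f y * bivector_comp A x (cx \o gtilde S tau) i j y).
  apply: jsmoothM (jsmooth_gtilde x i j) => //; apply: jsmooth_const => //.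
  exact: smooth_vd oD (smooth_dcoord A x i) sD.
apply: (jsmooth_ext oD _ (jsmooth_sum (index_enum _) oD s)) => tau y dx.
rewrite vdE /gradient (contr_expand _ oD dx dx sD) dv_suml; apply: eq_bigr => i _.
by rewrite dvZl -vd_contr_coord vdE.
Qed.

Lemma dT_gradient_coord sigma V x y j :
  dT AT sigma V (fun tau => vd A (X tau) (coord A x j) y) =
  - vd A (contr A (Gtilde S sigma V) f) (coord A x j) y.
Proof. by rewrite -dT_contr_gtilde; apply: dT_ext => tau. Qed.

Lemma jsmooth_gradient_lin x (l : 'I_m -> mfd S -> C) : (forall j, smoothf (dom A x) (l j)) ->
  smooth_prod AT A (dom A x) (fun tau y => \sum_j vd A (X tau) (coord A x j) y * l j y).
Proof.
move=> sl; have oD := @dom_open _ _ _ A x; apply: jsmooth_sum => // j.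
by apply: jsmoothM (jsmooth_gradient_coord x j) _ => //; apply: jsmooth_const.
Qed.

Lemma jsmooth_nb_gradient psi x : ssec setT psi ->
  smooth_prod AT A (dom A x) (fun tau => local_comp L k x (fun y => nb y (X tau y) psi)).
Proof.
move=> s; have oD := @dom_open _ _ _ A x; have sD := smooth_section_sub (@subsetT _ (dom A x)) s.
have sl j : smoothf (dom A x) (local_comp L k x (fun y => nb y (dco A x j y) psi)).
  have := smooth_nb hL oD (smooth_dcoord A x j) sD.
  by move=> /(smooth_sectionP _ _ _ oD)/(_ x); rewrite setIid.
apply: (jsmooth_ext oD _ (jsmooth_gradient_lin sl)) => tau y dx.
rewrite /local_comp [in RHS](vec_expand (X tau y) dx) nb_suml big_distrl.
by apply: eq_bigr => j _; rewrite nbZl vdE mulrA.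
Qed.

Lemma jsmooth_gradient_FC x :
  smooth_prod AT A (dom A x) (fun tau y => dv A (X tau y) (FF tau) y).
Proof.
have oD := @dom_open _ _ _ A x.
have sF := jsmooth_sub (@subsetT _ (dom A x)) (@jsmooth_FC _ _ _ S).
have s j := jsmoothM oD (jsmooth_gradient_coord x j)
  (jsmooth_vd finE oD (smooth_dcoord A x j) sF).
apply: (jsmooth_ext oD _ (jsmooth_sum (index_enum _) oD s)) => tau y dx.
by rewrite (dv_expand _ oD (jsmooth_slice finE tau oD sF) dx dx).
Qed.

(** The product rule in the frame of the chart at [y]; [dT_vd] turns the derivatives along [V] of
    the components of dF into the components of d(V[F]). *)
Lemma dT_gradient_FC sigma V y :
  dT AT sigma V (fun tau => dv A (X tau y) (FF tau) y) =
  - dv A (contr A (Gtilde S sigma V) f y) (FF sigma) y + dv A (X sigma y) (dF S sigma V) y.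
Proof.
have oD := @dom_open _ _ _ A y; have dy := dom_self A y.
have sF := jsmooth_sub (@subsetT _ (dom A y)) (@jsmooth_FC _ _ _ S).
have sFj j := jsmooth_vd finE oD (smooth_dcoord A y j) sF.
have s j := jsmoothM oD (jsmooth_gradient_coord y j) (sFj j).
have sl := jsmooth_slice finE _ oD sF.
have sdF := smooth_on_sub (@subsetT _ (dom A y)) (smooth_dF sigma V).
rewrite (@dT_ext _ _ _ _ _ _ _ (fun tau => \sum_j vd A (X tau) (coord A y j) y *
    vd A (dco A y j) (FF tau) y)); last first.
  by move=> tau; rewrite (dv_expand _ oD (sl tau) dy dy).
have -> := dT_sum (index_enum _) sigma V oD dy s.
rewrite (dv_expand _ oD (sl sigma) dy dy) (dv_expand _ oD sdF dy dy).
rewrite -sumrN -big_split; apply: eq_bigr => j _.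
have -> := dTM sigma V oD dy (jsmooth_gradient_coord y j) (sFj j).
rewrite dT_gradient_coord; have -> := dT_vd finE sigma V oD dy (smooth_dcoord A y j) sF.
by rewrite /= !vdE mulNr.
Qed.

Lemma divv_levi tau sigma x y j : dom A x y ->
  divv A (levi S tau) (dco A x j) y = divv A (levi S sigma) (dco A x j) y.
Proof.
move=> dx; apply: (divv_symplectic (levi_spec _ _ _ S tau) (levi_spec _ _ _ S sigma)
  (@smooth_omega _ _ _ S) (smooth_J tau) (smooth_J sigma) (J_squared tau) (J_squared sigma)
  (@omega_unit _ _ _ S)
  (@dom_open _ _ _ A x) dx).
exact: smooth_dcoord.
Qed.

(** The connection can be frozen at a fixed [sigma], since the divergences of coordinate fields are
    the same for all parameters; [tau] is then left only in the components of the gradient. *)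
Lemma divv_gradient sigma tau x y : dom A x y ->
  \sum_q (vd A (dco A x q) (vd A (X tau) (coord A x q)) y +
    vd A (X tau) (coord A x q) y * divv A (levi S sigma) (dco A x q) y) =
  divv A (levi S tau) (X tau) y.
Proof.
move=> dx; have oD := @dom_open _ _ _ A x.
have s := smooth_vfield_sub (@subsetT _ (dom A x)) (smooth_gradient tau).
rewrite (divv_coord (levi_connection tau) oD dx dx s); apply: eq_bigr => q _.
by rewrite (divv_levi tau sigma).
Qed.

Lemma jsmooth_divv_gradient x :
  smooth_prod AT A (dom A x) (fun tau => divv A (levi S tau) (X tau)).
Proof.
(* Freezing the connection takes a reference parameter; over an empty parameter space the claim is
   vacuous. *)
case: (pselect (exists sigma : tei S, True)) => [[sigma _]|no]; last first.
  by move=> tau; case: no; exists tau.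
have oD := @dom_open _ _ _ A x.
have s q := jsmoothD oD
  (jsmooth_vd finE oD (smooth_dcoord A x q) (jsmooth_gradient_coord x q))
  (jsmoothM oD (jsmooth_gradient_coord x q) (jsmooth_const AT oD
    (smooth_divv (levi_connection sigma) oD (smooth_dcoord A x q)))).
apply: (jsmooth_ext oD _ (jsmooth_sum (index_enum _) oD s)) => tau y dx.
exact: divv_gradient.
Qed.

Lemma dT_divv_gradient sigma V y :
  dT AT sigma V (fun tau => divv A (levi S tau) (X tau) y) =
  - divv A (levi S sigma) (contr A (Gtilde S sigma V) f) y.
Proof.
have oD := @dom_open _ _ _ A y; have dy := dom_self A y.
have sc q := jsmooth_gradient_coord y q.
have s1 q := jsmooth_vd finE oD (smooth_dcoord A y q) (sc q).
have sd q := jsmooth_const AT oD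
    (smooth_divv (levi_connection sigma) oD (smooth_dcoord A y q)).
have s2 q := jsmoothM oD (sc q) (sd q).
have s q := jsmoothD oD (s1 q) (s2 q).
have sX := smooth_contr (smooth_Gtilde sigma V) oD (smooth_on_sub (@subsetT _ (dom A y)) sf).
rewrite (@dT_ext _ _ _ _ _ _ _ (fun tau =>
  \sum_q (vd A (dco A y q) (vd A (X tau) (coord A y q)) y +
    vd A (X tau) (coord A y q) y * divv A (levi S sigma) (dco A y q) y))); last first.
  by move=> tau; rewrite (divv_gradient sigma tau dy).
have -> := dT_sum (index_enum _) sigma V oD dy s.
rewrite (divv_coord (levi_connection sigma) oD dy dy sX) -sumrN; apply: eq_bigr => q _.
have -> := dTD sigma V oD dy (s1 q) (s2 q).
have -> := dTM sigma V oD dy (sc q) (sd q).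
rewrite dT_gradient_coord dT_cst mulr0 addr0 mulNr opprD; congr (_ + _).
have -> := dT_vd finE sigma V oD dy (smooth_dcoord A y q) (sc q).
rewrite vdE [in RHS]vdE -(dvN _ oD dy (smooth_vd oD sX (coord_smooth A y q))).
by apply: (dv_ext _ _ oD dy) => z _; rewrite dT_gradient_coord.
Qed.

(** In its vector argument [nb] is a linear form whose coefficients [l] do not depend on [tau], so
    this is a case of [dT_form]. *)
Lemma dT_nb_gradient sigma V psi y :
  dT AT sigma V (fun tau => nb y (X tau y) psi) = - nb y (contr A (Gtilde S sigma V) f y) psi.
Proof.
pose l : 'rV[C]_m := \row_n nb y (dco A y n y) psi.
have E B : nb y (contr A B f y) psi = form (B y) (diff A f y) l.
  by rewrite nb_row /form mxE; apply: eq_bigr => n _; rewrite !mxE.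
by rewrite E -dT_form; apply: dT_ext => tau; rewrite E.
Qed.

Lemma diffop_first_order tau : diffop L k (first_order f tau).
Proof.
have c a := smooth_on_cst A (a : C) openT.
have sX := smooth_gradient tau.
apply: diffopD; first apply: diffopD.
- exact: diffopZ (c _) (diffop_nabla _ hL sX).
- apply: diffop_mulop; apply: smooth_onM (c _) _ => //; first exact: openT.
  exact: smooth_vd openT sX (smooth_FC tau).
- apply: diffop_mulop; apply: smooth_onM (c _) _ => //; first exact: openT.
  exact: (smooth_divv (levi_connection tau) openT sX).
Qed.

Lemma local_comp_first_order psi x tau y :
  local_comp L k x (first_order f tau psi) y =
  - 'i%C * local_comp L k x (fun z => nb z (X tau z) psi) y +
  (- 'i%C * dv A (X tau y) (FF tau) y + - 'i%C / 2 * divv A (levi S tau) (X tau) y) *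
    local_comp L k x psi y.
Proof.
rewrite /first_order /local_comp; move: (_ ^+ k)^-1 (nb _ _ _) (dv _ _ _ _) (divv _ _ _ _) => *.
by ring.
Qed.

Lemma smooth_first_order : smooth_opfamily S k (first_order f).
Proof.
split=> [tau|psi s x]; first exact: diffop_first_order.
have oD := @dom_open _ _ _ A x.
have c a := jsmooth_const AT oD (smooth_on_cst A (a : C) oD).
have sl : smoothf (dom A x) (local_comp L k x psi).
  have := smooth_section_sub (@subsetT _ (dom A x)) s.
  by move=> /(smooth_sectionP _ _ _ oD)/(_ x); rewrite setIid.
have sj := jsmoothD oD (jsmoothM oD (c (- 'i%C)) (jsmooth_nb_gradient x s))
  (jsmoothM oD (jsmoothD oD (jsmoothM oD (c (- 'i%C)) (jsmooth_gradient_FC x))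
    (jsmoothM oD (c (- 'i%C / 2)) (jsmooth_divv_gradient x))) (jsmooth_const AT oD sl)).
by apply: (jsmooth_ext oD _ sj) => tau y _; rewrite local_comp_first_order.
Qed.

Lemma dT_first_order sigma V psi y : ssec setT psi ->
  dT AT sigma V (fun tau => first_order f tau psi y) =
  'i%C * nb y (contr A (Gtilde S sigma V) f y) psi +
  ('i%C * dv A (contr A (Gtilde S sigma V) f y) (FF sigma) y
   - 'i%C * dv A (X sigma y) (dF S sigma V) y
   + 'i%C / 2 * divv A (levi S sigma) (contr A (Gtilde S sigma V) f) y) * psi y.
Proof.
move=> s; have oD := @dom_open _ _ _ A y; have dy := dom_self A y.
have c a := jsmooth_const AT oD (smooth_on_cst A (a : C) oD).
have j1 := jsmooth_nb_gradient y s.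
have j2 := jsmooth_gradient_FC y.
have j3 := jsmooth_divv_gradient y.
have m1 := jsmoothM oD (c (- 'i%C)) j1.
have m2 := jsmoothM oD (c (- 'i%C)) j2.
have m3 := jsmoothM oD (c (- 'i%C / 2)) j3.
have j23 := jsmoothD oD m2 m3.
have j23c := jsmoothM oD j23 (c (psi y)).
rewrite (@dT_ext _ _ _ _ _ _ _ (fun tau =>
  - 'i%C * local_comp L k y (fun z => nb z (X tau z) psi) y +
  (- 'i%C * dv A (X tau y) (FF tau) y + - 'i%C / 2 * divv A (levi S tau) (X tau) y) * psi y));
  last first.
  by move=> tau; rewrite -(local_comp_center L k y (first_order f tau psi))
    local_comp_first_order (local_comp_center L k y psi).
have -> := dTD sigma V oD dy m1 j23c.
have -> := dTM sigma V oD dy j23 (c (psi y)).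
have -> := dTD sigma V oD dy m2 m3.
have -> := dTZ (- 'i%C) sigma V oD dy j1.
have -> := dTZ (- 'i%C) sigma V oD dy j2.
have -> := dTZ (- 'i%C / 2) sigma V oD dy j3.
rewrite dT_cst mulr0 addr0 (@dT_ext _ _ _ _ _ _ _ (fun tau => nb y (X tau y) psi)); last first.
  by move=> tau; rewrite local_comp_center.
rewrite dT_nb_gradient dT_gradient_FC dT_divv_gradient.
by move: (nb _ _ _) (dv _ _ _ _) (dv _ _ _ _) (divv _ _ _ _) (psi y) => *; ring.
Qed.

Lemma comm_first_order sigma h psi y : smoothf setT h -> ssec setT psi ->
  commop (mulop h) (first_order f sigma) psi y = 'i%C * dv A (X sigma y) h y * psi y.
Proof.
move=> sh s; rewrite /commop /mulop /first_order.
rewrite (nbM _ openT I _ sh s).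
by move: (nb _ _ _) (dv _ _ _ _) (dv _ _ _ _) (divv _ _ _ _) (psi y) (h y) => *; ring.
Qed.

(** [P] is the common shape of [b] and [bbar]. Its term of order zero commutes with [f], and the
    derivative along B . dF contributes (B . dF)[f], which is (B . df)[F] by symmetry of [B]. *)
Lemma comm_bivector_term (B : mfd S -> 'M[C]_m) sigma (c : C) (h : mfd S -> C) psi y :
  (forall x i j, smoothf (dom A x) (bivector_comp A x B i j)) ->
  (forall x, (B x)^T = B x) -> ssec setT psi ->
  let P phi z := laplace L th k (levi S sigma) B phi z
    + 2 * nabla L th k (contr A B (FF sigma)) phi z - c * h z * phi z in
  commop P (mulop f) psi y = 2 * nb y (contr A B f y) psi +
    (divv A (levi S sigma) (contr A B f) y + 2 * dv A (contr A B f y) (FF sigma) y) * psi y.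
Proof.
move=> sB tB s /=; rewrite /commop /mulop !nb_nabla.
rewrite (laplace_comm sB tB (levi_connection sigma) hL openT _ sf s) //.
rewrite (nbM _ openT I _ sf s) (dv_contrC A tB f).
move: (laplace _ _ _ _ _ _ _) (nb _ _ _) (nb _ _ _) (dv _ _ _ _) (divv _ _ _ _) => *.
by ring.
Qed.

Lemma comm_b sigma V psi y : ssec setT psi ->
  commop (b S k sigma V) (mulop f) psi y = 2 * nb y (contr A (G S sigma V) f y) psi +
    (divv A (levi S sigma) (contr A (G S sigma V) f) y +
     2 * dv A (contr A (G S sigma V) f y) (FF sigma) y) * psi y.
Proof. exact: comm_bivector_term (smooth_G sigma V) (G_sym sigma V). Qed.

Lemma comm_bbar sigma V psi y : ssec setT psi ->
  commop (bbar S k sigma V) (mulop f) psi y = 2 * nb y (contr A (Gbar S sigma V) f y) psi +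
    (divv A (levi S sigma) (contr A (Gbar S sigma V) f) y +
     2 * dv A (contr A (Gbar S sigma V) f y) (FF sigma) y) * psi y.
Proof. exact: comm_bivector_term (smooth_Gbar sigma V) (Gbar_sym sigma V). Qed.

Lemma commDl (P Q : (mfd S -> C) -> mfd S -> C) psi y :
  commop (fun phi z => P phi z + Q phi z) (mulop f) psi y =
  commop P (mulop f) psi y + commop Q (mulop f) psi y.
Proof.
by rewrite /commop /mulop; move: (P _ _) (P _ _) (Q _ _) (Q _ _) => *; ring.
Qed.

Lemma dF_T_first_order sigma V : eq_op_on L k
  (dF_T S (first_order f) sigma V)
  (fun psi x => 'i%C / 2 *
     commop (fun phi y => b S k sigma V phi y + bbar S k sigma V phi y) (mulop f) psi x).
Proof.
move=> psi s y; rewrite /dF_T dT_first_order // (comm_first_order _ _ (smooth_dF sigma V) s).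
rewrite commDl comm_b // comm_bbar //.
have E : contr A (Gtilde S sigma V) f =
    (fun z => contr A (G S sigma V) f z + contr A (Gbar S sigma V) f z).
  by apply/funext => z; rewrite /contr Gtilde_split mulmxDr.
rewrite E (divvD (levi_connection sigma) openT) //; last first.
- exact: (smooth_contr (smooth_Gbar sigma V) openT sf).
- exact: (smooth_contr (smooth_G sigma V) openT sf).
by rewrite nbDl dvDl recursion_identity.
Qed.

End Fields.
End FirstOrderTerm.

(** * The coefficients as functions of s *)

Section Coefficients.
Variables (R : realType) (k : nat).
Local Notation C := R[i].

(** [d] will be t or its conjugate. Its modulus cancels against |t|, and what remains is the modulus
    of [z] divided by s. *)
Lemma coefficient_little_o (d : R -> C) (z : C) :
  (forall s, Normc.normc (d s) = Normc.normc (Complex k%:R s)) ->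
  (fun s => (Normc.normc (Complex k%:R s) * Normc.normc (z / (s%:C%C * d s))) : R^o)
    @ +oo --> (0 : R^o).
Proof.
move=> Ed.
have lim : (fun s : R => Normc.normc z * s^-1) @ +oo --> Normc.normc z * 0.
  apply: cvgMl_tmp; apply/gtr0_cvgV0; first exact: nbhs_pinfty_gt.
  exact: cvg_id.
rewrite mulr0 in lim; apply: cvg_trans lim; apply: near_eq_cvg; near=> s.
have s0 : 0 < s by near: s; exact: nbhs_pinfty_gt.
have n0 : Normc.normc (Complex k%:R s) != 0.
  by apply/eqP => /Normc.eq0_normc[_ E]; rewrite E ltxx in s0.
rewrite !Normc.normcM Normc.normcV Normc.normcM Ed.
have -> : Normc.normc (s%:C%C : C) = s by rewrite /= expr0n addr0 sqrtr_sqr gtr0_norm.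
by rewrite invfM mulrCA; congr (_ * _); rewrite mulrCA mulfV // mulr1.
Unshelve. all: by end_near.
Qed.

Lemma normc_conj (s : R) : Normc.normc ((Complex k%:R s)^*%C) = Normc.normc (Complex k%:R s : C).
Proof. by rewrite /= sqrrN. Qed.

Lemma tparE (s : R) : tpar k s = k%:R + 'i%C * s%:C%C :> C.
Proof.
rewrite -[k%:R](rmorph_nat (real_complex R)); apply/eqP; rewrite eq_complex /=.
by rewrite !(mul0r, mul1r, mulr0, subr0, addr0, add0r, oppr0) !eqxx.
Qed.

Lemma tpar_conjE (s : R) : (tpar k s)^*%C = k%:R - 'i%C * s%:C%C :> C.
Proof.
rewrite -[k%:R](rmorph_nat (real_complex R)); apply/eqP; rewrite eq_complex /=.
by rewrite !(mul0r, mul1r, mulr0, subr0, addr0, add0r, oppr0) !eqxx.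
Qed.

Lemma tpar_neq0 (s : R) : s != 0 -> tpar k s != 0.
Proof. by rewrite eq_complex negb_and /= => ->; rewrite orbT. Qed.

Lemma tpar_conj_neq0 (s : R) : s != 0 -> (tpar k s)^*%C != 0.
Proof. by rewrite eq_complex negb_and /= oppr_eq0 => ->; rewrite orbT. Qed.

End Coefficients.

Section CoefficientIdentity.
Variable F : numFieldType.

(* With t = k + e s and t' = k - e s, the part of order 1/s of the coefficients cancels:
   e / (2 s) + 1 / (2 t) = e k / (2 s t) and e / (2 s) - 1 / (2 t') = e k / (2 s t'). *)
Lemma asymptotic_identity (e k s t t' : F) (bf b'f br b'r : F) :
  e * e = -1 -> s != 0 -> t != 0 -> t' != 0 -> t = k + e * s -> t' = k - e * s ->
  s^-1 * (e / 2 * (bf + b'f)) + (2 * t)^-1 * (bf + s^-1 * br)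
    - (2 * t')^-1 * (b'f + s^-1 * b'r) =
  e * k / 2 / (s * t) * bf + e * k / 2 / (s * t') * b'f
   + 2^-1 / (s * t) * br + - 2^-1 / (s * t') * b'r.
Proof.
move=> ee s0 t0 t'0 tE t'E.
have c1 : s^-1 * (e / 2) + (2 * t)^-1 = e * k / 2 / (s * t).
  have -> : e * k = e * t + s by rewrite tE mulrDr mulrA ee mulN1r -addrA addNr addr0.
  by field; rewrite s0 t0.
have c2 : s^-1 * (e / 2) - (2 * t')^-1 = e * k / 2 / (s * t').
  have -> : e * k = e * t' - s by rewrite t'E mulrBr mulrA ee mulN1r opprK addrK.
  by field; rewrite s0 t'0.
by rewrite -c1 -c2; field; rewrite s0 t0 t'0.
Qed.

End CoefficientIdentity.

(** * Asymptotics of the covariant derivative of the symbol *)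

Section LittleO.
Variables (R : realType) (m p k : nat) (S : hw_setting R m p).
Local Notation C := R[i].
Local Notation A := (mfd_atlas S).
Local Notation AT := (real_atlas (tei_atlas S)).
Local Notation L := (lbundle S).
Local Notation th := (theta S).
Local Notation smoothf := (smooth_on A).
Local Notation ssec := (smooth_section L k).
Local Notation FF := (FC S).
Implicit Types (sigma tau : tei S) (V : cspace R p) (x y : mfd S) (f psi : mfd S -> C).

Lemma diffop_bivector_term (B : mfd S -> 'M[C]_m) sigma (c : C) (h : mfd S -> C) :
  (forall x i j, smoothf (dom A x) (bivector_comp A x B i j)) ->
  (forall x, (B x)^T = B x) -> smoothf setT h ->
  diffop L k (fun psi z => laplace L th k (levi S sigma) B psi z
    + 2 * nabla L th k (contr A B (FF sigma)) psi z - c * h z * psi z).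
Proof.
move=> sB tB sh; have cst a := smooth_on_cst A (a : C) openT.
have hL := @lbundle_smooth_connection _ _ _ S.
have d1 := diffop_laplace k hL sB tB (levi_connection sigma).
have d2 := diffopZ (cst 2) (diffop_nabla k hL (smooth_contr sB openT (smooth_FC sigma))).
have d3 := diffop_mulop L k (smooth_onM openT (cst (- c)) sh).
apply: (diffop_ext _ (diffopD (diffopD d1 d2) d3)) => psi _ x.
by rewrite nb_nabla /mulop !mulNr.
Qed.

Lemma diffop_b sigma V : diffop L k (b S k sigma V).
Proof. exact: diffop_bivector_term (smooth_G sigma V) (G_sym sigma V) (smooth_dF10 sigma V). Qed.

Lemma diffop_bbar sigma V : diffop L k (bbar S k sigma V).
Proof. exact: diffop_bivector_term (smooth_Gbar sigma V) (Gbar_sym sigma V) (smooth_dF01 sigma V). Qed.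

Variables (f : mfd S -> C) (sf : smoothf setT f).
Local Notation R1 := (first_order k f).

Lemma comm_symbol sigma (c : C) (P : (mfd S -> C) -> mfd S -> C) psi y :
  diffop L k P -> ssec setT psi ->
  commop P (fun phi x => mulop f phi x + c * R1 sigma phi x) psi y =
  commop P (mulop f) psi y + c * commop P (R1 sigma) psi y.
Proof.
move=> /diffop_linear hP s; have [sP lP] := hP.
have [sR _] := diffop_linear (diffop_first_order k sf sigma).
rewrite /commop.
have -> : (fun x => mulop f psi x + c * R1 sigma psi x) = (fun x => c * R1 sigma psi x + mulop f psi x).
  by apply/funext => x; rewrite addrC.
rewrite (lP c _ _ (sR _ s) (ssecM openT sf s)).
move: (P _ _) (P _ _) (mulop _ _ _) (first_order _ _ _ _ _) => *; ring.
Qed.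

(** [mulop f] does not depend on the parameter and commutes with multiplication by [dF], so it
    contributes nothing. *)
Lemma dF_T_symbol sigma V (c : C) psi y : ssec setT psi ->
  dF_T S (fun tau phi x => mulop f phi x + c * R1 tau phi x) sigma V psi y =
  c * dF_T S R1 sigma V psi y.
Proof.
move=> s; rewrite /dF_T mulrDr.
have oD := @dom_open _ _ _ A y; have dy := dom_self A y.
have j := (smooth_first_order k sf).2 psi s y.
have jc := jsmooth_const AT oD (smooth_on_cst A (f y * psi y) oD).
have jcc := jsmooth_const AT oD (smooth_on_cst A c oD).
congr (_ + _).
  rewrite (@dT_ext _ _ _ _ _ _ _ (fun tau => f y * psi y + c * local_comp L k y (R1 tau psi) y));
    last by move=> tau; rewrite local_comp_center.
  have -> := dTD sigma V oD dy jc (jsmoothM oD jcc j).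
  have -> := dTZ c sigma V oD dy j.
  rewrite dT_cst add0r; congr (_ * _); apply: dT_ext => tau.
  by rewrite local_comp_center.
rewrite /commop /mulop.
have [_ lR] := diffop_linear (diffop_first_order k sf sigma).
move: (first_order _ _ _ _ _) (first_order _ _ _ _ _) (dF _ _ _ _) (f y) (psi y) => *.
ring.
Qed.

Lemma little_o_first_order sigma V : little_o_inv L k (fun s =>
  nablaEnd S k s (fun tau psi x => mulop f psi x + (s^-1)%:C%C * R1 tau psi x) sigma V).
Proof.
pose B := b S k sigma V; pose B' := bbar S k sigma V.
have dB : diffop L k B := diffop_b sigma V.
have dB' : diffop L k B' := diffop_bbar sigma V.
have dR := diffop_first_order k sf sigma.
have df := diffop_mulop L k sf.
(* The four commutators of [b] and [bbar] with [f] and with the first-order term. Those with [f]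
   carry the coefficients left after the cancellation of order 1/s, and every coefficient is a
   constant divided by s t or by s times the conjugate of t. The defaults of [nth] are never
   reached. *)
exists 4%N, (fun j s => nth 0 [::
    'i%C * k%:R / 2 / (s%:C%C * tpar k s); 'i%C * k%:R / 2 / (s%:C%C * (tpar k s)^*%C);
    2^-1 / (s%:C%C * tpar k s); - 2^-1 / (s%:C%C * (tpar k s)^*%C)] j),
  (fun j => nth (mulop f) [:: commop B (mulop f); commop B' (mulop f);
    commop B (R1 sigma); commop B' (R1 sigma)] j); split.
- by case=> [[|[|[|[|//]]]]] ? /=; apply: diffop_comm.
- near=> s => psi ss y.
  have s0 : s != 0 by rewrite gt_eqF //; near: s; exact: nbhs_pinfty_gt.
  rewrite /nablaEnd dF_T_symbol // dF_T_first_order // commDl !comm_symbol //.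
  rewrite !big_ord_recr big_ord0 /= add0r fmorphV.
  apply: asymptotic_identity.
  + exact: imag_sqr.
  + by rewrite fmorph_eq0.
  + exact: tpar_neq0.
  + exact: tpar_conj_neq0.
  + exact: tparE.
  + exact: tpar_conjE.
- case=> [[|[|[|[|//]]]]] ?.
  + exact: (@coefficient_little_o R k (tpar k) _ (fun=> erefl)).
  + exact: (@coefficient_little_o R k (fun s => (tpar k s)^*%C) _ (normc_conj k)).
  + exact: (@coefficient_little_o R k (tpar k) _ (fun=> erefl)).
  + exact: (@coefficient_little_o R k (fun s => (tpar k s)^*%C) _ (normc_conj k)).
Unshelve. all: by end_near.
Qed.

End LittleO.

Lemma congruence_inv (F : comUnitRingType) n (P N B I : 'M[F]_n) : P *m N *m P^T = B ->
  B *m I = 1%:M -> N *m (P^T *m I *m P) = 1%:M.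
Proof. by move=> <- E; rewrite !mulmxA; apply: mulmx1C; rewrite !mulmxA. Qed.

Lemma congruenceB (F : comNzRingType) n (P U V : 'M[F]_n) :
  P *m (U - V) *m P^T = P *m U *m P^T - P *m V *m P^T.
Proof. by rewrite mulmxBr mulmxBl. Qed.

Lemma congruence_mul (F : comNzRingType) n (P U V N : 'M[F]_n) : U *m P = P *m V ->
  P *m (V *m N) *m P^T = U *m (P *m N *m P^T).
Proof. by move=> E; rewrite !mulmxA E. Qed.

Lemma congruence_cancel (F : comNzRingType) n l (d : 'M[F]_(l, n)) (P Q N : 'M[F]_n) :
  P *m Q = 1%:M -> d *m Q^T *m (P^T *m N *m P) = d *m N *m P.
Proof. by move=> E; rewrite !mulmxA -(mulmxA d) -trmx_mul E trmx1 mulmx1. Qed.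

Lemma subrACA (V : zmodType) (p q r s : V) : p - q - (r - s) = p - r - (q - s).
Proof. by rewrite !opprD !opprK addrACA. Qed.

Lemma power_rule_scale (F : comNzRingType) n (d h l e N : F) :
  d * (l * e) ^+ n + n%:R * h * (l * e) ^+ n.-1 * (l * N) =
  l ^+ n * (d * e ^+ n + n%:R * h * e ^+ n.-1 * N).
Proof.
case: n => [|n]; first by rewrite !mul0r !addr0 !expr0 mul1r.
by rewrite /= !exprMn !exprS; ring.
Qed.

Lemma unit_scale (F : comNzRingType) (u w c c' n d v q : F) : u * w = 1 ->
  u * (c * (w * n) + c * d * q + c' * v * q) = c * n + c * d * (u * q) + c' * v * (u * q).
Proof. by move=> E; rewrite -[c * n]mul1r -E; ring. Qed.

(** * Differences of potentials and smoothness of the metric *)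

Section PotentialDifference.
Variables (R : realType) (m : nat) (M : topologicalType) (A : atlas 'rV[R]_m M).
Local Notation C := R[i].
Local Notation cx := (map_mx (real_complex R)).
Local Notation smoothf := (smooth_on A).
Variable J : M -> 'M[R]_m.
Hypothesis J_smooth : forall x i j, smoothf (dom A x) (endo_comp A x (cx \o J) i j).

Lemma ddbarB (f h : M -> C) x : smoothf setT f -> smoothf setT h ->
  ddbar A J (fun y => f y - h y) x = ddbar A J f x - ddbar A J h x.
Proof.
move=> sf sh; have oD := @dom_open _ _ _ A x; have dx := dom_self A x.
have s l : smoothf setT l -> forall i, smoothf (dom A x) (cov_comp A x (dbar A J l) i).
  by move=> sl i; have := smooth_dbar J_smooth openT sl x i; rewrite setIT.
have E i : cov_comp A x (dbar A J (fun y => f y - h y)) i =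
    (fun y => cov_comp A x (dbar A J f) i y - cov_comp A x (dbar A J h) i y).
  apply/funext => y; rewrite !cov_compE !pr_dbar !vdE.
  exact: (dvB _ openT I sf sh).
have X : ext_d A (dbar A J (fun y => f y - h y)) x =
    ext_d A (dbar A J f) x - ext_d A (dbar A J h) x.
  apply/matrixP => i j; pose e l := esym (ext_d_coord A (dbar A J l) x i j).
  have D v i0 : dv A v (cov_comp A x (dbar A J (fun y => f y - h y)) i0) x =
      dv A v (cov_comp A x (dbar A J f) i0) x - dv A v (cov_comp A x (dbar A J h) i0) x.
    by rewrite E; exact: (dvB _ oD dx (s _ sf i0) (s _ sh i0)).
  apply: etrans (ext_d_coord _ _ _ _ _) _.
  apply: etrans (congr2 (fun u v : C => u - v) (D _ _) (D _ _)) _.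
  apply: etrans (subrACA _ _ _ _) _.
  apply: etrans (congr2 (fun u v : C => u - v) (e f) (e h)) _.
  by move: (ext_d _ _ _) (ext_d _ _ _) => *; rewrite !mxE.
rewrite /ddbar X; move: (P10 J x) (P01 J x) (ext_d _ _ _) (ext_d _ _ _) => U V N N'.
by rewrite !mulmxBr !mulmxBl opprD addrACA.
Qed.

Lemma smooth_form_omega (om : M -> 'M[R]_m) W X Y :
  (forall x i j, smoothf (dom A x) (form_comp A x (cx \o om) i j)) -> open W ->
  smooth_vfield A W X -> smooth_vfield A W Y -> smoothf W (gform om X Y).
Proof.
move=> so oW sX sY; apply: smooth_on_local => x Wx; exists (dom A x `&` W).
  by split=> //; exact: dom_self.
have o := dom_openI A x oW.
have s i : smoothf (dom A x `&` W) (fun y => \sum_j vd A X (coord A x i) y *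
    form_comp A x (cx \o om) i j y * vd A Y (coord A x j) y).
  apply: smooth_on_sum => // j; apply: smooth_onM => //; last first.
    exact: (smooth_vfieldP A W Y).1.
  apply: smooth_onM => //; first exact: (smooth_vfieldP A W X).1.
  by apply: smooth_on_sub (so x i j) => y [].
apply: (smooth_on_ext o _ (smooth_on_sum (index_enum _) o s)) => y [dx _].
rewrite /gform (vec_expand (X y) dx) (vec_expand (Y y) dx) /form.
rewrite !mulmx_suml summxE; apply: eq_bigr => i _.
rewrite linear_sum mulmx_sumr summxE; apply: eq_bigr => j _.
rewrite form_compE /form linearZ /= -!scalemxAl -scalemxAr !mxE !vdE.
by rewrite mulrA mulrAC.
Qed.

Lemma smooth_gform_metric (om : M -> 'M[R]_m) W X Y :
  (forall x i j, smoothf (dom A x) (form_comp A x (cx \o om) i j)) -> open W ->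
  smooth_vfield A W X -> smooth_vfield A W Y -> smoothf W (gform (metric J om) X Y).
Proof.
move=> so oW sX sY.
apply: (smooth_on_ext oW _ (smooth_form_omega so oW sX (smooth_jfield J_smooth oW sY))) => y _.
by rewrite /gform /jfield /form /metric map_mxM trmx_mul matrix.map_trmx !mulmxA.
Qed.

End PotentialDifference.

(** * Equivariance under the group *)

Section Equivariance.
Variables (R : realType) (m p k : nat) (S : hw_setting R m p).
Variables (Gamma : groupType) (a : hw_action S Gamma) (g : Gamma).
Local Notation C := R[i].
Local Notation A := (mfd_atlas S).
Local Notation cx := (map_mx (real_complex R)).
Local Notation L := (lbundle S).
Local Notation th := (theta S).
Local Notation J := (Jfam S).
Local Notation om := (omega S).
Local Notation smoothf := (smooth_on A).
Local Notation ssec := (smooth_section L k).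
Local Notation phi := (actM a g).
Local Notation phi' := (actM a g^-1%g).
Implicit Types (sigma : tei S) (x y : mfd S) (f psi : mfd S -> C).

Lemma actMK : cancel phi phi'.
Proof. by move=> x; rewrite -actMM mulVg actM1. Qed.

Lemma actMVK : cancel phi' phi.
Proof. by move=> x; rewrite -actMM mulgV actM1. Qed.

Let hphi : smooth_map A A phi := actM_smooth _ _ _ _ _ a g.
Let hphi' : smooth_map A A phi' := actM_smooth _ _ _ _ _ a g^-1%g.

(** The metric is built from omega and [J]; the action preserves the one and intertwines the values
    of the other at [sigma] and at its image. *)
Lemma act_isom sigma x : jacobian A phi x *m metric (J (actT a g sigma)) om (phi x)
  *m (jacobian A phi x)^T = metric (J sigma) om x.
Proof.
rewrite /metric -(actM_symplectic _ _ _ _ _ a g x) mulmxA -!mulmxA -!trmx_mul.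
by rewrite (act_equivariant _ _ _ _ _ a g sigma x).
Qed.

Lemma act_gtilde sigma x :
  (jacobian A phi x)^T *m gtilde S sigma x *m jacobian A phi x = gtilde S (actT a g sigma) (phi x).
Proof.
symmetry; apply/invmx_eq/(congruence_inv (act_isom sigma x)).
exact: mulmxV (metric_unit sigma x).
Qed.

(** Both sides are given by the equation of the Ricci potential, and its right-hand sides correspond
    under the isometry: the Ricci form is natural, omega is preserved, and [lambda] is the same
    constant for all parameters. *)
Lemma act_ddbar_FC sigma x :
  ddbar A (J sigma) (FC S (actT a g sigma) \o phi) x = ddbar A (J sigma) (FC S sigma) x.
Proof.
pose tau := actT a g sigma.
rewrite (ddbar_push hphi hphi' actMK actMVK (smooth_J sigma) (smooth_J tau)
  (act_equivariant _ _ _ _ _ a g sigma) x (smooth_FC tau)).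
have i0 : (2 * 'i%C : C) != 0.
  by rewrite mulf_neq0 ?pnatr_eq0 //; apply/eqP => E; have := imag_sqr R; rewrite E mul0r => /eqP;
    rewrite eq_sym oppr_eq0 oner_eq0.
apply: (scalerI i0); rewrite (Fpot_ricci _ _ _ S sigma x) scalemxAl scalemxAr.
pose P := jac A phi x.
apply: etrans (congr1 (fun N => P *m N *m P^T) (Fpot_ricci _ _ _ S tau (phi x))) _.
apply: etrans (congruenceB _ _ _) _; apply: (congr2 (fun U V => U - V)).
  have g1 W Y Z : open W -> smooth_vfield A W Y -> smooth_vfield A W Z ->
      smoothf W (gform (metric (J sigma) om) Y Z).
    exact: (smooth_gform_metric (smooth_J sigma) (@smooth_omega _ _ _ S)).
  have E := ricci_push hphi hphi' actMK actMVK (levi_spec _ _ _ S sigma) (levi_spec _ _ _ S tau)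
    (metric_sym sigma) (metric_sym tau) (metric_unit tau) (act_isom sigma) g1 x.
  apply: etrans _ (esym (congr1 (mulmx (cx (J sigma x))) E)).
  exact: congruence_mul (Jc_equiv (act_equivariant _ _ _ _ _ a g sigma) x).
rewrite -(actM_symplectic _ _ _ _ _ a g x) /P /jac.
by rewrite matrix.map_trmx -!map_mxM -scalemxAr -scalemxAl.
Qed.

Lemma act_potential sigma :
  exists c, forall x, Fpot S (actT a g sigma) (phi x) - Fpot S sigma x = c.
Proof.
have [cplx int _ _] := Jfam_kahler _ _ _ S sigma.
have s1 : smoothf setT (FC S (actT a g sigma) \o phi).
  exact: (smooth_comp hphi openT (smooth_FC (actT a g sigma))).
have E : (fun y => (Fpot S (actT a g sigma) (phi y) - Fpot S sigma y)%:C%C : C) =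
    (fun y => (FC S (actT a g sigma) \o phi) y - FC S sigma y).
  by apply/funext => y; rewrite rmorphB.
apply: (ddbar_eq0_const (smooth_J sigma) cplx int).
- rewrite E; exact: (smooth_onB openT s1 (smooth_FC sigma)).
- exact: mfd_H1_zero.
- exact: no_holomorphic_functions.
- move=> x; rewrite E (ddbarB (smooth_J sigma) _ s1 (smooth_FC sigma)).
  by rewrite act_ddbar_FC subrr.
Qed.

Lemma act_dv_FC sigma v x :
  dv A (v *m jac A phi x) (FC S (actT a g sigma)) (phi x) = dv A v (FC S sigma) x.
Proof.
have [c Ec] := act_potential sigma.
rewrite -(dv_comp hphi _ openT I (smooth_FC (actT a g sigma))).
rewrite (@dv_ext _ _ _ _ setT _ (fun y => FC S sigma y + c%:C%C)) //; last 2 first.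
- exact: openT.
- by move=> y _ /=; rewrite /FC -rmorphD -(Ec y) addrC subrK.
by rewrite (dvD _ I (smooth_FC sigma) (smooth_on_cst A _ openT)) dv_cst addr0.
Qed.

(** The differential of the transported function picks up the transpose of the inverse Jacobian,
    which cancels one of the two Jacobian factors in the transport of the inverse metric. *)
Lemma act_gradient sigma f : smoothf setT f ->
  gradient (actT a g sigma) (f \o phi') = push A phi phi' (gradient sigma f).
Proof.
move=> sf; apply/funext => y; rewrite /push -{1}(actMVK y); move: (phi' y) => {}y.
rewrite /gradient /contr /= -act_gtilde !map_mxM -matrix.map_trmx -/(jac A phi y).
have -> : diff A (f \o phi') (phi y) = diff A f y *m (jac A phi' (phi y))^T.
  apply/rowP => i; rewrite diff_center dcoord_center (dv_comp hphi' _ openT I sf) actMK.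
  by rewrite dv_pairing -pairing_mulr /pairing -rowE !mxE.
exact: congruence_cancel (jacK hphi hphi' actMK y).
Qed.

Lemma act_divv sigma f x : smoothf setT f ->
  divv A (levi S (actT a g sigma)) (push A phi phi' (gradient sigma f)) (phi x) =
  divv A (levi S sigma) (gradient sigma f) x.
Proof.
move=> sf; have sX := smooth_gradient sf sigma; pose tau := actT a g sigma.
apply: (divv_push hphi hphi' actMK actMVK (levi_spec _ _ _ S sigma)
    (levi_spec _ _ _ S tau) (metric_sym sigma) (metric_sym tau) (metric_unit tau)
    (act_isom sigma) _ openT I sX).
by move=> W Y Z oW sY sZ; apply: (smooth_gform_metric (smooth_J sigma) (@smooth_omega _ _ _ S)).
Qed.

Lemma lift_mulV x : lift a g x * lift a g^-1%g (phi x) = 1.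
Proof. by rewrite -{1}(actMK x) -(liftM _ _ _ _ _ a) mulgV lift1. Qed.

(** [lift_connection] concerns the line bundle itself. Near [phi x] the section is [h] times the
    [k]-th power of a frame, so the claim reduces to the chain rule for [h] and to the transport of
    this frame, with one factor of the lift for each power. *)
Lemma act_nb psi x (v : 'rV[C]_m) : ssec setT psi ->
  nb L th k x v (act_section k a g^-1%g psi) =
  lift a g^-1%g (phi x) ^+ k * nb L th k (phi x) (v *m jac A phi x) psi.
Proof.
move=> s; set y := phi x; pose l := lift a g^-1%g y.
have oD := @dom_open _ _ _ A y; have dy := dom_self A y.
have oP := preimage_open hphi oD.
have Px : (phi @^-1` dom A y) x by [].
pose e := frame L y; pose h := local_comp L k y psi.
(* The frame at [y], carried back to a neighbourhood of [x] by the lift of the inverse of [g]. *)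
pose e' z := lift a g^-1%g (phi z) * e (phi z).
have se : smooth_section L 1 (dom A y) e := frame_section L y.
have sh : smoothf (dom A y) h.
  have := smooth_section_sub (@subsetT _ (dom A y)) s.
  by move=> /(smooth_sectionP _ _ _ oD)/(_ y); rewrite setIid.
have se' : smooth_section L 1 (phi @^-1` dom A y) e'.
  by have := lift_smooth _ _ _ _ _ a g^-1%g _ _ oD se; rewrite invgK.
have sh' : smoothf (phi @^-1` dom A y) (h \o phi) := smooth_comp hphi oD sh.
have Ne : nb L th 1 x v e' = l * nb L th 1 y (v *m jac A phi x) e.
  have := lift_connection _ _ _ _ _ a g^-1%g _ _ oD se y dy (v *m jac A phi x).
  rewrite -mulmxA invgK actMK -!nb_nabla_at => E.
  by move: (jacK hphi hphi' actMK x) E => /(congr1 (mulmx v)); rewrite mulmx1 => ->.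
have E1 z : (phi @^-1` dom A y) z ->
    act_section k a g^-1%g psi z = (h \o phi) z * e' z ^+ k.
  move=> dz; rewrite /act_section invgK /= /h /local_comp /e' exprMn mulrCA; congr (_ * _).
  by rewrite divfK // expf_neq0 // frame_neq0.
have E2 z : dom A y z -> psi z = h z * e z ^+ k.
  by move=> dz; rewrite /h /local_comp divfK // expf_neq0 // frame_neq0.
apply: etrans (nb_ext L th k oP Px v E1) _.
apply: etrans (nb_power th k oP Px v sh' se') _; rewrite Ne (dv_comp hphi v oD dy sh).
apply: etrans (power_rule_scale _ _ _ _ _ _) _; congr (_ * _).
apply: etrans _ (esym (nb_ext L th k oD dy (v *m jac A phi x) E2)).
exact: (esym (nb_power th k oD dy (v *m jac A phi x) sh se)).
Qed.

(** Each of the three terms is transported separately; the powers of the lifts of [g] and of its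
    inverse cancel by the cocycle rule. *)
Lemma first_order_equivariant sigma f : smoothf setT f ->
  eq_op_on L k (act_op k a g (first_order k f sigma))
    (first_order k (f \o phi') (actT a g sigma)).
Proof.
move=> sf psi s y; rewrite /act_op /act_section -{3}(actMVK y); move: (phi' y) => x.
rewrite -/(act_section k a g^-1%g psi) /first_order (act_gradient sigma sf).
rewrite act_divv //.
have -> : push A phi phi' (gradient sigma f) (phi x) = gradient sigma f x *m jac A phi x.
  by rewrite /push actMK.
rewrite act_nb // act_dv_FC.
have E : psi (phi x) = lift a g x ^+ k * act_section k a g^-1%g psi x.
  by rewrite /act_section invgK mulrA -exprMn lift_mulV expr1n mul1r.
by rewrite E; apply: unit_scale; rewrite -exprMn lift_mulV expr1n.
Qed.


End Equivariance.

Theorem theorem3 (R : realType) (m p k : nat) (k_gt0 : (0 < k)%N)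
    (S : hw_setting R m p)
    (J_holomorphic : holomorphic_family S)
    (J_rigid : rigid_family S)
    (Gamma : groupType) (a : hw_action S Gamma) :
  exists R1 : (mfd S -> R[i]) ->
              tei S -> (mfd S -> R[i]) -> (mfd S -> R[i]),
    (forall f : mfd S -> R[i], smooth_on (mfd_atlas S) setT f ->
       smooth_opfamily S k (R1 f) /\
       forall sigma V,
         eq_op_on (lbundle S) k
           (dF_T S (R1 f) sigma V)
           (fun psi x => 'i%C / 2 *
              commop (fun phi y => b S k sigma V phi y + bbar S k sigma V phi y)
                     (mulop f) psi x)) /\
    (forall (g : Gamma) (sigma : tei S) (f : mfd S -> R[i]),
       smooth_on (mfd_atlas S) setT f ->
       eq_op_on (lbundle S) k
         (act_op k a g (R1 f sigma))
         (R1 (f \o actM a g^-1%g) (actT a g sigma))) /\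
    (forall f : mfd S -> R[i], smooth_on (mfd_atlas S) setT f ->
       forall sigma V,
         little_o_inv (lbundle S) k (fun s =>
           nablaEnd S k s
             (fun tau psi x => mulop f psi x + (s^-1)%:C%C * R1 f tau psi x)
             sigma V)).
Proof.
exists (@first_order R m p k S); split=> [f sf|].
  by split=> [|sigma V]; [exact: smooth_first_order|exact: dF_T_first_order].
split=> [g sigma f sf|f sf sigma V]; first exact: first_order_equivariant.
exact: little_o_first_order.
Qed.
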